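(* Let $\mathbf x_1,\dots,\mathbf x_m\in\mathbb R^d$ be pairwise distinct and let $P=\sum_{k=1}^m p_k\delta_{\mathbf x_k}$ with $p_k>0$ for all $k$ and $\sum_{k=1}^m p_k=1$. Let $Q$ be a Borel probability measure on $\mathbb R^d$ that is absolutely continuous with respect to Lebesgue measure $\ell_d$, and whose support is connected with Lebesgue negligible boundary, i.e. $\ell_d(\partial\operatorname{supp}(Q))=0$. Let $c(\mathbf x,\mathbf y)=h(\mathbf x-\mathbf y)$ where $h:\mathbb R^d\to[0,\infty)$ satisfies: (A1) $h$ is strictly convex on $\mathbb R^d$; (A2) given a radius $r>0$ and an angle $\theta\in(0,\pi)$, there exists $M=M(r,\theta)>0$ such that for all $\mathbf q\in\mathbb R^d$ with $|\mathbf q|>M$ one can find $\mathbf v\in\mathbb R^d\setminus\{\mathbf 0\}$ such that on the cone with vertex $\mathbf q$ $$K(r,\theta,\mathbf v,\mathbf q)=\{\mathbf x\in\mathbb R^d:\ |\mathbf x-\mathbf q|\,|\mathbf v|\cos(\theta/2)\le\langle\mathbf v,\mathbf x-\mathbf q\rangle\le r|\mathbf v|\}$$ $h$ attains its maximum at $\mathbf q$; (A3) $\lim_{|\mathbf x|\to\infty}h(\mathbf x)/|\mathbf x|=\infty$. Assume $\int c(\mathbf x_i,\mathbf y)\,dQ(\mathbf y)<\infty$ for all $i=1,\dots,m$. Let $P_n$ be the empirical measure of an i.i.d. sample of size $n$ with law $P$. Then, as $n\to\infty$, $$\sqrt n\,\bigl(\mathcal T_c(P_n,Q)-\mathcal T_c(P,Q)\bigr)\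 \overset{w}{\longrightarrow}\ \mathcal N(0,\sigma^2(P,\mathbf z))$$ for $\mathbf z\in\operatorname{Opt}_c(P,Q)$.
   Context: $\overset{w}{\longrightarrow}$ denotes convergence in distribution. $\mathcal T_c(P,Q)=\inf_{\pi\in\Pi(P,Q)}\int c(\mathbf x,\mathbf y)\,d\pi(\mathbf x,\mathbf y)$, where $\Pi(P,Q)$ is the set of probability measures on $\mathbb R^d\times\mathbb R^d$ with marginals $P$ and $Q$. If $X^{(1)},\dots,X^{(n)}$ are i.i.d. with law $P$, then $P_n=\frac1n\sum_{k=1}^n\delta_{X^{(k)}}$. Write $\mathbf p=(p_1,\dots,p_m)$ and, for $\mathbf z\in\mathbb R^m$, $$\mathcal M(\mathbf z,\mathbf p)=\sum_{k=1}^m p_kz_k+\int\min_{i=1,\dots,m}\{c(\mathbf x_i,\mathbf y)-z_i\}\,dQ(\mathbf y),\qquad \operatorname{Opt}_c(P,Q)=\{\mathbf z\in\mathbb R^m:\ \mathcal T_c(P,Q)=\mathcal M(\mathbf z,\mathbf p)\}.$$ The variance is $\sigma^2(P,\mathbf z)=\operatorname{Var}\bigl(\sum_{i=1}^m z_iX_i\bigr)$ with $(X_1,\dots,X_m)\sim\mathcal N(\mathbf 0,\Sigma(\mathbf p))$, where $\Sigma(\mathbf p)_{ii}=p_i(1-p_i)$ and $\Sigma(\mathbf p)_{ij}=-p_ip_j$ for $i\ne j$. $\mathcal N(0,0)$ denotes the Dirac mass at $0$. *)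

(* Defs.v *)
From HB Require Import structures.
From mathcomp Require Import all_boot all_order all_algebra.
From mathcomp Require Import all_classical all_reals all_analysis.
Import Order.TTheory GRing.Theory Num.Theory.
Import numFieldNormedType.Exports.

Set Implicit Arguments.
Unset Strict Implicit.
Unset Printing Implicit Defensive.

Local Open Scope classical_set_scope.
Local Open Scope ring_scope.

Section euclidean.
Context {R : realType} {d : nat}.
Implicit Types (x y v q : 'rV[R]_d).

Definition dotv x y : R := \sum_(i < d) x 0 i * y 0 i.

(* The library norm on ['rV[R]_d] is the sup norm (same topology). *)
Definition enorm x : R := Num.sqrt (dotv x x).

Definition frontier (A : set 'rV[R]_d) : set 'rV[R]_d := closure A `\` interior A.

End euclidean.

(* Convertible to ['rV[R]_d], with the Borel sigma-algebra. *)
Notation borelRV R d := (g_sigma_algebraType (@open 'rV[R]_d)).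

Section lebesgue.
Context {R : realType} {d : nat}.

Definition box (ab : 'rV[R]_d * 'rV[R]_d) : set 'rV[R]_d :=
  [set y | forall i, ab.1 0 i < y 0 i <= ab.2 0 i].

Definition box_volume (ab : 'rV[R]_d * 'rV[R]_d) : R :=
  \prod_(i < d) (ab.2 0 i - ab.1 0 i).

(* Lebesgue outer measure, [0 < d]: the infimum of the total volume over
   countable coverings by half-open boxes. On Borel sets it is the Lebesgue
   measure. For [d = 0] no box is empty and the value is always [+oo]. *)
Definition lebesgueRV (A : set (borelRV R d)) : \bar R :=
  ereal_inf [set (\sum_(k <oo) (box_volume (B k))%:E)%E |
    B in [set B : nat -> 'rV[R]_d * 'rV[R]_d |
      (forall k i, (B k).1 0 i <= (B k).2 0 i) /\
      A `<=` \bigcup_k box (B k)]].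

Definition supp (Q : set (borelRV R d) -> \bar R) : set 'rV[R]_d :=
  [set y | forall U : set 'rV[R]_d, open U -> U y -> (0 < Q U)%E].

End lebesgue.

Section cost.
Context {R : realType} {d : nat}.
Variable h : 'rV[R]_d -> R.

Definition strictly_convex : Prop :=
  forall (x y : 'rV[R]_d) (t : R), x != y -> 0 < t < 1 ->
    h (t *: x + (1 - t) *: y) < t * h x + (1 - t) * h y.

Definition cone (r theta : R) (v q : 'rV[R]_d) : set 'rV[R]_d :=
  [set x | enorm (x - q) * enorm v * cos (theta / 2) <= dotv v (x - q)
           <= r * enorm v].

Definition cone_condition : Prop :=
  forall r theta : R, 0 < r -> 0 < theta < pi ->
  exists2 M : R, 0 < M &
    forall q : 'rV[R]_d, M < enorm q ->
    exists2 v : 'rV[R]_d, v != 0 &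
      cone r theta v q q /\ forall x, cone r theta v q x -> h x <= h q.

Definition superlinear : Prop :=
  forall A : R, exists B : R, forall x : 'rV[R]_d,
    B < enorm x -> A < h x / enorm x.

End cost.

Section transport.
Context {R : realType} {d : nat}.
Local Notation E := (borelRV R d).
Local Open Scope ereal_scope.

Definition coupling (P Q : set E -> \bar R) : set (probability (E * E)%type R) :=
  [set pi | (forall A : set E, measurable A -> pi (A `*` setT) = P A) /\
            (forall B : set E, measurable B -> pi (setT `*` B) = Q B)].

Definition transport_cost (c : 'rV[R]_d -> 'rV[R]_d -> R)
    (P Q : set E -> \bar R) : \bar R :=
  ereal_inf [set \int[pi]_xy (c xy.1 xy.2)%:E | pi in coupling P Q].

Context {m : nat}.

(* [+oo] is neutral for [mine]; it is never the minimum when [0 < m]. *)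
Definition dual_value (c : 'rV[R]_d -> 'rV[R]_d -> R) (x : 'I_m -> 'rV[R]_d)
    (Q : {measure set E -> \bar R}) (z p : 'rV[R]_m) : \bar R :=
  (\sum_(k < m) p ord0 k * z ord0 k)%:E +
  \int[Q]_y \big[mine/+oo]_(i < m) (c (x i) y - z ord0 i)%:E.

Definition Opt (c : 'rV[R]_d -> 'rV[R]_d -> R) (x : 'I_m -> 'rV[R]_d)
    (p : 'rV[R]_m) (P : set E -> \bar R) (Q : {measure set E -> \bar R}) :
    set 'rV[R]_m :=
  [set z | transport_cost c P Q = dual_value c x Q z p].

End transport.

Section sampling.
Context {d' : measure_display} {Omega : measurableType d'} {R : realType}.
Variable Pr : probability Omega R.
Local Open Scope ereal_scope.

Section iid.
Context {d1 : measure_display} {T : measurableType d1}.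

Definition independent_seq (X : nat -> {RV Pr >-> T}) : Prop :=
  forall (J : seq nat) (A : nat -> set T), uniq J ->
    (forall k, measurable (A k)) ->
    Pr (\bigcap_(k in [set` J]) (X k @^-1` A k)) =
    \prod_(k <- J) Pr (X k @^-1` A k).

Definition iid (X : nat -> {RV Pr >-> T}) (P : set T -> \bar R) : Prop :=
  independent_seq X /\
  forall k (A : set T), measurable A -> distribution Pr (X k) A = P A.

Definition empirical (X : nat -> {RV Pr >-> T}) (n : nat) (w : Omega) :
    set T -> \bar R :=
  fun A => (n%:R^-1)%:E * \sum_(k < n) \d_(X k w) A.

End iid.

(* The [Y n] are extended-real valued and need only coincide almost surely with
   genuine real random variables. *)
Definition cvg_in_distribution (Y : nat -> Omega -> \bar R)
    (nu : probability (measurableTypeR R) R) : Prop :=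
  exists2 Z : nat -> {RV Pr >-> R},
    forall n, {ae Pr, forall w, Y n w = (Z n w)%:E} &
    forall f : R -> R, continuous f -> bounded_fun f ->
      'E_Pr[f \o Z n] @[n --> \oo] --> \int[nu]_y (f y)%:E.

End sampling.

(* [v] is the variance; [normal_prob] takes the standard deviation and is not
   the Dirac mass when it is zero. *)
Definition normal_law {R : realType} (mean v : R) :
    probability (measurableTypeR R) R :=
  if v == 0 then [the probability _ _ of \d_(mean : measurableTypeR R)]
  else [the probability _ _ of normal_prob mean (Num.sqrt v)].

(* Covariance of one draw from the multinomial distribution. *)
Definition multinomial_cov {R : realType} {m : nat} (p : 'rV[R]_m) : 'M[R]_m :=
  \matrix_(i, j) if i == j then p ord0 i * (1 - p ord0 i)
                 else - (p ord0 i * p ord0 j).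

Section gaussian_vector.
Context {dG : measure_display} {OmegaG : measurableType dG} {R : realType}.
Variables (PG : probability OmegaG R) (m : nat) (G : 'I_m -> {RV PG >-> R}).

Definition linear_comb (t : 'rV[R]_m) (w : OmegaG) : R :=
  \sum_(i < m) t ord0 i * G i w.

(* [Sigma] may be singular, so a density is not available: a vector is
   N(0, Sigma) when each linear form [t] of it is N(0, t Sigma t^T). *)
Definition centered_gaussian_vector (Sigma : 'M[R]_m) : Prop :=
  forall (t : 'rV[R]_m) (A : set R), measurable A ->
    PG (linear_comb t @^-1` A) =
    normal_law 0 ((t *m Sigma *m t^T) ord0 ord0) A.

End gaussian_vector.

(* Main.v *)
(* Let V(q) be the cost of transporting [\sum_k q_k \d_(x k)] to Q, and let phi
   be the minimum of the [h (x k - .) - z_k]. A coupling splits Q into measures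
   mu_k of mass q_k, and its cost is [\sum_k q_k z_k + \int phi dQ] plus the
   excess [\sum_k \int (h (x k - .) - z_k - phi) dmu_k >= 0]. Optimality of z says
   that plans of weights p reach excesses as small as desired; hence z is a
   subgradient of V at p. It is the gradient: as [supp Q] is connected, for every
   set I of indices the mass which a near-optimal plan assigns to I can be moved
   out of I, in some amount bounded below, at small excess per unit of mass.
   Iterating over I, mass can be moved between any two atoms with excess o(mass),
   and the pairs (weights, excess) which are reachable form a convex set, so
   [V(q) = V(p) + (q - p) . z + o(|q - p|)] for q near p.

   Thus [sqrt n (V(p_n) - V(p))], where p_n are the empirical frequencies, is a
   normalized sum of bounded centred i.i.d. variables up to [o(sqrt n |p_n - p|)].
   Lindeberg's replacement argument, for test functions smoothed by three moving
   averages, gives the Gaussian limit of the sum, and the remainder is controlled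
   by [n E |p_n - p|^2 <= m^2]. *)
Require Import Defs.
From HB Require Import structures.
From mathcomp Require Import all_boot all_order all_algebra.
From mathcomp Require Import all_classical all_reals all_analysis.
From mathcomp Require Import ring lra measurable_realfun.
Import Order.TTheory GRing.Theory Num.Theory.
Import numFieldNormedType.Exports.
Local Open Scope classical_set_scope.
Local Open Scope ring_scope.

Set Implicit Arguments.
Unset Strict Implicit.
Unset Printing Implicit Defensive.

(** * Convex functions and Borel sets of [R^d] *)

(** A subgradient alone yields no limit law: other subgradients at [p] could exist. Rather than
    comparing potentials, the proof bounds the least excess from above and shows that to first order
    it vanishes in each direction [e_j - e_i]. No optimal plan is constructed: upper bounds on the
    excess suffice. Connectedness is used through one function for each [I], the minimum of the
    [h (x j - .) - z_j] outside [I] minus the minimum inside: if its values skipped the interval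
    from [0] to [delta], the support would split, unless one of the two sides is null.

    Measurability of the transport cost of a random measure is never discussed: the cost depends on
    the sample only through the word of its atom labels, so every expectation is a finite sum over
    words. The replacement argument asks for a quadratic expansion with uniform cubic error, hence
    three derivatives and three averages; uniform continuity, which controls the averages, comes
    from compact support. General bounded test functions are then recovered by a cutoff. *)

(** The induction is on partial sums normalised by their weight, so that adding an index is one
    binary combination; a tail of total weight zero has all its weights zero. *)
Lemma convex_set_sum (R : realType) (V : lmodType R) (C : set V)
    (I : finType) (w : I -> R) (y : I -> V) :
  (forall a b t, C a -> C b -> 0 <= t <= 1 -> C (t *: a + (1 - t) *: b)) ->
  (forall i, 0 <= w i) -> \sum_i w i = 1 -> (forall i, C (y i)) ->
  C (\sum_i w i *: y i).
Proof.
move=> Cconv w0 w1 Cy.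
suff H (s : seq I) : 0 < \sum_(i <- s) w i ->
    C ((\sum_(i <- s) w i)^-1 *: \sum_(i <- s) w i *: y i).
  by have := H (index_enum I); rewrite w1 ltr01 invr1 scale1r; exact.
elim: s => [|i s IH]; first by rewrite big_nil ltxx.
rewrite !big_cons.
have [|s0 tot0] := leP (\sum_(j <- s) w j) 0.
  move=> s0 tot0.
  have {}s0 : \sum_(j <- s) w j = 0.
    by apply/eqP; rewrite eq_le s0 sumr_ge0.
  have -> : \sum_(j <- s) w j *: y j = 0.
    rewrite big_seq big1// => j js.
    suff -> : w j = 0 by rewrite scale0r.
    apply/eqP; rewrite eq_le w0 andbT -s0 (perm_big _ (perm_to_rem js))/=.
    by rewrite big_cons lerDl sumr_ge0.
  move: tot0; rewrite s0 !addr0 scalerA => tot0.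
  by rewrite mulVf ?gt_eqF// scale1r.
set W := \sum_(j <- s) w j in s0 tot0 IH *.
set Y := \sum_(j <- s) _ in IH *.
have -> : (w i + W)^-1 *: (w i *: y i + Y) =
    (w i / (w i + W)) *: y i + (1 - w i / (w i + W)) *: (W^-1 *: Y).
  rewrite scalerDr !scalerA; congr (_ *: _ + _ *: _); first by rewrite mulrC.
  by field; rewrite gt_eqF//= gt_eqF.
apply: Cconv; [exact: Cy|exact: IH|].
by rewrite divr_ge0 ?(ltW tot0)//= ler_pdivrMr// mul1r lerDl ltW.
Qed.

Section euclidean_topology.
Context {R : realType} {d : nat}.
Implicit Types (h : 'rV[R]_d -> R).

(* Near [a] the increment of [h] is controlled by its increments along the
   [2 d] axis points [a +/- d e_i]; the reflection through [a] bounds it from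
   below. *)
Lemma convex_continuous h :
  (forall a b t, 0 <= t <= 1 -> h (t *: a + (1 - t) *: b) <= t * h a + (1 - t) * h b) ->
  continuous h.
Proof.
move=> hconv a.
have [d0|d0] := posnP d.
  have -> : h = cst (h a).
    by apply/funext => v /=; congr h; apply/rowP; case => k kd; have : (k < 0)%N by rewrite -d0.
  exact: cst_continuous.
pose D : R := d%:R.
have D0 : 0 < D by rewrite ltr0n.
pose e (i : 'I_d) (s : R) : 'rV[R]_d := s *: delta_mx ord0 i.
pose M := \sum_i (`|h (a + e i D) - h a| + `|h (a + e i (- D)) - h a|).
have M0 : 0 <= M by apply: sumr_ge0 => i _; rewrite addr_ge0.
have coord i t : 0 <= t -> t <= 1 ->
    h (a + e i (D * t)) <= h a + t * M /\ h (a + e i (- (D * t))) <= h a + t * M.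
  move=> t0 t1.
  have aux s : h (a + e i s) - h a <= M -> h (a + t *: e i s) <= h a + t * M.
    move=> sM; have -> : a + t *: e i s = t *: (a + e i s) + (1 - t) *: a.
      by rewrite scalerDr scalerBl scale1r addrAC addrA [t *: a + a]addrC addrK.
    apply: le_trans (hconv _ _ _ _) _; first by rewrite t0.
    have : t * (h (a + e i s) - h a) <= t * M by rewrite ler_wpM2l.
    by lra.
  have Mi : `|h (a + e i D) - h a| + `|h (a + e i (- D)) - h a| <= M.
    by rewrite /M (bigD1 i)//= lerDl sumr_ge0// => j _; rewrite addr_ge0.
  split.
    have -> : e i (D * t) = t *: e i D by rewrite /e scalerA mulrC.
    apply: aux; apply: le_trans (ler_norm _) (le_trans _ Mi).
    by rewrite lerDl.
  have -> : e i (- (D * t)) = t *: e i (- D) by rewrite /e scalerA mulrN mulrC.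
  apply: aux; apply: le_trans (ler_norm _) (le_trans _ Mi).
  by rewrite lerDr.
have upper (v : 'rV[R]_d) t : 0 <= t -> t <= 1 -> (forall i, `|v ord0 i| <= t) ->
    h (a + v) <= h a + t * M.
  move=> t0 t1 vt.
  (* [a + v] is the barycentre of [d] points, each moved from [a] along a single axis; hence the
     factor [d] in the axis points. *)
  have -> : a + v = \sum_(i < d) D^-1 *: (a + e i (D * v ord0 i)).
    rewrite -scaler_sumr big_split/= sumr_const card_ord scalerDr.
    rewrite -scaler_nat scalerA mulVf ?gt_eqF// scale1r; congr (_ + _).
    rewrite {1}[v]row_sum_delta scaler_sumr; apply: eq_bigr => i _.
    by rewrite scalerA mulrA mulVf ?gt_eqF// mul1r.
  apply: (@convex_set_sum _ _ [set v | h v <= h a + t * M]) => //=.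
  - move=> b c s hb hc s01; apply: le_trans (hconv _ _ _ s01) _.
    by move/andP: s01 => [? ?]; nra.
  - by move=> _; rewrite invr_ge0 ltW.
  - by rewrite sumr_const card_ord -mulr_natr mulVf// gt_eqF.
  - move=> i; have [v0|v0] := leP 0 (v ord0 i).
      have vi := vt i; rewrite ger0_norm// in vi.
      have [+ _] := coord i _ v0 (le_trans vi t1).
      by move/le_trans; apply; rewrite lerD2l ler_wpM2r.
    have vi := vt i; rewrite ltr0_norm// in vi.
    have [_ +] := coord i _ (ltW (eqbRL (oppr_gt0 _) v0)) (le_trans vi t1).
    rewrite mulrN opprK.
    by move/le_trans; apply; rewrite lerD2l ler_wpM2r.
apply/(@cvgrPdist_le R R _ (nbhs (a : 'rV[R]_d)) (nbhs_filter _)) => eps eps0.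
have r0 : 0 < Num.min 1 (eps / (M + 1)).
  by rewrite lt_min ltr01 divr_gt0// ltr_pwDr.
apply/nbhs_ballP; exists (Num.min 1 (eps / (M + 1))) => //= y.
rewrite -ball_normE /= distrC lt_min => /andP[/ltW t1 /ltW t2].
have yt : forall i, `|(y - a) ord0 i| <= `|y - a|.
  move=> i; rewrite {2}/Num.norm/= mx_normrE.
  exact: (le_bigmax _ (fun i => `|(y - a) i.1 i.2|) (ord0, i)).
have tM : `|y - a| * M <= eps.
  move: t2; rewrite ler_pdivlMr ?ltr_pwDr//; apply: le_trans.
  by rewrite ler_wpM2l// lerDl.
have up : h y <= h a + `|y - a| * M.
  by rewrite -[in h y](subrK a y) addrC; apply: upper.
have dn : h (a - (y - a)) <= h a + `|y - a| * M.
  by apply: upper => // i; rewrite mxE normrN.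
have mid : h a <= 2^-1 * h y + (1 - 2^-1) * h (a - (y - a)).
  have {1}-> : a = 2^-1 *: y + (1 - 2^-1) *: (a - (y - a)).
    apply/rowP => i; rewrite !mxE; by field.
  by apply: hconv; rewrite invr_ge0 ler0n/= invf_le1// ler1n.
by rewrite ler_norml; apply/andP; split; lra.
Qed.

Lemma strictly_convex_continuous h : strictly_convex h -> continuous h.
Proof.
move=> hconv; apply: convex_continuous => a b t /andP[t0 t1].
have [->|ab] := eqVneq a b.
  by rewrite -scalerDl -mulrDl addrC subrK scale1r mul1r.
move: t0; rewrite le_eqVlt => /predU1P[<-|t0].
  by rewrite scale0r mul0r !add0r subr0 scale1r mul1r.
move: t1; rewrite le_eqVlt => /predU1P[->|t1].
  by rewrite subrr scale0r mul0r !addr0 scale1r mul1r.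
by apply/ltW/hconv => //; rewrite t0.
Qed.

(** A basis of the topology with a countable index type, so that [unpickle] enumerates its
    members. *)
Definition rat_ball (qn : 'rV[rat]_d * nat) : set 'rV[R]_d :=
  ball (map_mx ratr qn.1 : 'rV[R]_d) (qn.2.+1%:R^-1).

Lemma rat_ball_basis (U : set 'rV[R]_d) (y : 'rV[R]_d) : open U -> U y ->
  exists2 qn, rat_ball qn y & rat_ball qn `<=` U.
Proof.
move=> oU Uy; have /nbhs_ballP[e/= e0 yeU] : nbhs y U by exact: open_nbhs_nbhs.
have [n ne] : exists n : nat, n.+1%:R^-1 < e / 2.
  have := @near_infty_natSinv_lt R (PosNum (divr_gt0 e0 (ltr0Sn _ 1))).
  by move=> [n _ /(_ n (leqnn n))]; exists n.
have n0 : 0 < (n.+1%:R^-1 : R) by rewrite invr_gt0 ltr0n.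
have q_ i : {q : rat | (ratr q : R) \in `]y ord0 i - n.+1%:R^-1, y ord0 i + n.+1%:R^-1[}.
  apply: cid; have := @rat_in_itvoo R (y ord0 i - n.+1%:R^-1) (y ord0 i + n.+1%:R^-1).
  by case; [rewrite ltrBlDr -addrA ltrDl addr_gt0|move=> q qi; exists q].
have qy : ball (map_mx ratr (\row_i sval (q_ i)) : 'rV[R]_d) (n.+1%:R^-1) y.
  split=> // i j; rewrite /ball/= !mxE (ord1 i); case: (q_ j) => q /=.
  by rewrite in_itv/= ltr_distl => /andP[-> ->].
exists (\row_i sval (q_ i), n) => // v qv; apply: yeU.
apply: (@le_ball _ _ _ (n.+1%:R^-1 + n.+1%:R^-1)); first by rewrite [leRHS]splitr lerD// ltW.
exact: ball_triangle (ball_sym qy) qv.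
Qed.

Lemma rat_ball_measurable qn : measurable (rat_ball qn : set (borelRV R d)).
Proof. by apply: sub_sigma_algebra; exact: ball_open. Qed.

Lemma continuous_measurable_borelRV (f : 'rV[R]_d -> R) : continuous f ->
  measurable_fun setT (f : borelRV R d -> R).
Proof.
move=> cf; apply: (measurability _ (RGenOpens.measurableE R)).
move=> _ [_ [a [b ->] <-]]; rewrite setTI; apply: sub_sigma_algebra.
by apply: open_comp => // x _; exact: cf.
Qed.

(** The domain carries the product of the Borel sigma-algebras, generated by rectangles. An open set
    belongs to it as a countable union of products of rational balls. *)
Lemma continuous_measurable_borelRV2 (f : 'rV[R]_d * 'rV[R]_d -> R) :
  continuous f -> measurable_fun setT (f : borelRV R d * borelRV R d -> R).
Proof.
move=> cf; apply: (measurability _ (RGenOpens.measurableE R)).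
move=> _ [_ [a [b ->] <-]]; rewrite setTI.
set O := f @^-1` _.
have oO : open O by apply: open_comp => // x _; exact: cf.
pose S k : set (borelRV R d * borelRV R d) :=
  if unpickle k is Some (q1, q2) then
    if `[< rat_ball q1 `*` rat_ball q2 `<=` O >] then rat_ball q1 `*` rat_ball q2
    else set0
  else set0.
have -> : O = \bigcup_k S k.
  apply/seteqP; split => [[u v] Ouv|[u v] [k _]]; last first.
    by rewrite /S; case: unpickle => // -[q1 q2]; case: asboolP => // + uv; exact.
  have [[A B] /= [uA vB] ABO] : nbhs (u, v) O by exact: open_nbhs_nbhs.
  move: uA vB; rewrite !nbhsE => -[A' [oA' A'u] A'A] [B' [oB' B'v] B'B].
  have [q1 q1u q1A] := rat_ball_basis oA' A'u.
  have [q2 q2v q2B] := rat_ball_basis oB' B'v.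
  exists (pickle (q1, q2)) => //; rewrite /S pickleK; case: asboolP => // -[].
  by move=> -[s t] [/= /q1A/A'A As /q2B/B'B Bt]; exact: ABO.
apply: bigcupT_measurable => k; rewrite /S; case: unpickle => // -[q1 q2].
by case: asboolP => // _; apply: measurableX; exact: rat_ball_measurable.
Qed.

(** Every point outside the support lies in a null rational ball, and these balls are countably
    many. *)
Lemma open_setC_supp_null (Q : {measure set (borelRV R d) -> \bar R})
    (U : set 'rV[R]_d) : open U -> supp Q `&` U = set0 -> Q U = 0%E.
Proof.
move=> oU QU.
pose S k : set (borelRV R d) :=
  if unpickle k is Some q then
    if Q (rat_ball q) == 0%E then rat_ball q else set0
  else set0.
have S0 k : Q (S k) = 0%E.
  rewrite /S; case: unpickle => [q|]; last exact: measure0.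
  by case: eqP => // _; exact: measure0.
have mS k : measurable (S k).
  rewrite /S; case: unpickle => // q.
  by case: eqP => // _; exact: rat_ball_measurable.
apply/eqP; rewrite -measure_le0.
have mU : measurable (U : set (borelRV R d)) by exact: sub_sigma_algebra.
apply: (@le_trans _ _ (\sum_(k <oo) Q (S k))%E); last first.
  by rewrite eseries0// => i _ _; exact: S0.
apply: measure_sigma_subadditive => // u Uu.
have /existsNP[W /not_implyP[oW /not_implyP[Wu]]] : ~ supp Q u.
  by move=> Qu; have : (supp Q `&` U) u by []; rewrite QU.
move/negP; rewrite -leNgt measure_le0 => /eqP QW.
have [q qu qW] := rat_ball_basis oW Wu.
exists (pickle q) => //; rewrite /S pickleK ifT// -measure_le0 -QW.
by apply: le_measure; rewrite ?inE//; [exact: rat_ball_measurable|exact: sub_sigma_algebra].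
Qed.

(** If the open strip [0 < D < delta] is null, the support avoids it, so that on the support [0 < D]
    and [delta <= D] define the same set, relatively open and closed. By connectedness it is empty
    or the whole support. *)
Lemma connected_supp_gap (Q : {measure set (borelRV R d) -> \bar R})
    (D : 'rV[R]_d -> R) (delta : R) :
  connected (supp Q) -> continuous D -> 0 < delta ->
  [\/ (0 < Q [set y | (0 < D y < delta)%R])%E, Q [set y | 0 < D y] = 0%E
    | Q [set y | D y < delta] = 0%E].
Proof.
move=> cQ cD d0.
have oD a : open [set y | D y < a].
  rewrite -[X in open X]/(D @^-1` [set r | r < a]).
  by apply: open_comp => // x _; exact: cD.
have oD' a : open [set y | a < D y].
  rewrite -[X in open X]/(D @^-1` [set r | a < r]).
  by apply: open_comp => // x _; exact: cD.
have oI : open [set y | 0 < D y < delta].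
  rewrite (_ : mkset _ = [set y | 0 < D y] `&` [set y | D y < delta]).
    exact: openI.
  by apply/seteqP; split => y /=; [move/andP|move=> [-> ->]].
have [I0|I0] := eqVneq (Q [set y | 0 < D y < delta]) 0%E; last first.
  by apply: Or31; rewrite lt0e I0 measure_ge0.
have Qsplit y : supp Q y -> D y <= 0 \/ delta <= D y.
  move=> Qy; have [|Dy0] := leP (D y) 0; [by left|right].
  rewrite leNgt; apply/negP => Dyd.
  have /(Qy _ oI) : 0 < D y < delta by rewrite Dy0.
  by rewrite I0 ltxx.
have [[y [Qy Dy]]|/set0P/negP/negbNE/eqP hi] :=
    pselect (supp Q `&` [set y | 0 < D y] !=set0); last first.
  by apply: Or32; exact: open_setC_supp_null.
apply: Or33; apply: open_setC_supp_null => //.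
have <- : supp Q `&` [set y | 0 < D y] = supp Q.
  apply: cQ; first by exists y.
  - by exists [set y | 0 < D y].
  - exists [set y | delta <= D y].
      rewrite (_ : mkset _ = ~` [set y | D y < delta]); first exact: open_closedC.
      by apply/seteqP; split => u /=; rewrite leNgt => /negP.
    apply/seteqP; split => u /= [Qu Du]; split => //; last exact: lt_le_trans Du.
    by have [|//] := Qsplit _ Qu; rewrite leNgt Du.
apply/seteqP; split => // u /= [[Qu Du] Dud].
by have [|] := Qsplit _ Qu; rewrite leNgt ?Du ?Dud.
Qed.

End euclidean_topology.

(** * Exchanging mass between the measures of a plan *)

Section plans.
Context {dT : measure_display} {T : measurableType dT} {R : realType} {m : nat}.
Variables (Q : probability T R) (g : 'I_m -> T -> R) (phi : T -> R).
Hypothesis mg : forall i, measurable_fun setT (g i).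
Hypothesis mphi : measurable_fun setT phi.
Hypothesis phi_le : forall i y, phi y <= g i y.
Local Open Scope ereal_scope.

Definition plan (q : 'rV[R]_m) (mu : 'I_m -> {measure set T -> \bar R}) : Prop :=
  (forall k, mu k setT = (q ord0 k)%:E) /\
  (forall B, measurable B -> \sum_(k < m) mu k B = Q B).

Definition gap i y : \bar R := (g i y - phi y)%R%:E.

Definition excess (mu : 'I_m -> {measure set T -> \bar R}) : \bar R :=
  \sum_(k < m) \int[mu k]_y gap k y.

(** [R^o] makes the second coordinate a module, so that pairs admit linear combinations. With an
    inequality in place of an infimum, attainment is not an issue. *)
Definition reachable : set ('rV[R]_m * R^o) :=
  [set qe | exists2 mu, plan qe.1 mu & excess mu <= qe.2%:E].

Lemma gap_ge0 i y : 0 <= gap i y.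
Proof. by rewrite lee_fin subr_ge0. Qed.
Hint Resolve gap_ge0 : core.

Lemma measurable_gap i : measurable_fun setT (gap i).
Proof. by apply/measurable_EFinP; exact: measurable_funB. Qed.
Hint Resolve measurable_gap : core.

Lemma integral_gap_ge0 i (mu : {measure set T -> \bar R}) : 0 <= \int[mu]_y gap i y.
Proof. exact: integral_ge0. Qed.
Hint Resolve integral_gap_ge0 : core.

Lemma integral_gap_add i (a : {nonneg R}) (m1 m2 : {measure set T -> \bar R}) :
  \int[measure_add (mscale a m1) m2]_y gap i y =
  a%:num%:E * \int[m1]_y gap i y + \int[m2]_y gap i y.
Proof. by rewrite ge0_integral_measure_add// ge0_integral_mscale. Qed.

Lemma plan_le q mu k A : plan q mu -> measurable A -> mu k A <= (q ord0 k)%:E.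
Proof. by move=> [<- _] mA; apply: le_measure; rewrite ?inE. Qed.

Lemma plan_fin q mu k A : plan q mu -> measurable A -> mu k A \is a fin_num.
Proof.
move=> pq mA; rewrite ge0_fin_numE//.
by rewrite (le_lt_trans (plan_le k pq mA)) ?ltry.
Qed.

Lemma reachableW q (e e' : R) : (e <= e')%R -> reachable (q, e) -> reachable (q, e').
Proof. by move=> ee' [mu pq Emu]; exists mu => //; rewrite (le_trans Emu)// lee_fin. Qed.

Lemma reachable_convex a b (t : R) : reachable a -> reachable b -> (0 <= t <= 1)%R ->
  reachable (t *: a + (1 - t) *: b)%R.
Proof.
move=> [mu [mu1 mu2] Emu] [nu [nu1 nu2] Enu] /andP[t0 t1].
have s0 : (0 <= 1 - t)%R by rewrite subr_ge0.
pose r k : {measure set T -> \bar R} :=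
  measure_add (mscale (NngNum t0) (mu k)) (mscale (NngNum s0) (nu k)).
have rE k B : r k B = t%:E * mu k B + (1 - t)%:E * nu k B by exact: measure_addE.
exists r.
  split=> [k|B mB].
    by rewrite [LHS]rE mu1 nu1 /= !mxE.
  under eq_bigr do rewrite rE.
  rewrite big_split/= -!ge0_sume_distrr//=.
  by rewrite mu2// nu2// -ge0_muleDl ?lee_fin// -EFinD addrC subrK mul1e.
have -> : excess r = t%:E * excess mu + (1 - t)%:E * excess nu.
  rewrite /excess !ge0_sume_distrr//= -big_split/=; apply: eq_bigr => k _.
  by rewrite integral_gap_add ge0_integral_mscale.
rewrite -[leRHS]/((t * a.2 + (1 - t) * b.2)%R%:E) [leRHS]EFinD !EFinM.
by apply: leeD; apply: lee_wpmul2l.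
Qed.

(* A fraction [l] of the mass that [mu i] puts on [A] is relabelled [j]. *)
Lemma plan_transfer q mu i j A (l delta e : R) : i != j ->
  plan q mu -> measurable A -> (0 <= l <= 1)%R ->
  (forall y, A y -> g j y <= g i y + delta)%R ->
  (0 <= delta)%R -> excess mu <= e%:E ->
  reachable (q + (l * fine (mu i A)) *: (delta_mx ord0 j - delta_mx ord0 i),
             e + l * fine (mu i A) * delta)%R.
Proof.
move=> ij pq mA /andP[l0 l1] Agd delta0 Ee.
have mAC : measurable (~` A) by exact: measurableC.
have [q1 q2] := pq.
have s0 : (0 <= 1 - l)%R by rewrite subr_ge0.
pose rA : {measure set T -> \bar R} := mrestr (mu i) mA.
pose rC : {measure set T -> \bar R} := mrestr (mu i) mAC.
pose nu k : {measure set T -> \bar R} := if k == i then rC else mu k.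
(* [j] receives the share [l] of the restriction of [mu i] to [A], and [i] keeps [1 - l] of it; [nu]
   is the part that stays in place. *)
pose w k : {nonneg R} := if k == i then NngNum s0 else
                         if k == j then NngNum l0 else NngNum (lexx (0 : R)%R).
pose r k : {measure set T -> \bar R} := measure_add (mscale (w k) rA) (nu k).
have rE k B : r k B = (w k)%:num%:E * rA B + nu k B by exact: measure_addE.
have muE B : measurable B -> mu i B = rA B + rC B.
  move=> mB; transitivity (mu i (B `&` A `|` B `&` ~` A)).
    by rewrite -setIUr setUv setIT.
  rewrite measureU//; [exact: measurableI|exact: measurableI|].
  by rewrite setIACA setICr setI0.
have rAT : rA setT = (fine (mu i A))%:E.
  by rewrite -[LHS]/(mu i (setT `&` A)) setTI fineK// (plan_fin i pq).
have wsum (a : 'I_m -> \bar R) : (forall k, 0 <= a k) ->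
    \sum_(k < m) (w k)%:num%:E * a k = (1 - l)%:E * a i + l%:E * a j.
  move=> a0; rewrite (bigD1 i)//= (bigD1 j)/= ?(eq_sym j)// big1 ?adde0.
    by rewrite /w eqxx (eq_sym j) (negbTE ij) eqxx.
  by move=> k /andP[ki kj]; rewrite /w (negbTE ki) (negbTE kj) mul0e.
have nusum (a : 'I_m -> {measure set T -> \bar R} -> \bar R) :
    \sum_(k < m) a k (nu k) = a i rC + \sum_(k < m | k != i) a k (mu k).
  rewrite (bigD1 i)//= /nu eqxx; congr (_ + _).
  by apply: eq_bigr => k /negbTE ->.
have rCT : rC setT = (q ord0 i - fine (mu i A))%:E.
  by rewrite EFinB -q1 muE// rAT addeAC subee// add0e.
exists r.
  split=> [k|B mB].
    rewrite [LHS]rE rAT /= !mxE eqxx /= /nu /w.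
    case: eqVneq => [->|ki].
      by rewrite (negbTE ij) rCT /= -EFinM -EFinD; congr EFin; ring.
    by rewrite q1 -EFinM -EFinD; congr EFin; case: eqVneq => _ /=; ring.
  under eq_bigr do rewrite rE.
  rewrite big_split/= wsum// -ge0_muleDl ?lee_fin// -EFinD subrK mul1e.
  rewrite (nusum (fun k m => m B)) addeA -muE// -q2//.
  by rewrite [RHS](bigD1 i).
have EX : excess mu = \int[rA]_y gap i y + \sum_(k < m) \int[nu k]_y gap k y.
  rewrite (nusum (fun k m => \int[m]_y gap k y)) addeA.
  rewrite -ge0_integral_measure_add// /excess (bigD1 i)//=; congr (_ + _).
  by apply: eq_measure_integral => B mB _; rewrite muE//; apply/esym/measure_addE.
have -> : excess r = (1 - l)%:E * \int[rA]_y gap i y + l%:E * \int[rA]_y gap j y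
    + \sum_(k < m) \int[nu k]_y gap k y.
  rewrite /excess -(wsum (fun k => \int[rA]_y gap k y))// -big_split/=.
  by apply: eq_bigr => k _; rewrite integral_gap_add.
have gapij : \int[rA]_y gap j y <= \int[rA]_y gap i y + (delta * fine (mu i A))%:E.
  have -> : (delta * fine (mu i A))%:E = \int[rA]_y (cst delta%:E) y.
    by rewrite integral_cst// rAT EFinM.
  rewrite -ge0_integralD//.
  apply: ae_ge0_le_integral => //.
  - by move=> y _; rewrite adde_ge0.
  - by apply: emeasurable_funD.
  - exists (~` A); split => //; first by rewrite /rA/= /mrestr setICl measure0.
    move=> y /= + Ay; apply => _.
    by rewrite /gap -EFinD lee_fin lerBlDr addrAC subrK Agd.
apply: (@le_trans _ _ (excess mu + (l * fine (mu i A) * delta)%:E)); last first.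
  by rewrite EFinD leeD2r.
have a0 : (0 <= fine (mu i A))%R by rewrite fine_ge0.
apply: (@le_trans _ _ ((1 - l)%:E * \int[rA]_y gap i y +
    l%:E * (\int[rA]_y gap i y + (delta * fine (mu i A))%:E) +
    \sum_(k < m) \int[nu k]_y gap k y)).
  by rewrite leeD2r// leeD2l// lee_wpmul2l.
rewrite EX; have := integral_gap_ge0 i rA; move: (\int[rA]_y gap i y) => I I0.
rewrite ge0_muleDr ?lee_fin ?mulr_ge0// addeA -ge0_muleDl ?lee_fin//.
rewrite -EFinD subrK mul1e -EFinM addeAC.
by have -> : (l * (delta * fine (mu i A)) = l * fine (mu i A) * delta)%R by ring.
Qed.

(** Pigeonhole principle. Dividing by [m.+1] rather than [m] makes the contradiction strict. *)
Lemma sum_large (P : pred 'I_m) (a : 'I_m -> \bar R) (k : R) : (0 < k)%R ->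
  k%:E <= \sum_(i < m | P i) a i -> exists2 i, P i & (k / m.+1%:R)%:E <= a i.
Proof.
move=> k0 ka; apply: contrapT => /forall2NP H.
have : \sum_(i < m | P i) a i <= \sum_(i < m | P i) (k / m.+1%:R)%:E.
  apply: lee_sum => i Pi; have [//|/negP] := H i.
  by rewrite -ltNge => /ltW.
rewrite sumEFin => /(le_trans ka); rewrite lee_fin leNgt => /negP; apply.
rewrite sumr_const -[X in (X < _)%R]mulr_natr -mulrA gtr_pMr// mulrC ltr_pdivrMr ?ltr0Sn//.
by rewrite mul1r ltr_nat ltnS (leq_trans (max_card _))// card_ord.
Qed.

Lemma gap_markov q mu j S (e : R) : plan q mu -> measurable S -> (0 <= e)%R ->
  (forall y, S y -> e + phi y <= g j y)%R -> e%:E * mu j S <= \int[mu j]_y gap j y.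
Proof.
move=> pq mS e0 Se.
rewrite -[S]setIT -integral_indic// -ge0_integralZl//; last first.
- exact/measurable_EFinP/measurable_indic.
apply: ge0_le_integral => //.
- by move=> y _; rewrite mule_ge0.
- by apply: measurable_funeM; apply/measurable_EFinP/measurable_indic.
- move=> y _; rewrite indicE; have [yS|yS] := boolP (y \in S).
    by rewrite mule1 lee_fin lerBrDr Se// -inE.
  by rewrite mule0.
Qed.

Lemma gap_markov_sum q mu (P : pred 'I_m) S (e : R) :
  plan q mu -> measurable S -> (0 <= e)%R ->
  (forall y j, P j -> S y -> e + phi y <= g j y)%R ->
  e%:E * \sum_(j < m | P j) mu j S <= excess mu.
Proof.
move=> pq mS e0 Se; rewrite ge0_sume_distrr//.
apply: (@le_trans _ _ (\sum_(j < m | P j) \int[mu j]_y gap j y)).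
  by apply: lee_sum => j Pj; apply: (gap_markov pq mS e0) => y; exact: Se.
rewrite /excess [leRHS](bigID P)/= leeDl// sume_ge0//.
Qed.

(** * Moving mass between atoms at vanishing excess *)

Section exchange.
Variable p : 'rV[R]_m.
Hypothesis p_gt0 : forall k, (0 < p ord0 k)%R.
Hypothesis reachable_p : forall eta : R, (0 < eta)%R -> reachable (p, eta).

Let u i j : 'rV[R]_m := (delta_mx ord0 j - delta_mx ord0 i)%R.

(** The hypotheses force [D] to be the minimum of [g] outside [I] minus the minimum inside. Where
    [D < delta], each index of [I] has a competitor outside at extra cost below [delta]; where
    [D > 0], the indices outside pay at least [D], so a plan of small excess cannot leave the region
    [0 < D < delta] to them. The two constants do not depend on the plan. *)
Lemma cheap_mass (I : {set 'I_m}) i0 j0 (D : T -> R) (delta : R) :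
  i0 \in I -> j0 \notin I -> (0 < delta)%R -> measurable_fun setT D ->
  (forall y i, i \in I -> exists2 j, j \notin I & (g j y <= g i y + D y)%R) ->
  (forall y j, j \notin I -> exists2 i, i \in I & (g i y + D y <= g j y)%R) ->
  [\/ 0 < Q [set y | (0 < D y < delta)%R], Q [set y | (0 < D y)%R] = 0
    | Q [set y | (D y < delta)%R] = 0] ->
  exists2 ke : R * R, (0 < ke.1 /\ 0 < ke.2)%R &
    forall mu, plan p mu -> excess mu <= ke.2%:E ->
    exists i j, [/\ i \in I, j \notin I &
      ke.1%:E <= mu i [set y | (g j y <= g i y + delta)%R]].
Proof.
move=> i0I j0I delta0 mD DI DJ trichotomy.
have mDge a : measurable [set y | (a <= D y)%R].
  by rewrite -[X in measurable X]setTI; exact: measurable_fun_le.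
have mDlt a : measurable [set y | (D y < a)%R].
  rewrite (_ : mkset _ = ~` [set y | (a <= D y)%R]); first exact: measurableC.
  by apply/seteqP; split => y /=; rewrite ltNge => /negP.
have mDgt a : measurable [set y | (a < D y)%R].
  rewrite (_ : mkset _ = ~` [set y | (D y <= a)%R]).
    apply: measurableC; rewrite -[X in measurable X]setTI.
    exact: measurable_fun_le.
  by apply/seteqP; split => y /=; rewrite ltNge => /negP.
have mDI a : measurable [set y | (a <= D y)%R /\ (D y < delta)%R].
  exact: (measurableI _ _ (mDge a) (mDlt delta)).
have Dj y j : j \notin I -> (D y + phi y <= g j y)%R.
  move=> jI; have [i iI] := DJ y j jI.
  by apply: le_trans; rewrite addrC lerD2r.
have mA i j : measurable [set y | (g j y <= g i y + delta)%R].
  rewrite -[X in measurable X]setTI; apply: measurable_fun_le => //.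
  by apply: measurable_funD => //; exact: measurable_cst.
(* It is enough to find mass on [D < delta]: for [i] in [I] this region is covered by the sets
   [g j <= g i + delta] with [j] outside [I], and one of them carries a fixed share. *)
suff [[k eta]/= [k0 eta0] H] : exists2 ke : R * R, (0 < ke.1 /\ 0 < ke.2)%R &
    forall mu, plan p mu -> excess mu <= ke.2%:E ->
    exists2 i, i \in I & ke.1%:E <= mu i [set y | (D y < delta)%R].
  exists (k / m.+1%:R, eta)%R => /=; first by rewrite divr_gt0.
  move=> mu pmu /(H _ pmu)[i iI kmu].
  have [|j jI kj] := @sum_large (fun j => j \notin I)
      (fun j => mu i [set y | (g j y <= g i y + delta)%R]) k k0.
    apply: le_trans kmu _.
    rewrite bigfs ?index_enum_uniq//; last first.
      by move=> j _; rewrite mem_index_enum.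
    apply: content_sub_fsum => //.
    move=> y /= Dy; have [j jI gj] := DI y i iI.
    exists j => //=; apply: le_trans gj _.
    by rewrite lerD2l ltW.
  by exists i, j.
case: trichotomy => [Q0|Q0|Q0].
(* [D] has no positive lower bound on the strip; a slice [1 / (n + 1) <= D < delta] of positive mass
   is cut out of it. *)
- have [n] : exists n, 0 < Q [set y | (n.+1%:R^-1 <= D y)%R /\ (D y < delta)%R].
    apply: contrapT => /forallNP H; move: Q0; rewrite ltNge => /negP; apply.
    rewrite measure_le0; apply/eqP.
    rewrite (_ : mkset _ = \bigcup_n [set y | (n.+1%:R^-1 <= D y)%R /\ (D y < delta)%R]).
      apply/eqP; rewrite -measure_le0.
      apply: (@le_trans _ _ (\sum_(n <oo) Q [set y | (n.+1%:R^-1 <= D y)%R /\ (D y < delta)%R])).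
        apply: measure_sigma_subadditive => //.
        by apply: bigcupT_measurable => n; exact: mDI.
      rewrite eseries0// => n _ _; apply/eqP; rewrite -measure_le0 leNgt.
      exact/negP/H.
    apply/seteqP; split => y /=; last first.
      by move=> [n _ /= [nD ->]]; rewrite andbT (lt_le_trans _ nD).
    move=> /andP[D0 Dd]; have [n _ /(_ n (leqnn n)) nD] :=
      @near_infty_natSinv_lt R (PosNum D0).
    by exists n => //=; split => //; exact: ltW.
  set S := [set y | _ /\ _]; set e : R := (n.+1%:R^-1)%R => QS.
  have mS : measurable S by exact: mDI.
  have e0 : (0 < e)%R by rewrite invr_gt0.
  pose k := (fine (Q S) / 2)%R.
  have QSE : Q S = (k + k)%:E by rewrite -splitr fineK// fin_num_measure.
  have k0 : (0 < k)%R.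
    by rewrite divr_gt0// fine_gt0// QS/= ltey_eq fin_num_measure.
  (* With budget [e * k], Markov's inequality leaves to the indices outside [I] at most [k], half
     the mass of the slice. *)
  exists (k / m.+1%:R, e * k)%R => /=; first by rewrite divr_gt0// mulr_gt0.
  move=> mu pmu Emu.
  have J : \sum_(j < m | j \notin I) mu j S <= k%:E.
    have : e%:E * \sum_(j < m | j \notin I) mu j S <= (e * k)%:E.
      apply: le_trans Emu; apply: gap_markov_sum pmu mS (ltW e0) _.
      move=> y j jI [ey _]; apply: le_trans (Dj y _ jI).
      by rewrite lerD2r.
    by rewrite EFinM lee_pmul2l.
  have [|i iI ki] := @sum_large (fun j => j \in I) (fun j => mu j S) k k0.
    rewrite -(@leeD2rE _ (\sum_(j < m | j \notin I) mu j S)).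
      rewrite -(bigID (fun j => j \in I) predT (fun j => mu j S))/= pmu.2// QSE EFinD.
      by rewrite leeD2l.
    rewrite ge0_fin_numE ?sume_ge0//.
    by rewrite (le_lt_trans J) ?ltry.
  exists i => //; apply: (le_trans ki); apply: le_measure; rewrite ?inE//.
  by move=> y [].
(* Here [D <= 0] almost everywhere: all the mass of [mu i0] qualifies, and the budget [1] is
   arbitrary. *)
- exists (p ord0 i0, 1)%R => /=; first by [].
  move=> mu pmu _; exists i0 => //.
  have mu0 : mu i0 [set y | (0 < D y)%R] = 0.
    apply/eqP; rewrite -measure_le0 -Q0 -pmu.2// (bigD1 i0)//= leeDl//.
    exact: sume_ge0.
  rewrite -pmu.1.
  apply: (@le_trans _ _ (mu i0 ([set y | (D y < delta)%R] `|` [set y | (0 < D y)%R]))).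
    apply: le_measure; rewrite ?inE//; first exact: measurableU.
    move=> y _ /=; case: (ltP 0%R (D y)); [by right|move=> Dy].
    by left; exact: le_lt_trans delta0.
  by rewrite (le_trans (measureU2 _ _ _))// [X in _ + X]mu0 adde0.
(* Here [D >= delta] almost everywhere: [mu j0] alone pays [delta * p j0]. The budget is half of
   that, so no plan meets it and the mass [1] is a dummy. *)
- exists (1, delta * (p ord0 j0 / 2))%R => /=.
    by rewrite mulr_gt0// divr_gt0.
  move=> mu pmu Emu.
  have mu0 : mu j0 [set y | (D y < delta)%R] = 0.
    apply/eqP; rewrite -measure_le0 -Q0 -pmu.2// (bigD1 j0)//= leeDl//.
    exact: sume_ge0.
  have : (p ord0 j0)%:E <= mu j0 [set y | (delta <= D y)%R].
    rewrite -pmu.1.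
    apply: (@le_trans _ _ (mu j0 ([set y | (D y < delta)%R] `|` [set y | (delta <= D y)%R]))).
      apply: le_measure; rewrite ?inE//; first exact: measurableU.
      by move=> y _ /=; case: (ltP (D y) delta); [left|right].
    by rewrite (le_trans (measureU2 _ _ _))// [X in X + _]mu0 add0e.
  move=> pj; suff : (delta * p ord0 j0)%:E <= (delta * (p ord0 j0 / 2))%:E.
    by rewrite lee_fin ler_pM2l// ler_pdivlMr// mulr_natr leNgt mulr2n ltrDl p_gt0.
  apply: le_trans Emu; apply: (@le_trans _ _ (\int[mu j0]_y gap j0 y)).
    rewrite EFinM; apply: le_trans (gap_markov pmu (mDge delta) (ltW delta0) _).
      by rewrite lee_pmul2l.
    by move=> y Dy; apply: le_trans (Dj y _ j0I); rewrite lerD2r.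
  by rewrite /excess (bigD1 j0)//= leeDl// sume_ge0.
Qed.

(** The new point lies, up to excess, on the segment from [(p, eta)] to the given one, and
    [reachable] is convex. *)
Lemma reachable_shrink (v : 'rV[R]_m) (t s e eta : R) : (0 < s)%R -> (s <= t)%R ->
  (0 < eta)%R -> reachable ((p + t *: v)%R, e) ->
  reachable ((p + s *: v)%R, (s / t * e + eta)%R).
Proof.
move=> s0 st eta0 Ht; have t0 : (0 < t)%R by exact: lt_le_trans st.
have st1 : (0 <= s / t <= 1)%R by rewrite divr_ge0 ?(ltW s0) ?(ltW t0)//= ler_pdivrMr// mul1r.
have := reachable_convex Ht (reachable_p eta0) st1.
rewrite (_ : (_ + _)%R = (p + s *: v, s / t * e + (1 - s / t) * eta)%R); last first.
  congr pair; rewrite /= scalerDr scalerA divfK ?gt_eqF// addrAC -scalerDl.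
  by rewrite addrCA subrr addr0 scale1r.
apply: reachableW; rewrite lerD2l ler_piMl ?(ltW eta0)//.
by rewrite gerBl; case/andP: st1.
Qed.

(** The least excess has one-sided derivative zero at [p] towards [e_j - e_i]. One [t] for each [e]
    expresses this, because convexity passes the bound on to all shorter steps. *)
Definition cheap i j := forall e : R, (0 < e)%R ->
  exists2 t : R, (0 < t)%R & reachable ((p + t *: u i j)%R, (e * t)%R).

Lemma cheap_shrink i j (e : R) : cheap i j -> (0 < e)%R ->
  exists2 t : R, (0 < t)%R & forall s, (0 < s <= t)%R ->
  reachable ((p + s *: u i j)%R, (e * s)%R).
Proof.
move=> ij e0; have e20 : (0 < e / 2)%R by rewrite divr_gt0.
have [t t0 Ht] := ij _ e20; exists t => // s /andP[s0 st].
have := reachable_shrink s0 st (mulr_gt0 e20 s0) Ht.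
by apply: reachableW; rewrite le_eqVlt; apply/orP; left; apply/eqP; field; rewrite gt_eqF.
Qed.

(** The midpoint of two moves of equal size [s] issued from [p], from [i] to [j] and from [j] to
    [k], is a move of size [s / 2] from [i] to [k]. *)
Lemma cheap_trans i j k : cheap i j -> cheap j k -> cheap i k.
Proof.
move=> ij jk e e0.
have e20 : (0 < e / 2)%R by rewrite divr_gt0.
have [t1 t10 H1] := cheap_shrink ij e20.
have [t2 t20 H2] := cheap_shrink jk e20.
pose s := Num.min t1 t2.
have s0 : (0 < s)%R by rewrite lt_min t10.
exists (s / 2)%R; first by rewrite divr_gt0.
have h01 : (0 <= (2^-1 : R) <= 1)%R by rewrite invr_ge0 ler0n/= invf_le1 ?ler1n.
have /H1 r1 : (0 < s <= t1)%R by rewrite s0 ge_min lexx.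
have /H2 r2 : (0 < s <= t2)%R by rewrite s0 ge_min lexx orbT.
have := reachable_convex r1 r2 h01.
congr reachable; congr pair; last first.
  by rewrite -[LHS]/(2^-1 * (e / 2 * s) + (1 - 2^-1) * (e / 2 * s))%R; field.
by apply/rowP => l; rewrite /u !mxE; field.
Qed.

Hypothesis adjacent : forall (I : {set 'I_m}) i0 j0 (delta : R),
  i0 \in I -> j0 \notin I -> (0 < delta)%R -> exists D : T -> R,
  [/\ measurable_fun setT D,
  (forall y i, i \in I -> exists2 j, j \notin I & (g j y <= g i y + D y)%R),
  (forall y j, j \notin I -> exists2 i, i \in I & (g i y + D y <= g j y)%R) &
  [\/ 0 < Q [set y | (0 < D y < delta)%R], Q [set y | (0 < D y)%R] = 0
    | Q [set y | (D y < delta)%R] = 0]].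

(** The pair given by [cheap_mass] depends on the plan, whence the contrapositive: if no pair is
    cheap, one tolerance [e0] fails for all the finitely many pairs. A plan of excess at most
    [e0 * k / 2], from which mass [k] is moved at extra cost [e0 / 2] per unit, contradicts this. *)
Lemma cheap_exit (I : {set 'I_m}) i0 j0 : i0 \in I -> j0 \notin I ->
  exists i j, [/\ i \in I, j \notin I & cheap i j].
Proof.
move=> i0I j0I; apply: contrapT => H.
have /choice[eps epsP] (ij : 'I_m * 'I_m) : exists e : R, (0 < e)%R /\
    (ij.1 \in I -> ij.2 \notin I -> forall t : R, (0 < t)%R ->
      ~ reachable ((p + t *: u ij.1 ij.2)%R, (e * t)%R)).
  have [[iI jI]|] := pselect (ij.1 \in I /\ ij.2 \notin I); last first.
    by move=> nij; exists 1%R; split => // iI jI; exfalso; apply: nij.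
  have /existsNP[e /not_implyP[e0 He]] : ~ cheap ij.1 ij.2.
    by move=> c; apply: H; exists ij.1, ij.2.
  by exists e; split => // _ _ t t0 r; apply: He; exists t.
pose e0 := \big[Num.min/1%R]_ij eps ij.
have e00 : (0 < e0)%R by apply/bigmin_gtP; split => // ij _; exact: (epsP ij).1.
have d0 : (0 < e0 / 2)%R by rewrite divr_gt0.
have [D [mD DI DJ tri]] := adjacent i0I j0I d0.
have [[k eta]/= [k0 eta0] Hmass] := cheap_mass i0I j0I d0 mD DI DJ tri.
have m0 : (0 < Num.min eta (e0 / 2 * k))%R by rewrite lt_min eta0 mulr_gt0.
have [mu pmu/= Emu] := reachable_p m0.
have [|i [j [iI jI kA]]] := Hmass mu pmu.
  by apply: (le_trans Emu); rewrite lee_fin ge_min lexx.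
set A := mkset _ in kA.
have mA : measurable A.
  rewrite -[X in measurable X]setTI; apply: measurable_fun_le => //.
  by apply: measurable_funD => //; exact: measurable_cst.
have mufin := plan_fin i pmu mA.
have ka : (k <= fine (mu i A))%R by rewrite -lee_fin fineK.
have a0 : (0 < fine (mu i A))%R by exact: lt_le_trans ka.
have ij : i != j by apply: contraNneq jI => <-.
have l01 : (0 <= k / fine (mu i A) <= 1)%R.
  by rewrite divr_ge0 ?(ltW k0) ?(ltW a0)//= ler_pdivrMr// mul1r.
have Agd y : A y -> (g j y <= g i y + e0 / 2)%R by [].
have := plan_transfer ij pmu mA l01 Agd (ltW d0) Emu.
rewrite divfK ?gt_eqF// => r.
apply: ((epsP (i, j)).2 iI jI k k0) => /=.
apply: reachableW r.
apply: (@le_trans _ _ (e0 * k)%R).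
  have : (Num.min eta (e0 / 2 * k) <= e0 / 2 * k)%R by rewrite ge_min lexx orbT.
  by lra.
by rewrite ler_wpM2r ?(ltW k0)//; exact: bigmin_le_cond.
Qed.

(** By transitivity, no cheap move leaves the set of indices [k] with [cheap i k]; by [cheap_exit]
    that set has no complement. *)
Lemma cheap_all i j : cheap i j.
Proof.
pose I : {set 'I_m} := [set k | `[< cheap i k >]]%SET.
have IE k : k \in I <-> cheap i k by rewrite inE; split => /asboolP.
have iI : i \in I.
  apply/IE => e e0; exists 1%R => //; rewrite /u subrr scaler0 addr0 mulr1.
  exact: reachable_p.
have [|jI] := boolP (j \in I); first by move/IE.
have [k [l [/IE ik + kl]]] := cheap_exit iI jI.
by move=> /negP; case; apply/IE; exact: cheap_trans kl.
Qed.

(* [q] is the barycentre, with weights [(p - q)^+_i (q - p)^+_j / s ^ 2], of the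
   points [p + s (e_j - e_i)] where [s] is half the l1 distance. *)
Lemma reachable_near (e : R) : (0 < e)%R -> exists2 t0 : R, (0 < t0)%R &
  forall q : 'rV[R]_m, (\sum_(k < m) q ord0 k = \sum_(k < m) p ord0 k)%R ->
  (\sum_(k < m) `|q ord0 k - p ord0 k| <= t0)%R ->
  forall eta, (0 < eta)%R ->
  reachable (q, (e * \sum_(k < m) `|q ord0 k - p ord0 k| + eta)%R).
Proof.
move=> e0.
have /choice[t tP] (ij : 'I_m * 'I_m) : exists t : R, (0 < t)%R /\
    forall s, (0 < s <= t)%R -> reachable ((p + s *: u ij.1 ij.2)%R, (e * s)%R).
  by have [t t0 Ht] := cheap_shrink (cheap_all ij.1 ij.2) e0; exists t.
exists (\big[Num.min/1%R]_ij t ij).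
  by apply/bigmin_gtP; split => // ij _; exact: (tP ij).1.
move=> q qp qt eta eta0.
pose a k := Num.max (p ord0 k - q ord0 k)%R 0%R.
pose b k := Num.max (q ord0 k - p ord0 k)%R 0%R.
have [abs dif] : (forall k, `|q ord0 k - p ord0 k| = a k + b k)%R /\
    (forall k, q ord0 k - p ord0 k = b k - a k)%R.
  split=> k; rewrite /a /b -(opprB (q ord0 k)); move: (q ord0 k - p ord0 k)%R => r.
    have [r0|r0] := orP (le_total 0%R r).
      by rewrite ger0_norm// max_r ?oppr_le0// max_l// add0r.
    by rewrite ler0_norm// max_l ?oppr_ge0// max_r// addr0.
  have [r0|r0] := orP (le_total 0%R r).
    by rewrite max_l// max_r ?oppr_le0// subr0.
  by rewrite max_r// max_l ?oppr_ge0// opprK add0r.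
have a0 k : (0 <= a k)%R by rewrite le_max lexx orbT.
have b0 k : (0 <= b k)%R by rewrite le_max lexx orbT.
pose s : R := (\sum_(k < m) a k)%R.
have bs : (\sum_(k < m) b k = s)%R.
  apply/eqP; rewrite -subr_eq0 -sumrB; under eq_bigr do rewrite -dif.
  by rewrite sumrB qp subrr.
have S2 : (\sum_(k < m) `|q ord0 k - p ord0 k| = s + s)%R.
  by under eq_bigr do rewrite abs; rewrite big_split/= bs.
have s0 : (0 <= s)%R by exact: sumr_ge0.
rewrite S2 in qt *.
(* At [q = p] only positive excesses are known to be reachable, which is why the bound carries
   [eta]. *)
move: s0; rewrite le_eqVlt => /predU1P[s0|s0].
  suff -> : q = p by rewrite -s0 addr0 mulr0 add0r; exact: reachable_p.
  apply/rowP => k; apply/eqP; rewrite -subr_eq0 -normr_eq0 eq_le normr_ge0 andbT.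
  apply: (@le_trans _ _ (\sum_(k < m) `|q ord0 k - p ord0 k|)%R).
    by rewrite (bigD1 k)//= lerDl sumr_ge0.
  by rewrite S2 -s0 addr0.
have sn0 : s != 0%R by rewrite gt_eqF.
suff : reachable (q, (e * s)%R).
  by apply: reachableW; rewrite mulrDr; have := mulr_gt0 e0 s0; lra.
pose w (ij : 'I_m * 'I_m) := (a ij.1 / s * (b ij.2 / s))%R.
have w0 ij : (0 <= w ij)%R by rewrite mulr_ge0// divr_ge0// ltW.
have wi : (\sum_(i < m) a i / s = 1)%R by rewrite -mulr_suml divff.
have wj : (\sum_(j < m) b j / s = 1)%R by rewrite -mulr_suml bs divff.
have w1 : (\sum_ij w ij = 1)%R.
  rewrite -(pair_bigA _ (fun i j => a i / s * (b j / s)))%R/=.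
  by under eq_bigr do rewrite -mulr_sumr wj mulr1.
have := @convex_set_sum _ _ reachable _ w
  (fun ij => ((p + s *: u ij.1 ij.2)%R, (e * s)%R : R^o)) reachable_convex w0 w1.
have st ij : (0 < s <= t ij)%R.
  rewrite s0/=; apply: (@le_trans _ _ (\big[Num.min/1%R]_ij t ij)).
    by apply: le_trans qt; rewrite lerDl ltW.
  exact: bigmin_le_cond.
move=> /(_ (fun ij => (tP ij).2 s (st ij))).
congr reachable; rewrite [LHS]surjective_pairing; congr pair.
  rewrite (big_morph fst (id1 := 0%R) (op1 := +%R))//=.
  apply/rowP => k; rewrite summxE.
  under eq_bigr do rewrite !mxE eqxx/=.
  rewrite -(pair_bigA _ (fun i j => a i / s * (b j / s) *
    (p ord0 k + s * ((k == j)%:R - (k == i)%:R))))%R/=.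
  have dsum (f : 'I_m -> R) : (\sum_j f j * (k == j)%:R = f k)%R.
    rewrite (bigD1 k)//= eqxx mulr1 big1 ?addr0// => j /negbTE jk.
    by rewrite eq_sym jk mulr0.
  rewrite (eq_bigr (fun i => a i / s * (p ord0 k + b k) - a i * (k == i)%:R)%R).
    rewrite sumrB -mulr_suml wi mul1r dsum -addrA -dif.
    by rewrite addrC subrK.
  move=> i _; rewrite (eq_bigr (fun j => (a i / s * (p ord0 k - s * (k == i)%:R)) * (b j / s)
      + a i / s * (b j * (k == j)%:R)))%R; last by move=> j _; field.
  by rewrite big_split/= -!mulr_sumr wj dsum; field.
rewrite (big_morph snd (id1 := 0%R) (op1 := +%R))//=.
by rewrite -scaler_suml w1 scale1r.
Qed.

End exchange.
End plans.

(** * Semidiscrete transport *)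

Section atomic_couplings.
Local Open Scope ereal_scope.

(** The existential form lets [choice] select a family of measures. *)
Lemma exists_pushforward (d1 d2 : measure_display) (X : measurableType d1)
    (Y : measurableType d2) (R : realType) (phi : X -> Y)
    (mu : {measure set X -> \bar R}) : measurable_fun setT phi ->
  exists nu : {measure set Y -> \bar R}, nu = pushforward mu phi :> (set Y -> \bar R).
Proof.
by move=> mphi; unshelve eexists (pushforward mu phi : {measure set Y -> \bar R}).
Qed.

Section total_mass_one.
Variables (d : measure_display) (T : measurableType d) (R : realType).
Variables (mu : {measure set T -> \bar R}) (mu1 : mu setT = 1).

Definition unit_measure of mu setT = 1 : set T -> \bar R := mu.

HB.instance Definition _ := Measure.copy (unit_measure mu1) mu.
HB.instance Definition _ :=
  Measure_isProbability.Build d T R (unit_measure mu1) mu1.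

Lemma exists_probability : exists P : probability T R, P = mu :> (set T -> \bar R).
Proof. by exists (unit_measure mu1). Qed.

End total_mass_one.

(** The measure is the sum of the products of [\d_(x k)] with [mu k], built from push-forwards under
    [y |-> (x k, y)]. It turns sums over a plan into a single integral. *)
Lemma exists_atomic_joint (d1 d2 : measure_display) (X : measurableType d1)
    (T : measurableType d2) (R : realType) (m : nat) (x : 'I_m -> X)
    (mu : 'I_m -> {measure set T -> \bar R}) :
  exists nu : {measure set (X * T) -> \bar R},
    (forall S, nu S = \sum_(k < m) mu k [set y | S (x k, y)]) /\
    (forall f : X * T -> \bar R, measurable_fun setT f -> (forall u, 0 <= f u) ->
      \int[nu]_u f u = \sum_(k < m) \int[mu k]_y f (x k, y)).
Proof.
have mx k : measurable_fun setT (fun y : T => (x k, y)).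
  by apply: measurable_fun_pair => //; exact: measurable_cst.
have /choice[nu nuE] k := exists_pushforward (mu k) (mx k).
(* [inord] requires a non-empty index type. *)
case: m => [|n] in x mu mx nu nuE *.
  exists mzero; split=> [S|f mf f0]; first by rewrite big_ord0.
  by rewrite big_ord0 integral_measure_zero.
exists (msum (fun i => nu (inord i)) n.+1); split=> [S|f mf f0].
  by rewrite [LHS]/=/msum; apply: eq_bigr => k _; rewrite inord_val nuE.
rewrite ge0_integral_measure_sum//; apply: eq_bigr => k _.
by rewrite inord_val nuE ge0_integral_pushforward.
Qed.

End atomic_couplings.

Section pointwise_min.
Context {R : realType} {T : topologicalType} {I : finType}.
Variable g : I -> T -> R.
Hypothesis cg : forall i, continuous (g i).

Lemma continuous_minimum (P : pred I) i0 : P i0 -> exists f : T -> R,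
  [/\ continuous f, (forall y i, P i -> f y <= g i y) &
     (forall y, exists2 i, P i & f y = g i y)].
Proof.
move=> Pi0.
suff [f [cf fle fat]] : exists f : T -> R,
    [/\ continuous f, (forall y i, i \in i0 :: enum P -> f y <= g i y) &
     (forall y, exists2 i, i \in i0 :: enum P & f y = g i y)].
  exists f; split=> // [y i Pi|y].
    by apply: fle; rewrite inE mem_enum [i \in P]Pi orbT.
  have [i ii fi] := fat y; exists i => //; move: ii.
  by rewrite inE mem_enum => /predU1P[->|].
elim: (enum P) => [|j s [f [cf fle fat]]].
  exists (g i0); split=> // [y i|y]; first by rewrite inE => /eqP ->.
  by exists i0 => //; rewrite inE.
exists (f \min g j); split=> [|y i|y].
- exact: (@min_fun_continuous _ T R f (g j)).
- rewrite !inE orbCA => /predU1P[->|i0s]; first by rewrite ge_min lexx orbT.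
  by rewrite ge_min fle// inE.
- rewrite /=; have [ji|ij] := leP (f y) (g j y).
    by have [i i0s fi] := fat y; exists i => //; rewrite !inE orbCA -in_cons i0s orbT.
  by exists j => //; rewrite !inE eqxx orbT.
Qed.

End pointwise_min.

Section semidiscrete_transport.
Context {R : realType} {d m : nat}.
Variables (x : 'I_m -> 'rV[R]_d) (h : 'rV[R]_d -> R).
Variable Q : probability (borelRV R d) R.
Hypotheses (x_inj : injective x) (h_ge0 : forall y, 0 <= h y) (ch : continuous h).
Hypothesis c_int : forall i, (\int[Q]_y (h (x i - y))%:E < +oo)%E.
Local Open Scope ereal_scope.
Local Notation E := (borelRV R d).
Local Notation c := (fun a b : 'rV[R]_d => h (a - b)%R).

Definition atomic (q : 'rV[R]_m) (A : set E) : \bar R :=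
  \sum_(k < m) (q ord0 k)%:E * \d_(x k : E) A.

Lemma measurable_point (a : 'rV[R]_d) : measurable ([set a] : set E).
Proof.
rewrite -[X in measurable X]setCK; apply: measurableC; apply: sub_sigma_algebra.
apply: closed_openC; apply: accessible_closed_set1; apply: hausdorff_accessible.
exact: norm_hausdorff.
Qed.

Lemma continuous_translate (a : 'rV[R]_d) : continuous (fun y : 'rV[R]_d => h (a - y)%R).
Proof.
have ca : continuous (fun y : 'rV[R]_d => (a - y)%R).
  move=> v; apply: (@cvgB R 'rV[R]_d 'rV[R]_d (nbhs (v : 'rV[R]_d)) _ (cst a) id a v).
    exact: cst_continuous.
  exact: cvg_id.
by move=> y; apply: continuous_comp; [exact: ca|exact: ch].
Qed.

Lemma measurable_translate a : measurable_fun setT (fun y : E => (h (a - y))%:E).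
Proof.
apply/measurable_EFinP; apply: continuous_measurable_borelRV.
exact: continuous_translate.
Qed.

Lemma measurable_cost : measurable_fun setT (fun u : E * E => (h (u.1 - u.2))%:E).
Proof.
apply/measurable_EFinP; apply: continuous_measurable_borelRV2 => u.
apply: continuous_comp; last exact: ch.
exact: sub_continuous.
Qed.

(** [mu k] is the second marginal of [pi] restricted to the slice over [x k]. The first marginal has
    no mass off the atoms and injectivity of [x] makes the slices disjoint, so together they carry
    [pi]. *)
Lemma coupling_plan (P : set E -> \bar R) (q : 'rV[R]_m) pi :
  (forall A : set E, measurable A -> P A = atomic q A) -> coupling P Q pi ->
  exists2 mu, plan Q q mu &
    \int[pi]_u (h (u.1 - u.2))%:E = \sum_(k < m) \int[mu k]_y (h (x k - y))%:E.
Proof.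
move=> PE [pi1 pi2].
have mxk k : measurable ([set x k] `*` setT : set (E * E)).
  by apply: measurableX => //; exact: measurable_point.
have msnd : measurable_fun setT (snd : E * E -> E) by exact: measurable_snd.
have /choice[mu muE] k := exists_pushforward (mrestr pi (mxk k)) msnd.
have piE S : measurable S -> pi S = \sum_(k < m) mu k [set y | S (x k, y)].
  move=> mS.
  pose U : set (E * E) := \bigcup_(k in [set: 'I_m]) ([set x k] `*` setT).
  have mU : measurable U.
    by apply: fin_bigcup_measurable => // k _; exact: mxk.
  have piCU : pi (~` U) = 0.
    have -> : ~` U = (~` \bigcup_(k in [set: 'I_m]) [set x k]) `*` setT.
      apply/seteqP; split => -[a b] /= H.
        by split => // -[k _ /= ak]; apply: H; exists k.
      by case: H => H _ [k _ [/= ak _]]; apply: H; exists k.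
    have mC : measurable (~` \bigcup_(k in [set: 'I_m]) [set x k] : set E).
      apply: measurableC; apply: fin_bigcup_measurable => // k _.
      exact: measurable_point.
    rewrite pi1// PE// /atomic big1// => k _.
    by rewrite diracE memNset ?mule0//= => H; apply: H; exists k.
  transitivity (pi (S `&` U)).
    apply/eqP; rewrite eq_le; apply/andP; split; last first.
      by apply: le_measure; rewrite ?inE//; exact: measurableI.
    have mCU : measurable (~` U) by exact: measurableC.
    apply: (@le_trans _ _ (pi ((S `&` U) `|` ~` U))).
      apply: le_measure; rewrite ?inE//.
        by apply: measurableU => //; exact: measurableI.
      by move=> u Su; have [Uu|Uu] := pselect (U u); [left|right].
    rewrite (le_trans (measureU2 _ _ _))//; first exact: measurableI.
    by rewrite [X in _ + X]piCU adde0.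
  rewrite /U setI_bigcupr measure_fin_bigcup//=; first last.
  - by move=> k _; apply: measurableI => //; exact: mxk.
  - apply/trivIsetP => i j _ _ ij; apply/seteqP; split => // -[a b] /=.
    by move=> [[_ [-> _]] [_ [/x_inj ji _]]]; rewrite ji eqxx in ij.
  rewrite [RHS]bigfs ?index_enum_uniq//; last first.
    by move=> k _; rewrite mem_index_enum.
  rewrite (_ : [set` _] = setT); last by apply/seteqP.
  apply: eq_fsbigr => k _; rewrite muE; congr (pi _).
  by apply/seteqP; split => -[a b] /= [+ [ak _]]; rewrite ak.
have [nu [nuE nuI]] := exists_atomic_joint (x : 'I_m -> E) mu.
exists mu; first split=> [k|B mB].
- rewrite muE -[LHS]/(pi (setT `&` ([set x k] `*` setT))) setTI pi1; last exact: measurable_point.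
  rewrite PE; last exact: measurable_point.
  rewrite /atomic (bigD1 k)//= diracE mem_set// mule1 big1 ?adde0// => j jk.
  by rewrite diracE memNset ?mule0//= => /x_inj jk'; rewrite jk' eqxx in jk.
- rewrite -pi2// piE; last exact: measurableX.
  by apply: eq_bigr => k _; congr (mu k _); apply/seteqP; split => y //= [].
rewrite -(nuI (fun u => (h (u.1 - u.2))%:E)); last 2 first.
- exact: measurable_cost.
- by move=> u; rewrite lee_fin.
by apply: eq_measure_integral => S mS _; have := piE S mS; rewrite -nuE.
Qed.

Lemma plan_coupling (P : set E -> \bar R) (q : 'rV[R]_m) mu :
  (\sum_(k < m) q ord0 k = 1)%R ->
  (forall A : set E, measurable A -> P A = atomic q A) -> plan Q q mu ->
  exists2 pi, coupling P Q pi &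
    \int[pi]_u (h (u.1 - u.2))%:E = \sum_(k < m) \int[mu k]_y (h (x k - y))%:E.
Proof.
move=> q1 PE [mu1 mu2].
have [nu [nuE nuI]] := exists_atomic_joint (x : 'I_m -> E) mu.
have nu1 : nu setT = 1.
  rewrite nuE; under eq_bigr do rewrite (_ : mkset _ = setT) ?mu1 //.
  by rewrite sumEFin q1.
have [pi piE] := exists_probability nu1.
exists pi; last first.
  by rewrite piE (nuI _ measurable_cost)// => u; rewrite lee_fin.
split=> [A mA|B mB]; rewrite piE nuE.
  rewrite PE//; apply: eq_bigr => k _; rewrite diracE.
  have [kA|kA] := boolP (x k \in A).
    rewrite mule1 (_ : mkset _ = setT) ?mu1//.
    by apply/seteqP; split => // y _; split => //=; rewrite -inE.
  rewrite mule0 (_ : mkset _ = set0) ?measure0//.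
  by apply/seteqP; split => // y [/= xA _]; move: kA; rewrite mem_set.
rewrite -mu2//; apply: eq_bigr => k _; congr (mu k _).
by apply/seteqP; split => y /= => [[]|].
Qed.

Variables (z : 'rV[R]_m) (phi : 'rV[R]_d -> R).
Hypothesis cphi : continuous phi.
Let g k (y : E) := (h (x k - y) - z ord0 k)%R.
Hypothesis phi_le : forall i y, (phi y <= g i y)%R.
Hypothesis phi_att : forall y, exists i, phi y = g i y.

Lemma measurable_reduced k : measurable_fun setT (g k).
Proof.
apply: measurable_funB; last exact: measurable_cst.
by apply/measurable_EFinP; exact: measurable_translate.
Qed.

Lemma measurable_potential : measurable_fun setT (phi : E -> R).
Proof. exact: continuous_measurable_borelRV. Qed.

(** Adding [L] makes each [z k] and [phi] nonnegative, so that integrals can be split without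
    knowing that the cost of a plan is finite. *)
Let L : R := (\sum_(k < m) `|z ord0 k|)%R.

Let zL k : (`|z ord0 k| <= L)%R.
Proof. by rewrite /L (bigD1 k)//= lerDl sumr_ge0. Qed.

Let phiL y : (0 <= phi y + L)%R.
Proof.
have [i ->] := phi_att y; have := h_ge0 (x i - y); have := zL i.
by have := ler_norm (z ord0 i); rewrite /g; lra.
Qed.

Lemma integrable_potential (i0 : 'I_m) : Q.-integrable setT (fun y : E => (phi y)%:E).
Proof.
have iL r : Q.-integrable setT (fun y : E => r%:E) by exact: finite_measure_integrable_cst.
have ic : Q.-integrable setT (fun y : E => (h (x i0 - y))%:E).
  apply/integrableP; split; first exact: measurable_translate.
  by under eq_integral do rewrite gee0_abs ?lee_fin//; exact: c_int.
apply: (le_integrable _ _ _ (integrableD _ ic (iL (L + L)%R))) => //.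
  by apply/measurable_EFinP; exact: measurable_potential.
move=> y _; rewrite -EFinD /= lee_fin.
have h0 := h_ge0 (x i0 - y); have L0 : (0 <= L)%R by exact: sumr_ge0.
rewrite [leRHS]ger0_norm ?addr_ge0// ler_norml; have := phiL y.
have := phi_le i0 y; have := zL i0; have := ler_norm (- z ord0 i0)%R.
by rewrite normrN /g => *; apply/andP; split; lra.
Qed.

Lemma plan_integral q mu (f : E -> \bar R) : plan Q q mu -> measurable_fun setT f ->
  (forall y, 0 <= f y) -> \sum_(k < m) \int[mu k]_y f y = \int[Q]_y f y.
Proof.
move=> [_ mu2] mf f0; have [nu [nuE nuI]] := exists_atomic_joint (x : 'I_m -> E) mu.
rewrite -(nuI (f \o snd)); last 2 first.
- by apply: measurableT_comp => //; exact: measurable_snd.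
- by move=> u; exact: f0.
have msnd : measurable_fun setT (snd : E * E -> E) by exact: measurable_snd.
rewrite -[LHS](ge0_integral_pushforward msnd nu measurableT mf); last by move=> y _.
apply: eq_measure_integral => B mB _.
have H : nu (snd @^-1` B) = Q B by rewrite nuE; exact: (mu2 B mB).
exact: H.
Qed.

(** The pointwise identity [h (x k - y) = gap k y + phi y + z k] is integrated against each [mu k],
    after adding [2 L] to both sides. *)
Lemma plan_cost (i0 : 'I_m) (q : 'rV[R]_m) mu : (\sum_(k < m) q ord0 k = 1)%R -> plan Q q mu ->
  \sum_(k < m) \int[mu k]_y (h (x k - y))%:E =
  (\sum_(k < m) q ord0 k * z ord0 k + fine (\int[Q]_y (phi y)%:E))%:E +
  excess g (phi : E -> R) mu.
Proof.
move=> q1 pmu; have [mu1 mu2] := pmu.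
have L0 : (0 <= L)%R by exact: sumr_ge0.
have mg := measurable_reduced; have mphi := measurable_potential.
have mphiL : measurable_fun setT (fun y : E => (phi y + L)%R%:E).
  by apply/measurable_EFinP; apply: measurable_funD => //; exact: measurable_cst.
have zL0 k : (0 <= z ord0 k + L)%R.
  by have := zL k; have := ler_norm (- z ord0 k)%R; rewrite normrN; lra.
have cst_ r k : (0 <= r)%R -> (r * q ord0 k)%:E = \int[mu k]_y (cst r%:E y).
  by move=> r0; rewrite integral_cst// mu1 EFinM.
have split_ k : \int[mu k]_y (h (x k - y))%:E + ((L + L) * q ord0 k)%:E =
    \int[mu k]_y gap g (phi : E -> R) k y + \int[mu k]_y (phi y + L)%:E
      + ((z ord0 k + L) * q ord0 k)%:E.
  have mh := measurable_translate (x k).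
  have mgap : measurable_fun setT (gap g (phi : E -> R) k : E -> \bar R) by exact: measurable_gap.
  have intD (f1 f2 : E -> \bar R) : measurable_fun setT f1 -> measurable_fun setT f2 ->
      (forall y, 0 <= f1 y) -> (forall y, 0 <= f2 y) ->
      \int[mu k]_y f1 y + \int[mu k]_y f2 y = \int[mu k]_y (f1 y + f2 y).
    by move=> mf1 mf2 f10 f20; rewrite ge0_integralD.
  rewrite (cst_ _ _ (addr_ge0 L0 L0)) (cst_ _ _ (zL0 k)).
  have gap0 y : 0 <= gap g (phi : E -> R) k y by exact: gap_ge0.
  rewrite !intD//; first last.
  - by move=> y; rewrite lee_fin addr_ge0.
  - by move=> y; rewrite lee_fin.
  - by move=> y; rewrite lee_fin; exact: zL0.
  - by move=> y; apply: adde_ge0 => //; rewrite lee_fin.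
  - by apply: emeasurable_funD.
  by apply: eq_integral => y _; rewrite /gap/= -!EFinD; congr EFin; rewrite /g; ring.
have sum5 (a b e : 'I_m -> \bar R) (u v : 'I_m -> R) :
    (forall k, a k + (u k)%:E = b k + e k + (v k)%:E) ->
    \sum_(k < m) a k + (\sum_(k < m) u k)%:E =
    \sum_(k < m) b k + \sum_(k < m) e k + (\sum_(k < m) v k)%:E.
  by move=> abe; rewrite -!sumEFin -!big_split/=; apply: eq_bigr.
have /= := sum5 _ _ _ _ _ split_.
have -> : \sum_(k < m) \int[mu k]_y (phi y + L)%:E = \int[Q]_y (phi y + L)%:E.
  by apply: plan_integral pmu mphiL _ => y; rewrite lee_fin.
have qs (r : R) : (\sum_(k < m) r * q ord0 k = r)%R by rewrite -mulr_sumr q1 mulr1.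
have -> : (\sum_(k < m) (z ord0 k + L) * q ord0 k =
    \sum_(k < m) q ord0 k * z ord0 k + L)%R.
  rewrite -[X in (_ = _ + X)%R]qs -big_split/=; apply: eq_bigr => k _; ring.
rewrite qs.
have iphi := integrable_potential i0.
have -> : \int[Q]_y (phi y + L)%:E = (fine (\int[Q]_y (phi y)%:E) + L)%:E.
  under eq_integral do rewrite EFinD.
  rewrite integralD_EFin//; last exact: finite_measure_integrable_cst.
  rewrite integral_cst// [X in _ + _ * X]probability_setT mule1 EFinD fineK//.
  exact: integrable_fin_num.
rewrite -/(excess g (phi : E -> R) mu) => H.
rewrite -[LHS](@addeK _ (L + L)%:E) ?H//.
rewrite -!addeA -EFinN -!EFinD addeC; congr (_%:E + _).
ring.
Qed.

Let I := fine (\int[Q]_y (phi y)%:E).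

Lemma transport_atomic_ge (i0 : 'I_m) (P : set E -> \bar R) (q : 'rV[R]_m) :
  (\sum_(k < m) q ord0 k = 1)%R -> (forall A : set E, measurable A -> P A = atomic q A) ->
  (\sum_(k < m) q ord0 k * z ord0 k + I)%:E <= transport_cost c P Q.
Proof.
move=> q1 PE; apply/ereal_infP => _ [pi /(coupling_plan PE)[mu pmu ->] <-].
by rewrite (plan_cost i0 q1 pmu) leeDl//; apply: sume_ge0 => k _; exact: integral_gap_ge0.
Qed.

Lemma transport_atomic_le (i0 : 'I_m) (P : set E -> \bar R) (q : 'rV[R]_m) (e : R) :
  (\sum_(k < m) q ord0 k = 1)%R -> (forall A : set E, measurable A -> P A = atomic q A) ->
  reachable Q g (phi : E -> R) (q, e) ->
  transport_cost c P Q <= (\sum_(k < m) q ord0 k * z ord0 k + I + e)%:E.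
Proof.
move=> q1 PE [mu pmu Emu]; have [pi cpi pic] := plan_coupling q1 PE pmu.
apply: (@le_trans _ _ (\int[pi]_u (h (u.1 - u.2))%:E)).
  apply: ge_ereal_inf; exists (\int[pi]_u (h (u.1 - u.2))%:E) => //.
  by exists pi.
by rewrite pic (plan_cost i0 q1 pmu) [leRHS]EFinD leeD2l.
Qed.

Lemma transport_atomic_reachable (i0 : 'I_m) (P : set E -> \bar R) (q : 'rV[R]_m) (eta : R) :
  (\sum_(k < m) q ord0 k = 1)%R -> (forall A : set E, measurable A -> P A = atomic q A) ->
  transport_cost c P Q = (\sum_(k < m) q ord0 k * z ord0 k + I)%:E ->
  (0 < eta)%R -> reachable Q g (phi : E -> R) (q, eta).
Proof.
move=> q1 PE TE eta0.
have : transport_cost c P Q < (\sum_(k < m) q ord0 k * z ord0 k + I + eta)%:E.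
  by rewrite TE lte_fin ltrDl.
move=> /ereal_inf_lt[_ [pi /(coupling_plan PE)[mu pmu ->] <-]].
rewrite (plan_cost i0 q1 pmu) [ltRHS]EFinD lteD2lE// => Emu.
by exists mu => //; exact: ltW.
Qed.

(** The independent coupling has finite cost by [c_int]; hence the transport cost is finite for all
    weights, even far from [p]. *)
Lemma reachable_product (i0 : 'I_m) (q : 'rV[R]_m) : (forall k, 0 <= q ord0 k)%R ->
  (\sum_(k < m) q ord0 k = 1)%R -> exists e, reachable Q g (phi : E -> R) (q, e).
Proof.
move=> q0 q1.
pose mu k : {measure set E -> \bar R} := mscale (NngNum (q0 k)) Q.
have pmu : plan Q q mu.
  split=> [k|B mB]; first by rewrite /mu/= /mscale/= probability_setT mule1.
  by rewrite /mu/= /mscale/= -ge0_sume_distrl ?sumEFin ?q1 ?mul1e// => k _; rewrite lee_fin.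
exists (fine (excess g (phi : E -> R) mu)); exists mu => //=.
rewrite fineK// ge0_fin_numE; last first.
  by apply: sume_ge0 => k _; exact: integral_gap_ge0.
have := plan_cost i0 q1 pmu.
have : \sum_(k < m) \int[mu k]_y (h (x k - y))%:E < +oo.
  apply: lte_sum_pinfty => k _; rewrite ge0_integral_mscale//=.
  - by rewrite lte_mul_pinfty// ?c_int// lee_fin.
  - exact: measurable_translate.
  - by move=> y _; rewrite lee_fin.
move=> + H; rewrite {}H => H; rewrite ltey; move: H; apply: contraTneq => ->.
by rewrite addey// ltxx.
Qed.

Hypothesis Q_supp : connected (supp Q).

(** The difference of two minima of finitely many continuous functions is continuous, so
    [connected_supp_gap] provides the trichotomy. *)
Lemma adjacent_cells (J : {set 'I_m}) i0 j0 (delta : R) :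
  i0 \in J -> j0 \notin J -> (0 < delta)%R -> exists D : E -> R,
  [/\ measurable_fun setT D,
  (forall y i, i \in J -> exists2 j, j \notin J & (g j y <= g i y + D y)%R),
  (forall y j, j \notin J -> exists2 i, i \in J & (g i y + D y <= g j y)%R) &
  [\/ 0 < Q [set y | (0 < D y < delta)%R], Q [set y | (0 < D y)%R] = 0
    | Q [set y | (D y < delta)%R] = 0]].
Proof.
move=> i0J j0J delta0.
have cg k : continuous (g k : 'rV[R]_d -> R).
  move=> y; apply: (@cvgB R R 'rV[R]_d (nbhs (y : 'rV[R]_d)) _
    (fun y => h (x k - y)%R) (cst (z ord0 k))).
    exact: continuous_translate.
  exact: cst_continuous.
have [a [ca ale aat]] := continuous_minimum cg i0J.
have [b [cb ble bat]] := @continuous_minimum _ _ _ _ cg [pred j | j \notin J] j0 j0J.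
exists (fun y => b y - a y)%R.
have cD : continuous (fun y => b y - a y)%R.
  move=> y; apply: (@cvgB R R 'rV[R]_d (nbhs (y : 'rV[R]_d)) _ b a).
    exact: cb.
  exact: ca.
split.
- exact: continuous_measurable_borelRV.
- move=> y i iJ; have [j jJ bj] := bat y; exists j => //.
  by have := ale y i iJ; rewrite -bj; lra.
- move=> y j jJ; have [i iJ ai] := aat y; exists i => //.
  by have := ble y j jJ; rewrite -ai; lra.
- exact: connected_supp_gap.
Qed.

End semidiscrete_transport.

(** The lower bound on [r] is weak duality and holds for all weights; the upper one is
    [reachable_near] with [eta] sent to zero. [P'] is a bare set function, which is how empirical
    measures are given. *)
Lemma transport_cost_expansion (R : realType) (d m : nat) (x : 'I_m -> 'rV[R]_d)
    (h : 'rV[R]_d -> R) (P Q : probability (borelRV R d) R) (p z : 'rV[R]_m) (e : R) :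
  injective x -> (forall y, 0 <= h y) -> continuous h ->
  (forall i, (\int[Q]_y (h (x i - y))%:E < +oo)%E) -> connected (supp Q) ->
  (forall k, 0 < p ord0 k) -> \sum_(k < m) p ord0 k = 1 ->
  (forall A : set (borelRV R d), measurable A -> P A = atomic x p A) ->
  Opt (fun a b => h (a - b)) x p P Q z -> 0 < e ->
  exists2 t0 : R, 0 < t0 & forall (P' : set (borelRV R d) -> \bar R) (q : 'rV[R]_m),
    (forall k, 0 <= q ord0 k) -> \sum_(k < m) q ord0 k = 1 ->
    (forall A : set (borelRV R d), measurable A -> P' A = atomic x q A) ->
    let T := transport_cost (fun a b => h (a - b)) in
    let r := fine (T P' Q) - fine (T P Q) - \sum_(k < m) (q ord0 k - p ord0 k) * z ord0 k in
    [/\ T P' Q \is a fin_num, T P Q \is a fin_num, 0 <= r &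
      \sum_(k < m) `|q ord0 k - p ord0 k| <= t0 ->
      r <= e * \sum_(k < m) `|q ord0 k - p ord0 k|].
Proof.
move=> x_inj h_ge0 ch c_int cQ p0 p1 PE zopt e0.
have [i0 _] : exists i0 : 'I_m, true.
  case: m p z x x_inj c_int p0 p1 PE zopt => [|n] p z x _ _ _ p1 _ _; last by exists ord0.
  by move: p1; rewrite big_ord0 => /eqP; rewrite eq_sym oner_eq0.
pose g k (y : borelRV R d) := h (x k - y) - z ord0 k.
have cg k : continuous (g k : 'rV[R]_d -> R).
  move=> y; apply: (@cvgB R R 'rV[R]_d (nbhs (y : 'rV[R]_d)) _
    (fun y => h (x k - y)) (cst (z ord0 k))).
    exact: continuous_translate.
  exact: cst_continuous.
have [phi [cphi phile phiat]] := @continuous_minimum _ _ _ _ cg xpredT i0 isT.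
have {}phile i y : phi y <= g i y by exact: phile.
have {}phiat y : exists i, phi y = g i y by have [i _] := phiat y; exists i.
pose I := fine (\int[Q]_y (phi y)%:E)%E.
have iphi := integrable_potential h_ge0 ch c_int cphi phile phiat i0.
(* Optimality of [z] enters here: the transport cost at [p] is the dual value, so that [p] reaches
   every positive excess. *)
have TP : transport_cost (fun a b => h (a - b)) P Q =
    (\sum_(k < m) p ord0 k * z ord0 k + I)%:E.
  rewrite zopt /dual_value EFinD /I fineK; last exact: integrable_fin_num.
  congr (_ + _)%E; apply: eq_integral => y _; apply/eqP; rewrite eq_le.
  apply/andP; split.
    have [i ->] := phiat y; exact: bigmin_le.
  by apply/bigmin_geP; split => [|i _]; [rewrite leey|rewrite lee_fin; exact: phile].
have mg k : measurable_fun setT (g k) by exact: (@measurable_reduced _ _ _ x h ch z k).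
have mphi : measurable_fun setT (phi : borelRV R d -> R) by exact: measurable_potential.
have rp (eta : R) : 0 < eta -> reachable Q g (phi : borelRV R d -> R) (p, eta).
  exact: (@transport_atomic_reachable _ _ _ x h Q x_inj h_ge0 ch c_int z phi cphi phile
    phiat i0 P p eta p1 PE TP).
have adj := @adjacent_cells _ _ _ x h Q ch z cQ.
have [t0 t00 Ht] := reachable_near mg mphi phile p0 rp adj e0.
exists t0 => // P' q q0 q1 PE'.
have Tge := transport_atomic_ge x_inj h_ge0 ch c_int cphi phile phiat i0 q1 PE'.
have Tle r := @transport_atomic_le _ _ _ x h Q h_ge0 ch c_int z phi cphi phile phiat
  i0 P' q r q1 PE'.
have [r0 Hr0] := reachable_product h_ge0 ch c_int cphi phile phiat i0 q0 q1.
have Tfin : transport_cost (fun a b => h (a - b)) P' Q \is a fin_num.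
  have := Tle _ Hr0; move: Tge; by case: (transport_cost _ _ _).
rewrite /= TP/=.
have qpz : \sum_(k < m) (q ord0 k - p ord0 k) * z ord0 k =
    \sum_(k < m) q ord0 k * z ord0 k - \sum_(k < m) p ord0 k * z ord0 k.
  by rewrite -sumrB; apply: eq_bigr => k _; rewrite mulrBl.
move: Tfin Tge Tle; rewrite qpz -/I.
case: (transport_cost _ _ _) => // T _; rewrite /= lee_fin => Tge Tle.
split=> // [|qt]; first by lra.
apply/ler_addgt0Pr => eta eta0.
have := Tle _ (Ht q (etrans q1 (esym p1)) qt eta eta0).
by rewrite lee_fin; lra.
Qed.

(** * Gaussian integrals *)

Lemma bounded_integrable (d : measure_display) (T : measurableType d) (R : realType)
    (P : probability T R) (f : T -> R) (M : R) :
  measurable_fun setT f -> (forall y, `|f y| <= M) ->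
  P.-integrable setT (EFin \o f).
Proof.
move=> mf fM.
apply: (le_integrable _ _ _ (finite_measure_integrable_cst P M measurableT)) => //.
  exact/measurable_EFinP.
by move=> y _; rewrite lee_fin/= (le_trans (fM y))// ler_norm.
Qed.

Lemma affine_integral (d : measure_display) (T : measurableType d) (R : realType)
    (P : probability T R) (f : T -> R) (b a : R) : P.-integrable setT (EFin \o f) ->
  P.-integrable setT (EFin \o (fun y => b + a * f y)) /\
  \int[P]_y (b + a * f y) = b + a * \int[P]_y f y.
Proof.
move=> fi.
have ib : P.-integrable setT (EFin \o cst b) by exact: finite_measure_integrable_cst.
have ia : P.-integrable setT (EFin \o (fun y => a * f y)).
  by apply: eq_integrable (integrableZl measurableT a fi).
split; first by apply: eq_integrable (integrableD measurableT ib ia).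
rewrite RintegralD// RintegralZl// Rintegral_cst//.
by rewrite [X in fine X]probability_setT mulr1.
Qed.

(* An affine function below a smooth one, with equality at [0], is tangent. *)
Lemma slope_eq0 (R : realFieldType) (c K a0 : R) : 0 < a0 ->
  (forall a, `|a| <= a0 -> a * c <= K * a ^+ 2) -> c = 0.
Proof.
move=> a00 H; apply/eqP; rewrite -normr_le0; apply/ler_addgt0Pr => e e0.
rewrite add0r; pose t := Num.min a0 (e / (`|K| + 1)).
have K1 : 0 < `|K| + 1 by rewrite ltr_pwDr.
have t0 : 0 < t by rewrite lt_min a00 divr_gt0.
have ta : t <= a0 by rewrite ge_min lexx.
have te : t * (`|K| + 1) <= e by rewrite -ler_pdivlMr// ge_min lexx orbT.
have Kt : K * t <= e.
  apply: le_trans te; rewrite mulrC ler_pM2l//.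
  by rewrite (le_trans (ler_norm _))// lerDl.
have abst : `|t| <= a0 by rewrite gtr0_norm.
have absNt : `|- t| <= a0 by rewrite normrN gtr0_norm.
have := H t abst; have := H (- t) absNt.
rewrite sqrrN mulNr expr2 mulrCA -mulrN !ler_pM2l// => c1 c2.
by rewrite ler_norml; apply/andP; split; lra.
Qed.

Section gaussian_integrals.
Context {R : realType}.
Local Notation mu := (@lebesgue_measure R).
Implicit Types (x s a : R).

Lemma normal_peakE s : 0 < s -> normal_peak s = (s * Num.sqrt (pi *+ 2))^-1.
Proof.
by move=> s0; rewrite /normal_peak -mulrnAr sqrtrM ?sqr_ge0// sqrtr_sqr gtr0_norm.
Qed.

(** The Radon-Nikodym derivative of [normal_prob] is almost everywhere [normal_pdf], both having the
    same integrals over measurable sets. *)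
Lemma normal_density_integral x s (f : R -> \bar R) : measurable_fun setT f ->
  (forall y, (0 <= f y)%E) ->
  (\int[normal_prob x s]_y f y = \int[mu]_y (f y * (normal_pdf x s y)%:E))%E.
Proof.
move=> mf f0; have dom := @normal_prob_dominates R x s.
rewrite -(Radon_Nikodym_SigmaFinite.change_of_variables dom)//.
apply: ae_eq_integral => //.
- apply: emeasurable_funM => //; apply: (measurable_int mu).
  exact: Radon_Nikodym_SigmaFinite.f_integrable.
- by apply: emeasurable_funM => //; apply/measurable_EFinP; exact: measurable_normal_pdf.
- apply: ae_eqe_mul2l; apply: integral_ae_eq => //.
  + exact: Radon_Nikodym_SigmaFinite.f_integrable.
  + by apply/measurable_EFinP; exact: measurable_normal_pdf.
  + by move=> E _ mE; rewrite -Radon_Nikodym_SigmaFinite.f_integral.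
Qed.

Lemma integral_scaled_normal_pdf x s (k : R) : 0 <= k ->
  (\int[mu]_y (k * normal_pdf x s y)%:E = k%:E)%E.
Proof.
move=> k0; under eq_integral do rewrite EFinM.
rewrite ge0_integralZl ?lee_fin//; first by rewrite integral_normal_pdf mule1.
- by apply/measurable_EFinP; exact: measurable_normal_pdf.
- by move=> y _; rewrite lee_fin normal_pdf_ge0.
Qed.

(** Completing the square: the integrand times the density of deviation [s] is [b^-1] times the
    density of deviation [s / b], with [b ^+ 2 = 1 - 2 * a]. *)
Lemma normal_integral_expR_sqr x s a : 0 < s -> a < 2^-1 ->
  (\int[normal_prob x s]_y (expR (a * ((y - x) / s) ^+ 2))%:E =
   ((Num.sqrt (1 - 2 * a))^-1)%:E)%E.
Proof.
move=> s0 a2; have b0 : 0 < 1 - 2 * a by lra.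
pose b := Num.sqrt (1 - 2 * a).
have bgt0 : 0 < b by rewrite sqrtr_gt0.
have b2 : b ^+ 2 = 1 - 2 * a by rewrite sqr_sqrtr// ltW.
have sb0 : 0 < s / b by rewrite divr_gt0.
rewrite normal_density_integral; last 2 first.
- apply/measurable_EFinP; apply: measurableT_comp => //.
  apply: measurable_funM => //; apply: measurable_funX; apply: measurable_funM => //.
  by apply: measurable_funB.
- by move=> y; rewrite lee_fin expR_ge0.
have bV0 : 0 <= b^-1 by rewrite invr_ge0 ltW.
apply: etrans (integral_scaled_normal_pdf x (s / b) bV0).
apply: eq_integral => y _; rewrite -EFinM; congr EFin.
rewrite !normal_pdfE ?gt_eqF// !normal_peakE// /normal_fun -/b.
have -> : expR (- (y - x) ^+ 2 / ((s / b) ^+ 2 *+ 2)) =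
    expR (a * ((y - x) / s) ^+ 2) * expR (- (y - x) ^+ 2 / (s ^+ 2 *+ 2)).
  rewrite -expRD; congr expR.
  have -> : (s / b) ^+ 2 = s ^+ 2 / (1 - 2 * a) by rewrite expr_div_n b2.
  by field; rewrite !gt_eqF.
have q0 : 0 < Num.sqrt (pi *+ 2 : R) by rewrite sqrtr_gt0 pmulrn_lgt0// pi_gt0.
by field; rewrite !gt_eqF.
Qed.

(** The exponential factor shifts the mean of the density to [x + a * s ^+ 2]. *)
Lemma normal_integral_expR x s a : 0 < s ->
  (\int[normal_prob x s]_y (expR (a * (y - x)))%:E =
   (expR (a ^+ 2 * s ^+ 2 / 2))%:E)%E.
Proof.
move=> s0; rewrite normal_density_integral; last 2 first.
- apply/measurable_EFinP; apply: measurableT_comp => //.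
  by apply: measurable_funM => //; apply: measurable_funB.
- by move=> y; rewrite lee_fin expR_ge0.
apply: etrans (integral_scaled_normal_pdf (x + a * s ^+ 2) s (expR_ge0 _)).
apply: eq_integral => y _; rewrite -EFinM; congr EFin.
rewrite !normal_pdfE ?gt_eqF// /normal_fun mulrCA [RHS]mulrCA; congr (_ * _).
by rewrite -!expRD; congr expR; field; rewrite gt_eqF.
Qed.

(** The dominating function for moments up to order four, integrable because [1/4 < 1/2]. It is the
    square of [expR (u ^+ 2 / 8)], which exceeds [u ^+ 2 / 8]; hence [64 = 8 ^+ 2]. *)
Lemma expR_quarter_sqr_ge (u : R) : 1 <= expR (4^-1 * u ^+ 2) /\
  u ^+ 4 <= 64 * expR (4^-1 * u ^+ 2).
Proof.
have u0 : 0 <= u ^+ 2 by exact: sqr_ge0.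
have e1 := expR_ge1Dx (4^-1 * u ^+ 2); split; first by lra.
have e2 := expR_ge1Dx (8^-1 * u ^+ 2).
have -> : expR (4^-1 * u ^+ 2) = expR (8^-1 * u ^+ 2) ^+ 2.
  by rewrite [RHS]expr2 -expRD; congr expR; lra.
have -> : 64 = 8 ^+ 2 :> R by rewrite -natrX.
by rewrite -exprMn (exprM u 2 2) ler_sqr ?nnegrE//; lra.
Qed.

Section moments.
Variables (x s : R).
Hypothesis s_gt0 : 0 < s.
Local Notation N := (normal_prob x s).
Local Notation u := (fun y : R => (y - x) / s).

Lemma measurable_standardize : measurable_fun setT u.
Proof. by apply: measurable_funM => //; apply: measurable_funB. Qed.

Lemma normal_integrable_expR_sqr : N.-integrable setT (EFin \o (fun y => expR (4^-1 * u y ^+ 2))).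
Proof.
apply/integrableP; split.
  apply/measurable_EFinP; apply: measurableT_comp => //; apply: measurable_funM => //.
  by apply: measurable_funX; exact: measurable_standardize.
under eq_integral do rewrite /= ger0_norm ?expR_ge0//.
by rewrite normal_integral_expR_sqr// ?ltry//; lra.
Qed.

Lemma normal_integrable_dominated (f : R -> R) (K : R) : measurable_fun setT f ->
  (forall y, `|f y| <= K * expR (4^-1 * u y ^+ 2)) -> N.-integrable setT (EFin \o f).
Proof.
move=> mf fK.
have K0 : 0 <= K.
  by have := le_trans (normr_ge0 _) (fK 0); rewrite pmulr_lge0// expR_gt0.
apply: (le_integrable _ _ _ (integrableZl _ K normal_integrable_expR_sqr)) => //.
  exact/measurable_EFinP.
move=> y _; rewrite /= lee_fin (le_trans (fK y))// ger0_norm// mulr_ge0// expR_ge0//.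
Qed.

Lemma normal_integrable_pow (f : R -> R) k : (k <= 4)%N -> measurable_fun setT f ->
  (forall y, `|f y| = `|u y| ^+ k) -> N.-integrable setT (EFin \o f).
Proof.
move=> k4 mf fu; apply: (@normal_integrable_dominated _ 64) => // y.
rewrite fu; have [e1 e4] := expR_quarter_sqr_ge (u y).
have [u1|u1] := leP `|u y| 1.
  by apply: (@le_trans _ _ 1); [rewrite exprn_ile1|lra].
apply: (@le_trans _ _ (`|u y| ^+ 4)); first by rewrite ler_eXn2l.
have -> : `|u y| ^+ 4 = u y ^+ 4 by rewrite -normrX ger0_norm// (exprM _ 2 2) sqr_ge0.
by apply: (le_trans e4); rewrite ler_wpM2r ?expR_ge0// ler_nat.
Qed.

Lemma normal_integrable_standardize : N.-integrable setT (EFin \o u).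
Proof. by apply: (@normal_integrable_pow _ 1) => //; exact: measurable_standardize. Qed.

Lemma normal_integrable_standardize_sqr : N.-integrable setT (EFin \o (fun y => u y ^+ 2)).
Proof.
apply: (@normal_integrable_pow _ 2) => // [|y]; last by rewrite normrX.
by apply: measurable_funX; exact: measurable_standardize.
Qed.

(** Integrating [1 + a u <= expR (a u)] gives, for the moment [m] and [|a| <= 1], [1 + a m <= expR
    (a ^+ 2 / 2) <= 1 + a ^+ 2]; then [slope_eq0] applies. *)
Lemma normal_moment1 : \int[N]_y u y = 0.
Proof.
apply: (@slope_eq0 _ _ 1 1) => // a a1.
have iu := normal_integrable_standardize.
have : \int[N]_y (1 + a * u y) <= expR (a ^+ 2 / 2).
  rewrite -[leRHS]/(fine (expR (a ^+ 2 / 2))%:E).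
  have e := normal_integral_expR x (a / s) s_gt0.
  have -> : a ^+ 2 / 2 = (a / s) ^+ 2 * s ^+ 2 / 2 by field; rewrite gt_eqF.
  rewrite -e; apply: le_Rintegral => //.
  - exact: (affine_integral 1 a iu).1.
  - apply/integrableP; split.
      apply/measurable_EFinP; apply: measurableT_comp => //.
      by apply: measurable_funM => //; apply: measurable_funB.
    under eq_integral do rewrite /= ger0_norm ?expR_ge0//.
    by rewrite e ltry.
  - move=> y _; apply: le_trans (expR_ge1Dx _).
    by rewrite mulrA mulrAC.
rewrite (affine_integral 1 a iu).2.
move=> h; rewrite -(lerD2l 1); apply: (le_trans h).
have := expR_ge1Dx (- (a ^+ 2 / 2)).
rewrite expRN => e3.
have a2 : a ^+ 2 <= 1 by rewrite -(real_normK (num_real a)) exprn_ile1.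
have a20 := sqr_ge0 a.
have E0 := expR_gt0 (a ^+ 2 / 2).
set E := expR _ in E0 e3 *.
have : (1 - a ^+ 2 / 2) * E <= 1 by rewrite -ler_pdivlMr// mul1r.
by nra.
Qed.

(** The same tangent argument with [expR (a u ^+ 2)], whose mean [(1 - 2 a)^(-1/2)] has slope [1] at
    [a = 0]. *)
Lemma normal_moment2 : \int[N]_y (u y ^+ 2) = 1.
Proof.
apply/eqP; rewrite -subr_eq0; apply/eqP.
apply: (@slope_eq0 _ _ 8 4^-1) => // a a1.
have iu := normal_integrable_standardize_sqr.
have [a41 a42] : - 4^-1 <= a /\ a <= 4^-1 by move: a1; rewrite ler_norml => /andP[].
have : \int[N]_y (1 + a * u y ^+ 2) <= (Num.sqrt (1 - 2 * a))^-1.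
  have a2 : a < 2^-1 by lra.
  rewrite -[leRHS]/(fine ((Num.sqrt (1 - 2 * a))^-1)%:E).
  have e := normal_integral_expR_sqr x s_gt0 a2.
  rewrite -e; apply: le_Rintegral => //.
  - exact: (affine_integral 1 a iu).1.
  - apply/integrableP; split.
      apply/measurable_EFinP; apply: measurableT_comp => //; apply: measurable_funM => //.
      by apply: measurable_funX; exact: measurable_standardize.
    under eq_integral do rewrite /= ger0_norm ?expR_ge0//.
    by rewrite e ltry.
  - by move=> y _; exact: expR_ge1Dx.
rewrite (affine_integral 1 a iu).2.
set V := \int[_]_(y in _) _ => h.
pose b := Num.sqrt (1 - 2 * a).
have b0 : 0 < b by rewrite sqrtr_gt0; lra.
have b2 : b ^+ 2 = 1 - 2 * a by rewrite sqr_sqrtr//; lra.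
have c0 : 0 < 1 + a + 8 * a ^+ 2 by have := sqr_ge0 a; lra.
suff : b^-1 <= 1 + a + 8 * a ^+ 2 by move: h; rewrite -/b; lra.
rewrite -div1r ler_pdivrMr// -(@ler_pXn2r _ 2) ?nnegrE ?mulr_ge0 ?(ltW b0) ?(ltW c0)//.
rewrite expr1n exprMn b2.
(* For [|a| <= 1/4] the right-hand side is at least [1]; the coefficient [8] leaves room to
   spare. *)
have -> : (1 + a + 8 * a ^+ 2) ^+ 2 * (1 - 2 * a) =
    1 + a ^+ 2 * (13 - 18 * a + 32 * a ^+ 2 * (1 - 4 * a)) by ring.
have a24 : 0 <= 32 * a ^+ 2 * (1 - 4 * a).
  apply: mulr_ge0; last by lra.
  by rewrite mulr_ge0 ?sqr_ge0.
by rewrite lerDl mulr_ge0 ?sqr_ge0//; lra.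
Qed.

Lemma normal_integrable_standardize3 : N.-integrable setT (EFin \o (fun y => `|u y| ^+ 3)).
Proof.
apply: (@normal_integrable_pow _ 3) => // [|y]; last first.
  by rewrite ger0_norm// exprn_ge0.
apply: measurable_funX; apply: measurableT_comp => //; exact: measurable_standardize.
Qed.

(** A crude bound: the integrand is at most [65 * expR (u ^+ 2 / 4)], and the mean of this
    exponential is the square root of [2], bounded by [2]. Its size is immaterial, as it is finally
    divided by the square root of [n]. *)
Lemma normal_moment3 : \int[N]_y (`|u y| ^+ 3) <= 130.
Proof.
apply: (@le_trans _ _ (\int[N]_y (0 + 65 * expR (4^-1 * u y ^+ 2)))).
  apply: le_Rintegral => //; first exact: normal_integrable_standardize3.
    exact: (affine_integral _ _ normal_integrable_expR_sqr).1.
  move=> y _; rewrite add0r; have [e1 e4] := expR_quarter_sqr_ge (u y).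
  have [u1|u1] := leP `|u y| 1.
    by apply: (@le_trans _ _ 1); [rewrite exprn_ile1|lra].
  apply: (@le_trans _ _ (`|u y| ^+ 4)); first by rewrite ler_eXn2l.
  have -> : `|u y| ^+ 4 = u y ^+ 4 by rewrite -normrX ger0_norm// (exprM _ 2 2) sqr_ge0.
  by apply: (le_trans e4); rewrite ler_wpM2r ?expR_ge0// ler_nat.
rewrite (affine_integral _ _ normal_integrable_expR_sqr).2 add0r.
have -> : 130 = 65 * 2 :> R by ring.
rewrite ler_pM2l// /Rintegral normal_integral_expR_sqr//; last by lra.
rewrite /= -[leRHS]invrK lef_pV2 ?posrE ?sqrtr_gt0//; last by lra.
have <- : Num.sqrt (2^-1 ^+ 2) = 2^-1 :> R by rewrite sqrtr_sqr ger0_norm.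
by apply: ler_wsqrtr; lra.
Qed.

End moments.
End gaussian_integrals.

(** * Gaussian smoothing operators *)

Section gaussian_semigroup.
Context {R : realType}.
Local Notation mu := (@lebesgue_measure R).
Implicit Types (x s t : R) (f g : R -> R).

Definition gauss s f x : R := \int[normal_prob x s]_y f y.

(** Boundedness gives integrability against every normal law, and nonnegativity gives access to
    Tonelli's theorem. *)
Definition measurable_bounded (M : R) f := measurable_fun setT f /\ forall y, 0 <= f y <= M.

Lemma measurable_bounded_integrable M f x s : measurable_bounded M f ->
  (normal_prob x s).-integrable setT (EFin \o f).
Proof.
move=> [mf fM]; apply: (@bounded_integrable _ _ _ _ _ M) => // y.
by have /andP[f0 ?] := fM y; rewrite ger0_norm.
Qed.

Lemma gaussE M f x s : measurable_bounded M f ->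
  ((gauss s f x)%:E = \int[mu]_y (f y * normal_pdf x s y)%:E)%E.
Proof.
move=> bf; rewrite /gauss /Rintegral fineK; last first.
  by apply: integrable_fin_num => //; exact: (measurable_bounded_integrable x s bf).
have [mf fM] := bf; rewrite normal_density_integral//.
- exact/measurable_EFinP.
- by move=> y; rewrite lee_fin; case/andP: (fM y).
Qed.

Lemma gauss_dist M f g s x e : measurable_bounded M f -> measurable_bounded M g ->
  (forall y, `|f y - g y| <= e) -> `|gauss s f x - gauss s g x| <= e.
Proof.
move=> bf bg fg.
have intf := measurable_bounded_integrable x s bf.
have intg := measurable_bounded_integrable x s bg.
rewrite /gauss -RintegralB//; apply: le_trans (le_normr_Rintegral _ _) _ => //.
  exact: (integrableB measurableT intf intg).
have <- : \int[normal_prob x s]_y (cst e y) = e.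
  by rewrite Rintegral_cst// [X in fine X]probability_setT mulr1.
apply: le_Rintegral => //.
- apply: (@bounded_integrable _ _ _ _ _ e).
    apply: measurableT_comp => //; apply: measurable_funB; [exact: bf.1|exact: bg.1].
  by move=> y; rewrite normr_id.
- exact: finite_measure_integrable_cst.
Qed.

Lemma measurable_normal_pdf2 s : 0 < s ->
  measurable_fun setT (fun u : R * R => normal_pdf u.1 s u.2).
Proof.
move=> s0.
under eq_fun do rewrite normal_pdfE ?gt_eqF//.
rewrite /normal_fun; apply: measurable_funM => //; apply: measurableT_comp => //.
apply: measurable_funM => //; apply: measurableT_comp => //.
by apply: measurable_funX; apply: measurable_funB.
Qed.

Lemma gauss_measurable_bounded M f s : 0 < s -> measurable_bounded M f ->
  measurable_bounded M (gauss s f).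
Proof.
move=> s0 bf; have [mf fM] := bf; split.
  apply/measurable_EFinP; rewrite /comp.
  under eq_fun do rewrite (gaussE _ _ bf).
  pose F (u : R * R) := (f u.2 * normal_pdf u.1 s u.2)%:E.
  apply: (@measurable_fun_fubini_tonelli_F _ _ _ _ _ mu F).
    apply/measurable_EFinP; apply: measurable_funM; last exact: measurable_normal_pdf2.
    by apply: measurableT_comp.
  by move=> u; rewrite lee_fin mulr_ge0 ?normal_pdf_ge0//; case/andP: (fM u.2).
move=> x; rewrite /gauss; apply/andP; split.
  by apply: Rintegral_ge0 => y _; case/andP: (fM y).
have {1}<- : \int[normal_prob x s]_y (cst M y) = M.
  by rewrite Rintegral_cst// [X in fine X]probability_setT mulr1.
apply: le_Rintegral => //.
- exact: (measurable_bounded_integrable x s bf).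
- exact: finite_measure_integrable_cst.
- by move=> y _; case/andP: (fM y).
Qed.

(** Completing the square in [y]: the last factor is the density of the intermediate point given
    both endpoints, and integrates to one. *)
Lemma normal_pdf_convolution s t x y w : 0 < s -> 0 < t ->
  let r := Num.sqrt (s ^+ 2 + t ^+ 2) in
  normal_pdf y t w * normal_pdf x s y =
  normal_pdf x r w * normal_pdf ((x * t ^+ 2 + w * s ^+ 2) / r ^+ 2) (s * t / r) y.
Proof.
move=> s0 t0 r.
have st0 : 0 < s ^+ 2 + t ^+ 2 by rewrite addr_gt0 ?exprn_gt0.
have r0 : 0 < r by rewrite sqrtr_gt0.
have r2 : r ^+ 2 = s ^+ 2 + t ^+ 2 by rewrite sqr_sqrtr// ltW.
have str0 : 0 < s * t / r by rewrite divr_gt0// mulr_gt0.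
have q0 : 0 < Num.sqrt (pi *+ 2 : R) by rewrite sqrtr_gt0 pmulrn_lgt0// pi_gt0.
rewrite !normal_pdfE ?gt_eqF// !normal_peakE// /normal_fun mulrACA [RHS]mulrACA.
congr (_ * _); first by field; rewrite !gt_eqF.
rewrite -!expRD; congr expR.
have -> : (s * t / r) ^+ 2 = s ^+ 2 * t ^+ 2 / (s ^+ 2 + t ^+ 2).
  by rewrite expr_div_n exprMn r2.
by rewrite r2; field; rewrite !gt_eqF.
Qed.

Lemma gauss_semigroup M f s t x : 0 < s -> 0 < t -> measurable_bounded M f ->
  gauss s (gauss t f) x = gauss (Num.sqrt (s ^+ 2 + t ^+ 2)) f x.
Proof.
move=> s0 t0 bf; have [mf fM] := bf; set r := Num.sqrt _.
have f0 y : 0 <= f y by case/andP: (fM y).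
have bt := gauss_measurable_bounded t0 bf.
have e1 := gaussE x s bt; have e2 := gaussE x r bf.
apply: (fun E => congr1 fine (etrans e1 (etrans E (esym e2)))).
pose F (u : R * R) := (f u.2 * normal_pdf u.1 t u.2 * normal_pdf x s u.1)%:E.
have F0 u : (0 <= F u)%E by rewrite lee_fin !mulr_ge0 ?normal_pdf_ge0.
have mF : measurable_fun setT F.
  apply/measurable_EFinP; apply: measurable_funM.
    apply: measurable_funM; last exact: measurable_normal_pdf2.
    by apply: measurableT_comp.
  by apply: measurableT_comp => //; exact: measurable_normal_pdf.
have mpdf a b : measurable_fun setT (fun y : R => (normal_pdf a b y)%:E).
  by apply/measurable_EFinP; exact: measurable_normal_pdf.
transitivity (\int[mu]_y \int[mu]_w F (y, w))%E.
  apply: eq_integral => y _; rewrite EFinM (gaussE _ _ bf) -ge0_integralZr//.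
  - by apply/measurable_EFinP; apply: measurable_funM => //; exact: measurable_normal_pdf.
  - by move=> w _; rewrite lee_fin mulr_ge0 ?normal_pdf_ge0.
  - by rewrite lee_fin normal_pdf_ge0.
rewrite (@fubini_tonelli _ _ _ _ _ mu mu F mF F0).
apply: eq_integral => w _; rewrite /F/=.
under eq_integral do rewrite -mulrA normal_pdf_convolution// mulrA.
by rewrite integral_scaled_normal_pdf// mulr_ge0 ?normal_pdf_ge0.
Qed.

(** No derivative is mentioned: in this form the class is visibly stable under weighted averages,
    with the same [C]. *)
Definition taylor2 (C : R) f := exists f1 f2 : R -> R, forall x h,
  `|f (x + h) - f x - f1 x * h - f2 x * h ^+ 2 / 2| <= C * `|h| ^+ 3.

(** The expansion is integrated with [h = y - x]: the linear term vanishes, [h ^+ 2] has mean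
    [s ^+ 2], and [130] comes from the third absolute moment. *)
Lemma gauss_taylor2 (M C : R) f s x (f1 f2 : R) : 0 < s -> measurable_bounded M f ->
  (forall h, `|f (x + h) - f x - f1 * h - f2 * h ^+ 2 / 2| <= C * `|h| ^+ 3) ->
  `|gauss s f x - f x - f2 * s ^+ 2 / 2| <= C * (130 * s ^+ 3).
Proof.
move=> s0 bf T.
have C0 : 0 <= C by have := le_trans (normr_ge0 _) (T 1); rewrite normr1 expr1n mulr1.
pose N := normal_prob x s; pose u y := (y - x) / s.
have i1 : N.-integrable setT (EFin \o u) := normal_integrable_standardize x s0.
have i2 : N.-integrable setT (EFin \o (fun y => u y ^+ 2)) :=
  normal_integrable_standardize_sqr x s0.
have i3 := normal_integrable_standardize3 x s0.
have m1 : \int[N]_y u y = 0 := normal_moment1 x s0.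
have m2 : \int[N]_y (u y ^+ 2) = 1 := normal_moment2 x s0.
have m3 : \int[N]_y (`|u y| ^+ 3) <= 130 := normal_moment3 x s0.
have i0 : N.-integrable setT (EFin \o f) := measurable_bounded_integrable x s bf.
have [a1 b1] := affine_integral (f x) (f1 * s) i1.
have [a2 b2] := affine_integral 0 (f2 * s ^+ 2 / 2) i2.
have [a3 b3] := affine_integral 0 (C * s ^+ 3) i3.
pose q y := (f x + f1 * s * u y) + (0 + f2 * s ^+ 2 / 2 * u y ^+ 2).
have iq : N.-integrable setT (EFin \o q) by exact: (integrableD measurableT a1 a2).
have -> : gauss s f x - f x - f2 * s ^+ 2 / 2 = \int[N]_y (f y - q y).
  rewrite RintegralB// /q RintegralD// b1 b2 m1 m2 -/N /gauss.
  by ring.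
apply: le_trans (le_normr_Rintegral _ _) _ => //.
  exact: (integrableB measurableT i0 iq).
apply: (@le_trans _ _ (\int[N]_y (0 + C * s ^+ 3 * `|u y| ^+ 3))).
  apply: le_Rintegral => //.
    exact: (integrable_norm (integrableB measurableT i0 iq)).
  move=> y _; rewrite add0r.
  have := T (y - x); rewrite [x + _]addrC subrK.
  have us : y - x = s * u y by rewrite /u mulrC divfK ?gt_eqF.
  rewrite us normrM (gtr0_norm s0).
  by congr (`|_| <= _); rewrite /q; ring.
rewrite b3 add0r.
have s30 : 0 <= C * s ^+ 3 by rewrite mulr_ge0// exprn_ge0// ltW.
have := ler_wpM2l s30 m3.
move=> /le_trans; apply.
by rewrite le_eqVlt; apply/orP; left; apply/eqP; ring.
Qed.

End gaussian_semigroup.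

(** * Lindeberg's replacement argument *)

Section lindeberg.
Context {R : realType} {m : nat}.
Variable w : 'I_m -> R.
Hypotheses (w_ge0 : forall k, 0 <= w k) (w_sum : \sum_k w k = 1).
Implicit Types (zeta : 'I_m -> R) (f : R -> R).

(** The transition operator of a random walk with steps [zeta k] of probability [w k]; its iterates
    are expectations after several steps. *)
Definition average zeta f (x : R) : R := \sum_k w k * f (x + zeta k).

Lemma weighted_sum_le (a : 'I_m -> R) (M : R) : (forall k, `|a k| <= M) ->
  `|\sum_k w k * a k| <= M.
Proof.
move=> aM; apply: (le_trans (ler_norm_sum _ _ _)).
rewrite -[leRHS]mul1r -w_sum mulr_suml; apply: ler_sum => k _.
by rewrite normrM ger0_norm// ler_wpM2l.
Qed.

Lemma average_measurable_bounded M zeta f : measurable_bounded M f ->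
  measurable_bounded M (average zeta f).
Proof.
move=> [mf fM]; split.
  rewrite /average; apply: measurable_sum => k; apply: measurable_funM => //.
  by apply: measurableT_comp => //; apply: measurable_funD.
move=> x; apply/andP; split.
  by apply: sumr_ge0 => k _; rewrite mulr_ge0//; case/andP: (fM (x + zeta k)).
rewrite -[leRHS]mul1r -w_sum mulr_suml; apply: ler_sum => k _.
by rewrite ler_wpM2l//; case/andP: (fM (x + zeta k)).
Qed.

Lemma average_taylor2 C zeta f : taylor2 C f -> taylor2 C (average zeta f).
Proof.
move=> [f1 [f2 T]]; exists (average zeta f1), (average zeta f2) => x h.
have -> : average zeta f (x + h) - average zeta f x - average zeta f1 x * h
    - average zeta f2 x * h ^+ 2 / 2 =
  \sum_k w k * (f (x + zeta k + h) - f (x + zeta k) - f1 (x + zeta k) * h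
    - f2 (x + zeta k) * h ^+ 2 / 2).
  rewrite /average !mulr_suml -!sumrB; apply: eq_bigr => k _.
  by rewrite (addrAC x h); ring.
by apply: weighted_sum_le => k; exact: T.
Qed.

(** The first two moments of the discrete step and of the Gaussian agree, so both means equal
    [f x + f2 x * s ^+ 2 / 2] up to a cubic error. *)
Lemma average_gauss_dist M C zeta s f x : 0 < s -> measurable_bounded M f -> taylor2 C f ->
  \sum_k w k * zeta k = 0 -> \sum_k w k * zeta k ^+ 2 = s ^+ 2 ->
  `|average zeta f x - gauss s f x| <= C * (\sum_k w k * `|zeta k| ^+ 3 + 130 * s ^+ 3).
Proof.
move=> s0 bf [f1 [f2 T]] z1 z2.
have := gauss_taylor2 s0 bf (T x).
have : `|average zeta f x - f x - f2 x * s ^+ 2 / 2| <= C * \sum_k w k * `|zeta k| ^+ 3.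
  have -> : average zeta f x - f x - f2 x * s ^+ 2 / 2 =
    \sum_k w k * (f (x + zeta k) - f x - f1 x * zeta k - f2 x * zeta k ^+ 2 / 2).
    transitivity (average zeta f x - f x * \sum_k w k - f1 x * \sum_k w k * zeta k
        - f2 x / 2 * \sum_k w k * zeta k ^+ 2).
      by rewrite w_sum z1 z2; ring.
    rewrite /average !mulr_sumr -!sumrB; apply: eq_bigr => k _.
    by ring.
  apply: (le_trans (ler_norm_sum _ _ _)); rewrite mulr_sumr; apply: ler_sum => k _.
  by rewrite normrM ger0_norm// [leRHS]mulrCA ler_wpM2l.
rewrite mulrDr => h1 h2; apply: le_trans (lerD h1 h2).
rewrite (_ : average zeta f x - gauss s f x =
    (average zeta f x - f x - f2 x * s ^+ 2 / 2) -
    (gauss s f x - f x - f2 x * s ^+ 2 / 2)); last by ring.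
exact: ler_normB.
Qed.

(** One step is replaced at a time. Iterates of [average] keep the constants [M] and [C], so each
    replacement costs the same, and [gauss s] does not increase the error already made. *)
Lemma iter_average_gauss_dist M C zeta s f n x : 0 < s ->
  measurable_bounded M f -> taylor2 C f ->
  \sum_k w k * zeta k = 0 -> \sum_k w k * zeta k ^+ 2 = s ^+ 2 ->
  `|iter n.+1 (average zeta) f x - gauss (s * Num.sqrt n.+1%:R) f x| <=
  n.+1%:R * (C * (\sum_k w k * `|zeta k| ^+ 3 + 130 * s ^+ 3)).
Proof.
move=> s0 bf tf z1 z2; set K := C * _.
elim: n x => [|n IH] x.
  by rewrite sqrtr1 mulr1 mul1r; exact: average_gauss_dist bf tf z1 z2.
have [bi ti] : measurable_bounded M (iter n.+1 (average zeta) f) /\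
    taylor2 C (iter n.+1 (average zeta) f).
  elim: n.+1 => [|k [bk tk]] //.
  by split; [exact: average_measurable_bounded|exact: average_taylor2].
have sn0 : 0 < s * Num.sqrt (n.+1%:R : R) by rewrite mulr_gt0// sqrtr_gt0.
have -> : s * Num.sqrt n.+2%:R = Num.sqrt (s ^+ 2 + (s * Num.sqrt n.+1%:R) ^+ 2).
  rewrite exprMn sqr_sqrtr// -[X in X + _]mulr1 -mulrDr -natr1 addrC.
  by rewrite sqrtrM ?sqr_ge0// sqrtr_sqr gtr0_norm// (natr1 n.+1) addrC natr1.
rewrite -(gauss_semigroup x s0 sn0 bf).
have h1 := average_gauss_dist x s0 bi ti z1 z2.
have h2 := gauss_dist s x bi (gauss_measurable_bounded sn0 bf) IH.
apply: (@le_trans _ _ (K + n.+1%:R * K)); last first.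
  by rewrite -[X in _ <= X * _]natr1 mulrDl mul1r addrC.
apply: le_trans (lerD h1 h2); apply: le_trans (ler_normD _ _).
by rewrite addrA subrK.
Qed.

(** Rescaling divides each cubic error by [n.+1] to the power [3/2], and there are [n.+1] of
    them. *)
Lemma lindeberg M C zeta s f n x : 0 < s -> measurable_bounded M f -> taylor2 C f ->
  \sum_k w k * zeta k = 0 -> \sum_k w k * zeta k ^+ 2 = s ^+ 2 ->
  `|iter n.+1 (average (fun k => zeta k / Num.sqrt n.+1%:R)) f x - gauss s f x| <=
  C * (\sum_k w k * `|zeta k| ^+ 3 + 130 * s ^+ 3) / Num.sqrt n.+1%:R.
Proof.
move=> s0 bf tf z1 z2; set r := Num.sqrt _.
have r0 : 0 < r by rewrite sqrtr_gt0.
have r2 : r ^+ 2 = n.+1%:R by rewrite sqr_sqrtr.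
have sr0 : 0 < s / r by rewrite divr_gt0.
have := @iter_average_gauss_dist M C (fun k => zeta k / r) (s / r) f n x sr0 bf tf.
rewrite -/r divfK ?gt_eqF//.
have -> : \sum_k w k * (zeta k / r) = 0.
  by under eq_bigr do rewrite mulrA; rewrite -mulr_suml z1 mul0r.
have -> : \sum_k w k * (zeta k / r) ^+ 2 = (s / r) ^+ 2.
  by under eq_bigr do rewrite expr_div_n mulrA; rewrite -mulr_suml z2 expr_div_n.
have -> : \sum_k w k * `|zeta k / r| ^+ 3 = (\sum_k w k * `|zeta k| ^+ 3) / r ^+ 3.
  rewrite mulr_suml; apply: eq_bigr => k _.
  by rewrite normrM normfV (gtr0_norm r0) exprMn exprVn mulrA.
move=> /(_ erefl erefl); congr (_ <= _).
by rewrite -r2; field; rewrite gt_eqF.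
Qed.

End lindeberg.

(** * Smoothing of compactly supported test functions *)

Section smoothing.
Context {R : realType}.
Local Notation mu := (@lebesgue_measure R).

Lemma derive_pow_bound (psi dpsi : R -> R) (C : R) k (t : R) :
  (forall t : R, is_derive t 1 psi (dpsi t)) -> psi 0 = 0 ->
  (forall t, `|dpsi t| <= C * `|t| ^+ k) -> `|psi t| <= C * `|t| ^+ k.+1.
Proof.
move=> D psi0 dC.
have C0 : 0 <= C by have := le_trans (normr_ge0 _) (dC 1); rewrite normr1 expr1n mulr1.
have cpsi a b : {within `[a, b], continuous psi}.
  apply: continuous_subspaceT => y.
  by apply: differentiable_continuous; apply/derivable1_diffP; case: (D y).
have fin c : `|c| <= `|t| -> `|dpsi c * t| <= C * `|t| ^+ k.+1.
  move=> ct; rewrite normrM exprSr mulrA ler_wpM2r//; apply: (le_trans (dC c)).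
  by rewrite ler_wpM2l// lerXn2r ?nnegrE.
have [t0|t0|->] := ltgtP t 0.
- have [c] := MVT t0 (fun y _ => D y) (cpsi _ _).
  rewrite in_itv/= psi0 !sub0r => /andP[tc c0] e.
  have -> : psi t = dpsi c * t by rewrite -[LHS]opprK e mulrN opprK.
  by apply: fin; rewrite !ltr0_norm// lerN2 ltW.
- have [c] := MVT t0 (fun y _ => D y) (cpsi _ _).
  rewrite in_itv/= psi0 !subr0 => /andP[c0 ct] ->.
  by apply: fin; rewrite !gtr0_norm// ltW.
- by rewrite psi0 normr0 mulr_ge0// exprn_ge0.
Qed.

(** [derive_pow_bound] is applied three times, from the second derivative back to [f], each
    remainder vanishing at [0]; the factorials that integration would yield are given up. *)
Lemma is_derive_taylor2 (C : R) (f f1 f2 f3 : R -> R) :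
  (forall t : R, is_derive t 1 f (f1 t)) -> (forall t : R, is_derive t 1 f1 (f2 t)) ->
  (forall t : R, is_derive t 1 f2 (f3 t)) -> (forall t, `|f3 t| <= C) -> taylor2 C f.
Proof.
move=> D0 D1 D2 f3C; exists f1, f2 => x h.
have shift (g dg : R -> R) : (forall t : R, is_derive t 1 g (dg t)) ->
    forall t : R, is_derive t 1 (fun h => g (x + h)) (dg (x + t)).
  move=> Dg t; rewrite -[dg _]mulr1.
  have Dx : is_derive t 1 (fun h : R => x + h) 1.
    by have := is_deriveD (is_derive_cst x t 1) (is_derive_id t (1 : R)); rewrite add0r.
  exact: (is_derive1_comp (Dg (x + t)) Dx).
have b2 t : `|f2 (x + t) - f2 x| <= C * `|t| ^+ 1.
  apply: (@derive_pow_bound (fun t => f2 (x + t) - f2 x) (fun t => f3 (x + t))) => //.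
  - by move=> u; have Du := shift _ _ D2 u; apply: is_derive_eq; rewrite subr0.
  - by rewrite addr0 subrr.
  - by move=> u; rewrite mulr1.
have b1 t : `|f1 (x + t) - f1 x - f2 x * t| <= C * `|t| ^+ 2.
  apply: (@derive_pow_bound (fun t => f1 (x + t) - f1 x - f2 x * t)
    (fun t => f2 (x + t) - f2 x)) => //.
  - move=> u; have Du := shift _ _ D1 u.
    by apply: is_derive_eq; rewrite subr0 -[_%:A]/(f2 x * 1) mulr1.
  - by rewrite addr0 subrr mulr0 subrr.
apply: (@derive_pow_bound (fun t => f (x + t) - f x - f1 x * t - f2 x * t ^+ 2 / 2)
    (fun t => f1 (x + t) - f1 x - f2 x * t)) => //.
- move=> u; have Du := shift _ _ D0 u.
  apply: is_derive_eq.
  rewrite -[LHS]/(f1 (x + u) - 0 - f1 x * 1 -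
    ((f2 x * u ^+ 2) * (- 2 ^- 2 * 0) + 2^-1 * (f2 x * (u * 1 + u * 1)))).
  by field.
- by rewrite addr0 subrr mulr0 expr0n/= mulr0 mul0r !subr0.
Qed.

Lemma is_derive_continuous (f df : R -> R) :
  (forall t : R, is_derive t 1 f (df t)) -> continuous f.
Proof.
move=> D y; apply: differentiable_continuous; apply/derivable1_diffP.
by case: (D y).
Qed.

Definition supported (K : R) (f : R -> R) := forall t, K < `|t| -> f t = 0.

Lemma supported_primitive (K : R) (f : R -> R) : continuous f -> supported K f ->
  exists F : R -> R, forall t : R, is_derive t 1 F (f t).
Proof.
move=> cf sf.
have intf : mu.-integrable setT (EFin \o f).
  have : mu.-integrable `[- K, K] (EFin \o f).
    apply: continuous_compact_integrable; first exact: segment_compact.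
    exact: continuous_subspaceT.
  move=> H.
  have mI : measurable (`[- K, K]%classic : set (measurableTypeR R)).
    exact: measurable_itv.
  have := (@integrable_mkcond _ (measurableTypeR R) R mu _ (EFin \o f) mI).1 H.
  congr (mu.-integrable _ _); apply/funext => t; rewrite patchE.
  case: ifPn => // /negP; rewrite inE/= in_itv/= -ler_norml => /negP.
  by rewrite -ltNge => /sf ->.
exists (fun t => \int[mu]_(y in [set` Interval -oo%O (BRight t)]) f y) => t.
have [||||dF F'] := @continuous_FTC1 R f -oo%O t (t + 1) => //.
- by rewrite ltrDl.
- exact: (integrableS measurableT).
- by rewrite ltNyr.
- exact: cf.
split; first exact: dF.
by rewrite -F' derive1E.
Qed.

Lemma is_derive_shift (g dg : R -> R) x : (forall t : R, is_derive t 1 g (dg t)) ->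
  forall t : R, is_derive t 1 (fun h => g (h + x)) (dg (t + x)).
Proof.
move=> Dg t; rewrite -[dg _]mulr1.
have Dx : is_derive t 1 (fun h : R => h + x) 1.
  by have := is_deriveD (is_derive_id t (1 : R)) (is_derive_cst x t 1); rewrite addr0.
exact: (@is_derive1_comp _ g (fun h => h + x) t _ 1 (Dg (t + x)) Dx).
Qed.

Definition quotient_diff (d : R) (f : R -> R) t := (f (t + d) - f t) / d.

Lemma is_derive_quotient_diff d (f df : R -> R) : (forall t : R, is_derive t 1 f (df t)) ->
  forall t : R, is_derive t 1 (quotient_diff d f) (quotient_diff d df t).
Proof.
move=> Df t; have D1 := is_derive_shift d Df t; have D2 := Df t.
rewrite (_ : quotient_diff d f = (d^-1 *: (fun t => f (t + d) - f t))); last first.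
  by apply/funext => y; rewrite /quotient_diff mulrC.
by apply: is_derive_eq; rewrite /quotient_diff mulrC.
Qed.

(** [v t] is the mean of [f] over [[t, t + d]], hence a value of [f] on it. The modulus of
    continuity follows in the same way from the mean value theorem for the difference of two
    translates of the primitive. As [d] and [e] are preserved, the construction can be iterated. *)
Lemma moving_average (K M d e : R) (f : R -> R) : 0 < d -> continuous f -> supported K f ->
  (forall t, 0 <= f t <= M) -> (forall s t, `|s - t| <= d -> `|f s - f t| <= e) ->
  exists v : R -> R, [/\ (forall t : R, is_derive t 1 v (quotient_diff d f t)),
    supported (K + d) v, (forall t, 0 <= v t <= M),
    (forall s t, `|s - t| <= d -> `|v s - v t| <= e) & (forall t, `|v t - f t| <= e)].
Proof.
move=> d0 cf sf fM fe; have [F DF] := supported_primitive cf sf.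
pose v := quotient_diff d F.
have mvt (G g : R -> R) t : (forall t : R, is_derive t 1 G (g t)) ->
    exists2 c, t < c < t + d & G (t + d) - G t = g c * d.
  move=> DG; have ttd : t < t + d by rewrite ltrDl.
  have cG : {within `[t, t + d], continuous G}.
    exact/continuous_subspaceT/(is_derive_continuous DG).
  have [c + ->] := MVT ttd (fun y _ => DG y) cG.
  by rewrite in_itv/= => tc; exists c => //; rewrite addrAC subrr add0r.
have vE t : exists2 c, t < c < t + d & v t = f c.
  have [c tc e1] := mvt F f t DF; exists c => //.
  by rewrite /v /quotient_diff e1 mulfK// gt_eqF.
exists v; split.
- exact: is_derive_quotient_diff.
- move=> t Kt; have [c /andP[tc ctd] ->] := vE t; apply: sf.
  rewrite ltNge; apply/negP => cK; move: Kt; rewrite ltNge => /negP; apply.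
  have : `|t - c| <= d by rewrite ler_norml; apply/andP; split; lra.
  by have := ler_normD (t - c) c; rewrite subrK; lra.
- by move=> t; have [c _ ->] := vE t.
- move=> s t st; pose G y := F (y + (s - t)) - F y.
  have DG (y : R) : is_derive y 1 G (f (y + (s - t)) - f y).
    by have D1 := is_derive_shift (s - t) DF y; have D2 := DF y; apply: is_deriveB.
  have [c _ e1] := mvt G _ t DG.
  have -> : v s - v t = f (c + (s - t)) - f c.
    have : v s - v t = (G (t + d) - G t) / d.
      rewrite /v /quotient_diff /G -mulrBl; congr (_ / _).
      have -> : t + d + (s - t) = s + d by ring.
      have -> : t + (s - t) = s by ring.
      by ring.
    by move=> ->; rewrite e1 mulfK// gt_eqF.
  by apply: fe; rewrite addrAC subrr add0r.
- move=> t; have [c /andP[tc ctd] ->] := vE t; apply: fe.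
  by rewrite ler_norml; apply/andP; split; lra.
Qed.

Lemma supported_unif_continuous (K e : R) (f : R -> R) : 0 < e -> continuous f ->
  supported K f ->
  exists2 d : R, 0 < d & forall s t, `|s - t| <= d -> `|f s - f t| <= e.
Proof.
move=> e0 cf sf.
have e20 : 0 < e / 2 by rewrite divr_gt0.
have cover := (compact_near_coveringP _).1 (@segment_compact R (- (K + 1)) (K + 1)).
have H : \forall d \near (0 : R)^'+, `[- (K + 1), K + 1] `<=`
    [set s | forall t, `|s - t| <= d -> `|f s - f t| <= e].
  apply: cover => s _.
  have /cvgrPdist_le/(_ _ e20)/nbhs_ballP[r/= r0 rf] := cf s.
  have r20 : 0 < r / 2 by rewrite divr_gt0.
  exists (ball s (r / 2), [set d | d < r / 2]) => /=.
    split; first exact: nbhsx_ballx.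
    exact: nbhs_right_lt.
  move=> [s' d]/= [ss' dr] t st.
  have fs' : `|f s - f s'| <= e / 2.
    by apply: rf; apply: le_ball ss'; rewrite ler_pdivrMr// ler_peMr ?ler1n// ltW.
  have ft : `|f s - f t| <= e / 2.
    apply: rf; rewrite [r]splitr; apply: ball_triangle ss' _.
    by rewrite /ball/= (le_lt_trans st).
  rewrite [leRHS]splitr; apply: le_trans (lerD fs' ft).
  rewrite -[X in _ <= X + _]normrN; apply: le_trans (ler_normD _ _).
  by rewrite opprB addrA subrK.
near (0 : R)^'+ => d.
have d0 : 0 < d by near: d; exact: nbhs_right_gt.
have d1 : d <= 1 by near: d; exact: nbhs_right_le.
exists d => // s t st.
have [sK|sK] := leP `|s| (K + 1).
  have Hd : `[- (K + 1), K + 1] `<=` [set s | forall t, `|s - t| <= d -> `|f s - f t| <= e].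
    by near: d.
  by apply: Hd => //=; rewrite in_itv/= -ler_norml.
rewrite !sf ?subrr ?normr0 ?(ltW e0)//; last by lra.
have : `|s| <= `|s - t| + `|t| by have := ler_normD (s - t) t; rewrite subrK.
by lra.
Unshelve. all: by end_near.
Qed.

Lemma quotient_diff_bound d (f : R -> R) (M : R) : 0 < d -> (forall t, `|f t| <= M) ->
  forall t, `|quotient_diff d f t| <= 2 * M / d.
Proof.
move=> d0 fM t; rewrite /quotient_diff normrM normfV (gtr0_norm d0).
rewrite ler_pM2r ?invr_gt0//; apply: (le_trans (ler_normB _ _)).
by have := fM t; have := fM (t + d); lra.
Qed.

(** Each of three moving averages costs [e / 3] and gains one derivative; the third derivative is a
    triple difference quotient of [f], bounded by [8 M / d ^+ 3]. *)
Lemma smooth_approximation (K M e : R) (f : R -> R) : 0 < e -> continuous f ->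
  supported K f -> (forall t, 0 <= f t <= M) ->
  exists g C, [/\ taylor2 C g, measurable_bounded M g & forall t, `|g t - f t| <= e].
Proof.
move=> e0 cf sf fM.
have e30 : 0 < e / 3 by rewrite divr_gt0.
have [d d0 fe] := supported_unif_continuous e30 cf sf.
have [v1 [D1 s1 v1M v1e v1f]] := moving_average d0 cf sf fM fe.
have c1 := is_derive_continuous D1.
have [v2 [D2 s2 v2M v2e v2f]] := moving_average d0 c1 s1 v1M v1e.
have c2 := is_derive_continuous D2.
have [v3 [D3 s3 v3M v3e v3f]] := moving_average d0 c2 s2 v2M v2e.
have c3 := is_derive_continuous D3.
have fb t : `|f t| <= M by have /andP[f0 ?] := fM t; rewrite ger0_norm.
have b1 := quotient_diff_bound d0 fb; have b2 := quotient_diff_bound d0 b1.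
have b3 := quotient_diff_bound d0 b2.
exists v3, (2 * (2 * (2 * M / d) / d) / d); split.
- apply: is_derive_taylor2 D3 _ _ b3.
    exact: is_derive_quotient_diff.
  exact/is_derive_quotient_diff/is_derive_quotient_diff.
- by split => //; exact: continuous_measurable_fun.
- move=> t; rewrite (_ : v3 t - f t = (v3 t - v2 t) + (v2 t - v1 t) + (v1 t - f t)); last by ring.
  apply: (le_trans (ler_normD _ _)).
  have := ler_normD (v3 t - v2 t) (v2 t - v1 t).
  by have := v3f t; have := v2f t; have := v1f t; lra.
Qed.

End smoothing.

(** * Means over words *)

(** Cauchy-Schwarz, from the nonnegativity of the sum of the [(m a_j - S) ^+ 2], where [S] is the
    sum of the [a_j]. *)
Lemma sqr_sum_le (R : realFieldType) (m : nat) (a : 'I_m -> R) :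
  (\sum_j a j) ^+ 2 <= m%:R * \sum_j a j ^+ 2.
Proof.
case: m a => [|n] a; first by rewrite !big_ord0 expr0n mul0r.
set N : R := n.+1%:R.
have N0 : 0 < N by rewrite ltr0n.
have expand (S : R) : \sum_j (N * a j - S) ^+ 2 =
    N ^+ 2 * (\sum_j a j ^+ 2) - 2 * N * S * (\sum_j a j) + N * S ^+ 2.
  rewrite (_ : N * S ^+ 2 = \sum_(j < n.+1) S ^+ 2).
    by rewrite !mulr_sumr -sumrB -big_split/=; apply: eq_bigr => j _; ring.
  by rewrite sumr_const card_ord -[RHS]mulr_natl.
have : 0 <= \sum_j (N * a j - \sum_j a j) ^+ 2.
  by apply: sumr_ge0 => j _; exact: sqr_ge0.
rewrite expand; set S := \sum_j a j.
have -> : N ^+ 2 * (\sum_j a j ^+ 2) - 2 * N * S * S + N * S ^+ 2 =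
    N * (N * \sum_j a j ^+ 2 - S ^+ 2) by ring.
by rewrite pmulr_rge0// subr_ge0.
Qed.

Section words.
Context {R : realType} {m : nat}.
Variable w : 'I_m -> R.
Hypotheses (w_ge0 : forall k, 0 <= w k) (w_sum : \sum_k w k = 1).
Implicit Types (F G : seq 'I_m -> R) (zeta : 'I_m -> R).

(** The expectation of [F] over words of [n] independent letters of law [w]. Splitting off the first
    letter matches the iteration of [average]. *)
Fixpoint word_mean n F : R :=
  if n is n'.+1 then \sum_k w k * word_mean n' (fun s => F (k :: s)) else F [::].

Lemma word_meanE n F :
  word_mean n F = \sum_(t : n.-tuple 'I_m) (\prod_(k <- t) w k) * F t.
Proof.
elim: n F => [|n IH] F /=.
  rewrite (big_pred1 [tuple]) => [|t]; first by rewrite big_nil mul1r.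
  by apply/esym/eqP; exact: tuple0.
rewrite (reindex (fun kt : 'I_m * n.-tuple 'I_m => [tuple of kt.1 :: kt.2]))/=; last first.
  exists (fun t => (thead t, [tuple of behead t])) => [[k t] _|t _] /=.
    by congr pair; apply: val_inj.
  exact/esym/tuple_eta.
rewrite -(pair_bigA _ (fun k (t : n.-tuple 'I_m) => (\prod_(j <- k :: t) w j) * F (k :: t)))/=.
apply: eq_bigr => k _; rewrite IH mulr_sumr; apply: eq_bigr => t _.
by rewrite big_cons mulrA.
Qed.

Lemma eq_word_mean n F G : (forall s, size s = n -> F s = G s) ->
  word_mean n F = word_mean n G.
Proof.
move=> FG; rewrite !word_meanE; apply: eq_bigr => t _.
by rewrite FG// size_tuple.
Qed.

Lemma word_mean_le n F G : (forall s, size s = n -> F s <= G s) ->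
  word_mean n F <= word_mean n G.
Proof.
move=> FG; rewrite !word_meanE; apply: ler_sum => t _.
by rewrite ler_wpM2l ?FG ?size_tuple//; apply: prodr_ge0.
Qed.

Lemma word_meanD n F G : word_mean n (fun s => F s + G s) = word_mean n F + word_mean n G.
Proof.
by rewrite !word_meanE -big_split/=; apply: eq_bigr => t _; rewrite mulrDr.
Qed.

Lemma word_meanZ n (a : R) F : word_mean n (fun s => a * F s) = a * word_mean n F.
Proof. by rewrite !word_meanE mulr_sumr; apply: eq_bigr => t _; rewrite mulrCA. Qed.

Lemma word_meanB n F G : word_mean n (fun s => F s - G s) = word_mean n F - word_mean n G.
Proof.
under eq_word_mean do rewrite -mulN1r.
by rewrite word_meanD word_meanZ mulN1r.
Qed.

Lemma word_mean_cst n (a : R) : word_mean n (fun=> a) = a.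
Proof. by elim: n => //= n IH; rewrite IH -mulr_suml w_sum mul1r. Qed.

Lemma word_mean_sum n (I : finType) (F : I -> seq 'I_m -> R) :
  word_mean n (fun s => \sum_i F i s) = \sum_i word_mean n (F i).
Proof.
rewrite word_meanE; under eq_bigr do rewrite mulr_sumr.
by rewrite exchange_big/=; apply: eq_bigr => i _; rewrite word_meanE.
Qed.

Lemma word_mean_norm n F G : (forall s, size s = n -> `|F s| <= G s) ->
  `|word_mean n F| <= word_mean n G.
Proof.
move=> FG; rewrite ler_norml -mulN1r -word_meanZ; apply/andP; split;
  apply: word_mean_le => s sn; have := FG s sn; rewrite ler_norml => /andP[] //.
by rewrite mulN1r.
Qed.

Lemma word_mean_iter n zeta (f : R -> R) x :
  word_mean n (fun s => f (x + \sum_(k <- s) zeta k)) = iter n (average w zeta) f x.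
Proof.
elim: n x => [|n IH] x /=; first by rewrite big_nil addr0.
rewrite /average; apply: eq_bigr => k _; rewrite -IH; congr (_ * _).
by apply: eq_word_mean => s _; rewrite big_cons addrA.
Qed.

Lemma word_mean_sqr n zeta x : \sum_k w k * zeta k = 0 ->
  word_mean n (fun s => (x + \sum_(k <- s) zeta k) ^+ 2) =
  x ^+ 2 + n%:R * \sum_k w k * zeta k ^+ 2.
Proof.
move=> z0; elim: n x => [|n IH] x /=; first by rewrite big_nil addr0 mul0r addr0.
under eq_bigr => k _.
  rewrite (@eq_word_mean _ _ (fun s => ((x + zeta k) + \sum_(k <- s) zeta k) ^+ 2)).
    rewrite IH; over.
  by move=> s _; rewrite big_cons addrA.
transitivity (x ^+ 2 * \sum_k w k + 2 * x * \sum_k w k * zeta k + \sum_k w k * zeta k ^+ 2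
    + (\sum_k w k) * (n%:R * \sum_k w k * zeta k ^+ 2)); last first.
  by rewrite w_sum z0 -natr1; ring.
rewrite [(\sum_k w k) * _]mulr_suml !(mulr_sumr (index_enum _) xpredT) -!big_split/=.
by apply: eq_bigr => k _; ring.
Qed.

Definition frequency (s : seq 'I_m) : 'rV[R]_m :=
  \row_j ((count_mem j s)%:R / (size s)%:R).

Lemma frequency_ge0 s k : 0 <= frequency s ord0 k.
Proof. by rewrite mxE divr_ge0. Qed.

Lemma frequency_sum (a : 'I_m -> R) s :
  \sum_k frequency s ord0 k * a k = (\sum_(k <- s) a k) / (size s)%:R.
Proof.
under eq_bigr do rewrite mxE mulrAC; rewrite -mulr_suml; congr (_ / _).
elim: s => [|j s IH]; first by rewrite big_nil big1// => k _; rewrite mul0r.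
rewrite big_cons -IH (bigD1 j)//= [in RHS](bigD1 j)//= eqxx addrA natrD mulrDl mul1r.
congr (_ + _); apply: eq_bigr => k /negbTE kj.
by rewrite eq_sym kj.
Qed.

Lemma frequency_total s : size s != 0%N -> \sum_k frequency s ord0 k = 1.
Proof.
move=> s0; have := frequency_sum (fun=> 1) s.
under eq_bigr do rewrite mulr1.
by rewrite big_const_seq count_predT iter_addr_0 divff// pnatr_eq0.
Qed.

Definition deviation (s : seq 'I_m) : R := \sum_k `|frequency s ord0 k - w k|.

(** Cauchy-Schwarz over the coordinates costs one factor [m]; each coordinate is a mean of [n]
    independent centred variables of variance at most [1], and summing over coordinates gives the
    other. *)
Lemma deviation_sqr_mean n : (0 < n)%N ->
  n%:R * word_mean n (fun s => deviation s ^+ 2) <= (m * m)%:R.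
Proof.
move=> n0; have nR : 0 < n%:R :> R by rewrite ltr0n.
pose zeta j k : R := (k == j)%:R - w j.
have z0 j : \sum_k w k * zeta j k = 0.
  rewrite /zeta; under eq_bigr do rewrite mulrBr.
  rewrite sumrB -mulr_suml w_sum mul1r (bigD1 j)//= eqxx mulr1 big1 ?addr0 ?subrr//.
  by move=> k /negbTE ->; rewrite mulr0.
have z2 j : \sum_k w k * zeta j k ^+ 2 <= 1.
  rewrite -w_sum; apply: ler_sum => k _; rewrite ler_piMr//.
  have wj1 : w j <= 1 by rewrite -w_sum (bigD1 j)//= lerDl sumr_ge0.
  have := w_ge0 j; rewrite /zeta => wj0.
  rewrite -(real_normK (num_real _)) exprn_ile1// ler_norml.
  by case: (k == j); apply/andP; split; rewrite /=; lra.
have freq s j : size s = n -> frequency s ord0 j - w j = (\sum_(k <- s) zeta j k) / n%:R.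
  move=> sn; have := frequency_sum (fun k => zeta j k) s; rewrite sn => <-.
  rewrite /zeta; under eq_bigr do rewrite mulrBr.
  rewrite sumrB -mulr_suml frequency_total ?sn -?lt0n// mul1r; congr (_ - _).
  rewrite (bigD1 j)//= eqxx mulr1 big1 ?addr0//.
  by move=> k /negbTE ->; rewrite mulr0.
(* The term [0 +] is the starting point [x = 0] of [word_mean_sqr]. *)
have dev s : size s = n -> deviation s ^+ 2 <=
    m%:R * \sum_j (0 + \sum_(k <- s) zeta j k) ^+ 2 / n%:R ^+ 2.
  move=> sn; rewrite /deviation.
  have -> : \sum_j (0 + \sum_(k <- s) zeta j k) ^+ 2 / n%:R ^+ 2 =
      \sum_j `|frequency s ord0 j - w j| ^+ 2.
    by apply: eq_bigr => j _; rewrite (freq s j sn) add0r real_normK ?num_real// expr_div_n.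
  exact: sqr_sum_le.
apply: (@le_trans _ _ (n%:R * word_mean n (fun s =>
    m%:R / n%:R ^+ 2 * \sum_j (0 + \sum_(k <- s) zeta j k) ^+ 2))).
  rewrite ler_pM2l//; apply: word_mean_le => s sn.
  by apply: le_trans (dev s sn) _; rewrite -mulr_suml mulrA mulrAC.
rewrite word_meanZ word_mean_sum.
under eq_bigr do rewrite word_mean_sqr// expr0n/= add0r.
rewrite -mulr_sumr (_ : n%:R * _ = m%:R * \sum_j \sum_k w k * zeta j k ^+ 2); last first.
  by field; rewrite gt_eqF.
rewrite natrM ler_wpM2l//; apply: (@le_trans _ _ (\sum_(j < m) 1)).
  by apply: ler_sum => j _.
by rewrite sumr_const card_ord.
Qed.

End words.

(** * The central limit theorem over words, with perturbation *)

Section word_limits.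
Context {R : realType} {m : nat}.
Variables (w zeta : 'I_m -> R).
Hypotheses (w_gt0 : forall k, 0 < w k) (w_sum : \sum_k w k = 1).
Hypothesis zeta_mean : \sum_k w k * zeta k = 0.
Let w_ge0 k : 0 <= w k. Proof. exact: ltW. Qed.
Local Notation v := (\sum_k w k * zeta k ^+ 2).
Local Notation nu := (normal_law 0 v).
Let S n (s : seq 'I_m) : R := (\sum_(k <- s) zeta k) / Num.sqrt n%:R.

Lemma word_mean_clt (K M : R) (g : R -> R) : continuous g -> supported K g ->
  (forall t, 0 <= g t <= M) ->
  word_mean w n (fun s => g (S n s)) @[n --> \oo] --> \int[nu]_t g t.
Proof.
move=> cg sg gM.
have mg : measurable_fun setT g by exact: continuous_measurable_fun.
have v0 : 0 <= v by apply: sumr_ge0 => k _; rewrite mulr_ge0 ?sqr_ge0.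
(* As the weights are positive, zero variance forces [zeta = 0], and both sides are [g 0]. Otherwise
   the deviation is positive, as [lindeberg] requires. *)
have [v_eq0|v_neq0] := eqVneq v 0.
  have z0 k : zeta k = 0.
    apply/eqP; rewrite -sqrf_eq0; have := v_eq0.
    move=> /eqP; rewrite psumr_eq0 => [/allP/(_ k)|j _]; last by rewrite mulr_ge0 ?sqr_ge0.
    by rewrite mem_index_enum => /(_ isT)/=; rewrite mulf_eq0 gt_eqF.
  rewrite /normal_law v_eq0 eqxx.
  have -> : (fun n => word_mean w n (fun s => g (S n s))) = cst (g 0).
    apply/funext => n /=; rewrite -[RHS](word_mean_cst w_sum n); apply: eq_word_mean => s _.
    by rewrite /S big1 ?mul0r// => k _; rewrite z0.
  have -> : \int[\d_(0 : measurableTypeR R)]_t g t = g 0.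
    rewrite /Rintegral integral_dirac//; last exact/measurable_EFinP.
    by rewrite diracT mul1e.
  exact: cvg_cst.
rewrite /normal_law (negbTE v_neq0); set sigma := Num.sqrt v.
have sigma0 : 0 < sigma by rewrite sqrtr_gt0 lt_neqAle eq_sym v_neq0.
have sigma2 : v = sigma ^+ 2 by rewrite sqr_sqrtr.
apply/cvgrPdist_le => e e0.
have e30 : 0 < e / 3 by rewrite divr_gt0.
have [f [C [tf bf fg]]] := smooth_approximation e30 cg sg gM.
have bg : measurable_bounded M g by [].
have h1 : `|gauss sigma g 0 - gauss sigma f 0| <= e / 3.
  by apply: gauss_dist bg bf _ => t; rewrite distrC.
pose D := C * (\sum_k w k * `|zeta k| ^+ 3 + 130 * sigma ^+ 3).
have [N _ ND] : \forall n \near \oo, D / (e / 3) <= Num.sqrt n%:R.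
  near=> n; apply: le_trans (ler_norm _) _; rewrite -sqrtr_sqr ler_wsqrtr//.
  by near: n; exact: nbhs_infty_ger.
exists N.+1 => // -[//|n] /= Nn.
have r0 : 0 < Num.sqrt (n.+1%:R : R) by rewrite sqrtr_gt0.
have h2 : `|word_mean w n.+1 (fun s => f (S n.+1 s)) - gauss sigma f 0| <= e / 3.
  have -> : word_mean w n.+1 (fun s => f (S n.+1 s)) =
      iter n.+1 (average w (fun k => zeta k / Num.sqrt n.+1%:R)) f 0.
    rewrite -word_mean_iter; apply: eq_word_mean => s _.
    by rewrite add0r /S mulr_suml.
  apply: le_trans (lindeberg w_ge0 w_sum n 0 sigma0 bf tf zeta_mean sigma2) _.
  by rewrite ler_pdivrMr// [leRHS]mulrC -ler_pdivrMr//; apply: ND; exact: ltnW.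
have h3 : `|word_mean w n.+1 (fun s => f (S n.+1 s)) -
    word_mean w n.+1 (fun s => g (S n.+1 s))| <= e / 3.
  rewrite -word_meanB -[leRHS](word_mean_cst w_sum n.+1).
  by apply: word_mean_norm => // s _; exact: fg.
rewrite -/(gauss sigma g 0).
set A := word_mean _ _ _ in h2 h3; set B := word_mean _ _ _ in h3 *.
rewrite (_ : _ - B = (gauss sigma g 0 - gauss sigma f 0) - (A - gauss sigma f 0) + (A - B));
  last by ring.
apply: le_trans (ler_normD _ _) _.
have := ler_normB (gauss sigma g 0 - gauss sigma f 0) (A - gauss sigma f 0).
by lra.
Unshelve. all: by end_near.
Qed.

Variable F : nat -> seq 'I_m -> R.
Hypothesis F_near : forall e : R, 0 < e -> exists2 t0 : R, 0 < t0 &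
  forall n s, (0 < n)%N -> size s = n -> deviation w s <= t0 ->
    `|F n s - S n s| <= e * Num.sqrt n%:R * deviation w s.

(** Convergence in probability is replaced by a pointwise bound: if [F] and [S] differ by more than
    [d], then either the deviation exceeds [t0], or [eps] times the square root of [n] times the
    deviation exceeds [d]. In both cases a multiple of [n * deviation ^+ 2] is at least [1], and its
    mean is controlled. *)
Lemma word_mean_perturbed (K M : R) (g : R -> R) : continuous g -> supported K g ->
  (forall t, 0 <= g t <= M) ->
  word_mean w n (fun s => g (F n s)) @[n --> \oo] --> \int[nu]_t g t.
Proof.
move=> cg sg gM.
have M0 : 0 <= M by have /andP[] := gM 0; exact: le_trans.
suff H : word_mean w n (fun s => g (F n s)) - word_mean w n (fun s => g (S n s))
    @[n --> \oo] --> (0 : R).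
  rewrite (_ : (fun n => _) = (fun n => (word_mean w n (fun s => g (F n s)) -
      word_mean w n (fun s => g (S n s))) + word_mean w n (fun s => g (S n s)))).
    by rewrite -[X in _ --> X]add0r; exact: (cvgD H (word_mean_clt cg sg gM)).
  by apply/funext => n; rewrite subrK.
apply/cvgrPdist_le => e e0.
have e20 : 0 < e / 2 by rewrite divr_gt0.
have [d d0 ge] := supported_unif_continuous e20 cg sg.
(* The added [1] keeps [L] positive when [M] or [m] is zero. *)
pose L : R := M * (m * m)%:R + 1.
have L0 : 0 < L by rewrite ltr_pwDr// mulr_ge0.
(* The ratio [eps / d] is at most [1] and at most [e / (4 L)], so [L (eps / d) ^+ 2 <= e / 4]. *)
pose eps : R := d * Num.min 1 (e / (4 * L)).
have u0 : 0 < e / (4 * L) by rewrite divr_gt0// mulr_gt0.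
have eps0 : 0 < eps by rewrite mulr_gt0// lt_min ltr01.
have epsd : L * (eps / d) ^+ 2 <= e / 4.
  rewrite /eps mulrAC divff ?gt_eqF// mul1r.
  have a1 : Num.min 1 (e / (4 * L)) <= 1 by rewrite ge_min lexx.
  have a2 : Num.min 1 (e / (4 * L)) <= e / (4 * L) by rewrite ge_min lexx orbT.
  have a0 : 0 <= Num.min 1 (e / (4 * L)) by rewrite le_min ler01 ltW.
  apply: (@le_trans _ _ (L * (e / (4 * L)))).
    rewrite ler_pM2l// expr2; apply: le_trans a2.
    by rewrite ler_piMr.
  by rewrite le_eqVlt; apply/orP; left; apply/eqP; field; rewrite gt_eqF.
have [t0 t00 Ft] := F_near eps0.
have [N _ NL] : \forall n \near \oo, L / t0 ^+ 2 / (e / 4) <= n%:R.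
  by near=> n; near: n; exact: nbhs_infty_ger.
exists N.+1 => // -[//|n] Nn; rewrite sub0r normrN.
have nR : 0 < n.+1%:R :> R by [].
have e40 : 0 < e / 4 by rewrite divr_gt0.
rewrite -word_meanB.
pose c : R := M * ((t0 ^+ 2 * n.+1%:R)^-1 + (eps / d) ^+ 2).
have c0 : 0 <= c.
  by rewrite mulr_ge0// addr_ge0 ?sqr_ge0// invr_ge0 mulr_ge0 ?sqr_ge0.
apply: (@le_trans _ _ (word_mean w n.+1 (fun s =>
    e / 2 + c * (n.+1%:R * deviation w s ^+ 2)))).
  apply: word_mean_norm => // s sn; have := ge (F n.+1 s) (S n.+1 s).
  set r := `|F _ _ - _|; have dev0 : 0 <= deviation w s by exact: sumr_ge0.
  have q0 : 0 <= n.+1%:R * deviation w s ^+ 2 by rewrite mulr_ge0 ?sqr_ge0.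
  have [rd /(_ isT) gd|dr _] := leP r d.
    by apply: (le_trans gd); rewrite lerDl mulr_ge0.
  have gM1 : `|g (F n.+1 s) - g (S n.+1 s)| <= M.
    have := gM (F n.+1 s); have := gM (S n.+1 s).
    by rewrite ler_norml => /andP[? ?] /andP[? ?]; apply/andP; split; lra.
  apply: (le_trans gM1); rewrite -[leLHS]add0r lerD ?(ltW e20)//.
  rewrite /c -mulrA -[leLHS]mulr1 ler_wpM2l// mulrDl.
  have [devt|devt] := leP (deviation w s) t0.
    have := Ft n.+1 s isT sn devt; rewrite -/r => rle.
    have drle : d <= eps * Num.sqrt n.+1%:R * deviation w s by apply: ltW (lt_le_trans dr rle).
    have : 1 <= (eps * Num.sqrt n.+1%:R * deviation w s / d) ^+ 2.
      by apply: exprn_ege1; rewrite ler_pdivlMr// mul1r.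
    have -> : (eps * Num.sqrt n.+1%:R * deviation w s / d) ^+ 2 =
        (eps / d) ^+ 2 * (Num.sqrt n.+1%:R ^+ 2 * deviation w s ^+ 2).
      by field; rewrite gt_eqF.
    rewrite sqr_sqrtr// => /le_trans; apply; rewrite lerDr mulr_ge0//.
    by rewrite invr_ge0 mulr_ge0 ?sqr_ge0.
  have : 1 <= (t0 ^+ 2 * n.+1%:R)^-1 * (n.+1%:R * deviation w s ^+ 2).
    rewrite -[leRHS]mulrC ler_pdivlMr ?mulr_gt0 ?exprn_gt0// mul1r mulrC ler_pM2l//.
    by rewrite lerXn2r ?nnegrE ?(ltW t00) ?(ltW devt).
  by move=> /le_trans; apply; rewrite lerDl mulr_ge0 ?sqr_ge0.
rewrite word_meanD word_mean_cst// !word_meanZ.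
apply: (@le_trans _ _ (e / 2 + c * (m * m)%:R)).
  by rewrite lerD2l ler_wpM2l// deviation_sqr_mean.
have cL : c * (m * m)%:R <= L / t0 ^+ 2 / n.+1%:R + L * (eps / d) ^+ 2.
  have -> : L / t0 ^+ 2 / n.+1%:R + L * (eps / d) ^+ 2 =
      L * ((t0 ^+ 2 * n.+1%:R)^-1 + (eps / d) ^+ 2).
    by rewrite mulrDr [X in _ = L * X + _]invfM [in RHS]mulrA.
  rewrite /c mulrAC ler_wpM2r ?lerDl//.
  by rewrite addr_ge0 ?sqr_ge0// invr_ge0 mulr_ge0 ?sqr_ge0.
have tL : L / t0 ^+ 2 / n.+1%:R <= e / 4.
  by rewrite ler_pdivrMr// [leRHS]mulrC -ler_pdivrMr//; apply: NL; exact: ltnW.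
apply: (@le_trans _ _ (e / 2 + (e / 4 + e / 4))); last by lra.
by rewrite lerD2l; apply: le_trans cL (lerD tL epsd).
Unshelve. all: by end_near.
Qed.

Let cutoff (K t : R) : R := Num.max 0 (Num.min 1 (K + 1 - `|t|)).

Let cutoff01 K t : 0 <= cutoff K t <= 1.
Proof. by rewrite /cutoff le_max lexx/= ge_max ler01 ge_min lexx. Qed.

Let cutoff_in K t : `|t| <= K -> cutoff K t = 1.
Proof.
by move=> tK; rewrite /cutoff min_l ?max_r//; lra.
Qed.

Let cutoff_supported K : supported (K + 1) (cutoff K).
Proof.
by move=> t tK; rewrite /cutoff max_l// ge_min; apply/orP; right; lra.
Qed.

Let cutoff_continuous K : continuous (cutoff K).
Proof.
move=> t; rewrite /cutoff.
apply: (@continuous_max R R (cst 0) (fun t => Num.min 1 (K + 1 - `|t|))).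
  exact: cst_continuous.
apply: (@continuous_min R R (cst 1) (fun t => K + 1 - `|t|)); first exact: cst_continuous.
by apply: cvgB; [exact: cvg_cst|apply: cvg_norm; exact: cvg_id].
Qed.

Let nu_integrable (f : R -> R) (M : R) : continuous f -> (forall t, `|f t| <= M) ->
  nu.-integrable setT (EFin \o f).
Proof.
move=> cf fM; apply: (@bounded_integrable _ _ R nu f M) => //.
exact: continuous_measurable_fun.
Qed.

(** The masses of the intervals [[-n, n]] increase to one, and the cutoff dominates their
    indicators. *)
Lemma normal_law_tight (e : R) : 0 < e ->
  exists2 K, 0 <= K & 1 - e <= \int[nu]_t cutoff K t.
Proof.
move=> e0; pose I n : set (measurableTypeR R) := `[- n%:R, n%:R]%classic.
have mI n : measurable (I n) by exact: measurable_itv.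
have Icvg : nu (I n) @[n --> \oo] --> nu (\bigcup_n I n).
  apply: nondecreasing_cvg_mu => //; first exact: bigcup_measurable.
  apply/nondecreasing_seqP => n; apply/subsetPset => t /=.
  rewrite /I/= !in_itv/= => /andP[t1 t2]; have : n%:R <= n.+1%:R :> R by rewrite ler_nat.
  by move=> nn; apply/andP; split; lra.
have IT : \bigcup_n I n = setT.
  apply/seteqP; split => // t _; have [n _ /(_ n (leqnn n)) tn] := nbhs_infty_ger `|t|.
  by exists n => //=; rewrite /I/= in_itv/= -ler_norml.
rewrite IT probability_setT in Icvg.
have [n _ /(_ n (leqnn n)) Hn] : \forall n \near \oo, ((1 - e)%:E <= nu (I n))%E.
  have /fine_cvgP[fin /cvgrPdist_le/(_ _ e0) near1] := Icvg.
  near=> n; rewrite -[X in (_ <= X)%E]fineK; last by near: n; exact: fin.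
  have : `|1 - fine (nu (I n))| <= e by near: n; exact: near1.
  by rewrite lee_fin ler_norml => /andP[_ ?]; lra.
exists n%:R => //; rewrite -lee_fin; apply: (le_trans Hn).
have cK := @cutoff_continuous n%:R.
have cb t : `|cutoff n%:R t| <= 1.
  by have /andP[c0 ?] := cutoff01 n%:R t; rewrite ger0_norm.
have ci := nu_integrable cK cb.
rewrite /Rintegral fineK; last by apply: integrable_fin_num.
rewrite -[X in (nu X <= _)%E]setIT -integral_indic//.
apply: ge0_le_integral => //.
- by apply/measurable_EFinP; exact: measurable_indic.
- by apply/measurable_EFinP; exact: continuous_measurable_fun.
- move=> t _; rewrite lee_fin indicE; case: (boolP (t \in I n)) => [|_].
    by rewrite inE /I/= in_itv/= -ler_norml => tn; rewrite cutoff_in.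
  by case/andP: (cutoff01 n%:R t).
Unshelve. all: by end_near.
Qed.

(* Convergence of the means of compactly supported test functions to the mean
   under a probability measure entails tightness, tested on a cutoff. *)
Theorem word_mean_limit (f : R -> R) : continuous f -> bounded_fun f ->
  word_mean w n (fun s => f (F n s)) @[n --> \oo] --> \int[nu]_t f t.
Proof.
move=> cf [B0 [_ fB0]].
pose B := `|B0| + 1.
have fB t : `|f t| <= B by apply: (fB0 B) => //; rewrite /B (le_lt_trans (ler_norm _))// ltrDl.
have B1 : 0 < B by rewrite ltr_pwDr.
apply/cvgrPdist_le => e e0.
(* With [2 B e' = e / 8], the part cut off contributes at most [e / 8] under the limit law and
   [e / 4] over words. *)
pose e' := e / (16 * B).
have e'0 : 0 < e' by rewrite divr_gt0// mulr_gt0.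
have Be' : 2 * B * e' = e / 8 by rewrite /e'; field; rewrite gt_eqF.
have [K K0 Kt] := normal_law_tight e'0.
have cK := @cutoff_continuous K; have sK := @cutoff_supported K.
have c01 := cutoff01 K.
(* The shift by [B] makes the truncated function nonnegative, as [word_mean_perturbed] requires. *)
pose g t := (f t + B) * cutoff K t.
have cg : continuous g.
  move=> t; apply: cvgM; last exact: cK.
  by apply: cvgD; [exact: cf|exact: cvg_cst].
have sg : supported (K + 1) g by move=> t Kt'; rewrite /g sK ?mulr0.
have fB2 t : 0 <= f t + B <= 2 * B.
  by have := fB t; rewrite ler_norml => /andP[? ?]; apply/andP; split; lra.
have gB t : 0 <= g t <= 2 * B.
  have /andP[f1 f2] := fB2 t; have /andP[c0 c1] := c01 t.
  by rewrite mulr_ge0//= -[leRHS]mulr1 ler_pM.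
have hg := word_mean_perturbed cg sg gB.
have hc := word_mean_perturbed cK sK c01.
have gb t : `|g t| <= 2 * B by have /andP[? ?] := gB t; rewrite ger0_norm.
have cb t : `|cutoff K t| <= 1 by have /andP[? ?] := c01 t; rewrite ger0_norm.
have ig := nu_integrable cg gb; have ic := nu_integrable cK cb; have if_ := nu_integrable cf fB.
have [ic1 Ec1] := affine_integral (2 * B) (- (2 * B)) ic.
have [if1 Ef1] := affine_integral B 1 if_.
have ifg : nu.-integrable setT (EFin \o (fun t => (B + 1 * f t) - g t)).
  exact: (integrableB measurableT if1 ig).
have rest0 t : 0 <= (B + 1 * f t) - g t <= 2 * B + - (2 * B) * cutoff K t.
  rewrite (_ : (B + 1 * f t) - g t = (f t + B) * (1 - cutoff K t)); last by rewrite /g; ring.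
  rewrite (_ : 2 * B + - (2 * B) * cutoff K t = 2 * B * (1 - cutoff K t)); last by ring.
  have /andP[f1 f2] := fB2 t; have /andP[c0 c1] := c01 t.
  by rewrite mulr_ge0 ?subr_ge0//= ler_wpM2r// subr_ge0.
have restI : 0 <= B + \int[nu]_t f t - \int[nu]_t g t <= e / 8.
  have -> : B + \int[nu]_t f t - \int[nu]_t g t = \int[nu]_t ((B + 1 * f t) - g t).
    by rewrite RintegralB// Ef1 mul1r.
  apply/andP; split; first by apply: Rintegral_ge0 => t _; case/andP: (rest0 t).
  apply: (@le_trans _ _ (\int[nu]_t (2 * B + - (2 * B) * cutoff K t))).
    by apply: le_Rintegral => // t _; case/andP: (rest0 t).
  rewrite Ec1; have : 2 * B * (1 - e') <= 2 * B * \int[nu]_t cutoff K t.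
    by rewrite ler_pM2l ?mulr_gt0.
  by rewrite mulrBr Be'; lra.
near=> n.
have hgn : `|\int[nu]_t g t - word_mean w n (fun s => g (F n s))| <= e / 8.
  near: n; move/cvgrPdist_le : hg; apply; exact: divr_gt0.
have hcn : `|\int[nu]_t cutoff K t - word_mean w n (fun s => cutoff K (F n s))| <= e'.
  by near: n; move/cvgrPdist_le : hc; apply.
have restW : 0 <= B + word_mean w n (fun s => f (F n s))
    - word_mean w n (fun s => g (F n s)) <= e / 4.
  have -> : B + word_mean w n (fun s => f (F n s)) - word_mean w n (fun s => g (F n s)) =
      word_mean w n (fun s => (B + 1 * f (F n s)) - g (F n s)).
    by rewrite word_meanB word_meanD word_mean_cst// word_meanZ mul1r.
  apply/andP; split.
    rewrite -[leLHS](word_mean_cst w_sum n); apply: word_mean_le => // s _.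
    by case/andP: (rest0 (F n s)).
  apply: (@le_trans _ _ (word_mean w n (fun s => 2 * B + - (2 * B) * cutoff K (F n s)))).
    by apply: word_mean_le => // s _; case/andP: (rest0 (F n s)).
  rewrite word_meanD word_mean_cst// word_meanZ.
  have : 2 * B * (1 - e' - e') <= 2 * B * word_mean w n (fun s => cutoff K (F n s)).
    by rewrite ler_pM2l ?mulr_gt0//; move: hcn; rewrite ler_norml => /andP[_ ?]; lra.
  by rewrite !mulrBr Be'; lra.
move: hgn; rewrite ler_norml => /andP[g1 g2].
move: restI => /andP[i1 i2]; move: restW => /andP[w1 w2].
clear - g1 g2 i1 i2 w1 w2; by rewrite ler_norml; apply/andP; split; lra.
Unshelve. all: by end_near.
Qed.

End word_limits.

(** * Samples *)

Section sampling_words.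
Context {d' d1 : measure_display} {Omega : measurableType d'} {T : measurableType d1}.
Context {R : realType} {m : nat}.
Variables (Pr : probability Omega R) (P : probability T R).
Variables (X : nat -> {RV Pr >-> T}) (label : T -> 'I_m) (w : 'I_m -> R) (i0 : 'I_m).
Hypothesis X_iid : iid X P.
Hypothesis mlabel : forall j, measurable (label @^-1` [set j]).
Hypothesis label_law : forall j, P (label @^-1` [set j]) = (w j)%:E.

Definition sample_word n (o : Omega) : seq 'I_m := [seq label (X k o) | k <- iota 0 n].

Lemma size_sample_word n o : size (sample_word n o) = n.
Proof. by rewrite size_map size_iota. Qed.

(** [independent_seq] asks for a measurable set at every index; beyond the length of the word it is
    the whole space. *)
Let factor n (t : n.-tuple 'I_m) k : set T :=
  if (k < n)%N then label @^-1` [set nth i0 t k] else setT.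

Let measurable_factor n (t : n.-tuple 'I_m) k : measurable (factor t k).
Proof. by rewrite /factor; case: ifP. Qed.

Let word_event n (t : n.-tuple 'I_m) :
  [set o | sample_word n o = t] = \bigcap_(k in [set` iota 0 n]) (X k @^-1` factor t k).
Proof.
apply/seteqP; split => o /=.
  move=> ot k /=; rewrite mem_iota add0n => /andP[_ kn]; rewrite /factor kn/= -ot.
  by rewrite (nth_map 0%N) ?size_iota// nth_iota.
move=> H; apply: (@eq_from_nth _ i0) => [|k]; rewrite size_sample_word ?size_tuple// => kn.
have /= := H k; rewrite mem_iota add0n kn => /(_ isT); rewrite /factor kn/= => <-.
by rewrite (nth_map 0%N) ?size_iota// nth_iota.
Qed.

Lemma measurable_word_event n (t : n.-tuple 'I_m) : measurable [set o | sample_word n o = t].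
Proof.
rewrite word_event; apply: fin_bigcap_measurable => // k _.
rewrite -[X in measurable X]setTI.
exact: (measurable_funP (X k)).
Qed.

Lemma word_event_prob n (t : n.-tuple 'I_m) :
  Pr [set o | sample_word n o = t] = (\prod_(k <- t) w k)%:E.
Proof.
rewrite word_event; have [indep law] := X_iid.
rewrite indep ?iota_uniq// -prodEFin.
rewrite -[in RHS](mkseq_nth i0 t) size_tuple big_map.
rewrite [LHS]big_seq [RHS]big_seq; apply: eq_bigr => k; rewrite mem_iota add0n => /andP[_ kn].
by rewrite -label_law -[LHS]/(distribution Pr (X k) (factor t k)) law// /factor kn.
Qed.

(** A function of the word is a finite combination of indicators, so its measurability and its mean
    require no condition on [G]. *)
Lemma sample_word_expansion n (G : seq 'I_m -> R) o :
  G (sample_word n o) = \sum_(t : n.-tuple 'I_m) G t * \1_[set o | sample_word n o = t] o.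
Proof.
have sz : size (sample_word n o) == n by rewrite size_sample_word.
rewrite (bigD1 (Tuple sz))//= indicE mem_set// mulr1 big1 ?addr0// => t tn.
rewrite indicE memNset ?mulr0//= => e; move/eqP: tn; apply.
exact/val_inj/esym.
Qed.

Lemma measurable_sample_word n (G : seq 'I_m -> R) :
  measurable_fun setT (fun o => G (sample_word n o)).
Proof.
under eq_fun do rewrite sample_word_expansion.
apply: measurable_sum => t; apply: measurable_funM => //.
exact/measurable_indic/measurable_word_event.
Qed.

Lemma sample_word_mean n (G : seq 'I_m -> R) :
  (\int[Pr]_o (G (sample_word n o))%:E = (word_mean w n G)%:E)%E.
Proof.
under eq_integral do rewrite sample_word_expansion -sumEFin.
have mI (t : n.-tuple 'I_m) : measurable_fun setT
    (fun o => \1_[set o | sample_word n o = t] o : R).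
  exact/measurable_indic/measurable_word_event.
have iI (t : n.-tuple 'I_m) : Pr.-integrable setT
    (fun o => (\1_[set o | sample_word n o = t] o : R)%:E).
  by apply: (@bounded_integrable _ _ _ Pr _ 1) => // o; rewrite ger0_norm// indicE; case: (_ \in _).
rewrite integral_sum//; last first.
  by move=> t; under eq_fun do rewrite EFinM; exact: integrableZl.
rewrite word_meanE -sumEFin; apply: eq_bigr => t _.
under eq_integral do rewrite EFinM.
rewrite integralZl// integral_indic//; last exact: measurable_word_event.
rewrite setIT mulrC EFinM; congr (_ * _)%E; exact: word_event_prob.
Qed.

Lemma empirical_sample_word n o (x : 'I_m -> T) (A : set T) :
  (forall k, X k o = x (label (X k o))) ->
  empirical X n o A =
  (\sum_(k < m) (frequency (R := R) (sample_word n o) ord0 k)%:E * \d_(x k) A)%E.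
Proof.
move=> Xo; rewrite /empirical.
have -> : (\sum_(k < n) \d_(X k o) A = (\sum_(j <- sample_word n o) \1_A (x j) : R)%:E)%E.
  rewrite /sample_word big_map -sumEFin -[X in iota 0 X]subn0 big_mkord.
  by apply: eq_bigr => k _; rewrite -Xo diracE indicE.
rewrite -EFinM mulrC -[in n%:R](size_sample_word n o) -frequency_sum -sumEFin.
by apply: eq_bigr => k _; rewrite EFinM diracE indicE.
Qed.

End sampling_words.

(** * The limiting variance *)

Section normal_law_variance.
Context {R : realType}.

Lemma normal_law_moments (v : R) : 0 <= v -> let nu := normal_law 0 v in
  [/\ nu.-integrable setT (EFin \o id), \int[nu]_t t = 0,
      nu.-integrable setT (EFin \o (fun t => t ^+ 2)) & \int[nu]_t (t ^+ 2) = v].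
Proof.
move=> v0; rewrite /normal_law; have [->|vn0] := eqVneq v 0.
  have m2 : measurable_fun setT (fun t : R => t ^+ 2) by exact: measurable_funX.
  have dint (f : R -> R) : measurable_fun setT f ->
      (\d_(0 : measurableTypeR R) : set _ -> \bar R).-integrable setT (EFin \o f).
    move=> mf; apply/integrableP; split; first exact/measurable_EFinP.
    rewrite integral_dirac//; first by rewrite diracT mul1e ltry.
    by apply: measurableT_comp => //; exact/measurable_EFinP.
  have dE (f : R -> R) : measurable_fun setT f ->
      \int[\d_(0 : measurableTypeR R)]_t f t = f 0.
    move=> mf; rewrite /Rintegral integral_dirac//; last exact/measurable_EFinP.
    by rewrite diracT mul1e.
  by split; rewrite ?dE ?expr0n//; exact: dint.
set s := Num.sqrt v.
have s0 : 0 < s by rewrite sqrtr_gt0 lt_neqAle eq_sym vn0.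
have v2 : v = s ^+ 2 by rewrite sqr_sqrtr.
have [a1 b1] := affine_integral 0 s (normal_integrable_standardize 0 s0).
have [a2 b2] := affine_integral 0 (s ^+ 2) (normal_integrable_standardize_sqr 0 s0).
have e1 : (fun y => 0 + s * ((y - 0) / s)) = id.
  by apply/funext => y /=; field; rewrite gt_eqF.
have e2 : (fun y => 0 + s ^+ 2 * ((y - 0) / s) ^+ 2) = (fun y => y ^+ 2).
  by apply/funext => y; field; rewrite gt_eqF.
rewrite e1 in a1 b1; rewrite e2 in a2 b2.
split => //.
  by rewrite b1 normal_moment1// mulr0 addr0.
by rewrite b2 normal_moment2// mulr1 add0r -v2.
Qed.

(** The variance in the statement is that of a linear form of a Gaussian vector, known only through
    its law; its moments are computed by push-forward. *)
Lemma variance_normal_law (d : measure_display) (T : measurableType d)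
    (P : probability T R) (Y : T -> measurableTypeR R) (v : R) :
  0 <= v -> measurable_fun setT Y ->
  (forall A : set (measurableTypeR R), measurable A -> P (Y @^-1` A) = normal_law 0 v A) ->
  'V_P[Y] = v%:E.
Proof.
move=> v0 mY law; have [i1 m1 i2 m2] := normal_law_moments v0.
have push (f : measurableTypeR R -> \bar R) : measurable_fun setT f -> (forall y, 0 <= f y)%E ->
    (\int[P]_t f (Y t) = \int[normal_law 0 v]_y f y)%E.
  move=> mf f0; transitivity (\int[pushforward P Y]_y f y)%E.
    by rewrite ge0_integral_pushforward// => y _.
  by apply: eq_measure_integral => A mA _; exact: law.
have iY : P.-integrable setT (EFin \o Y).
  apply/integrableP; split; first exact/measurable_EFinP.
  rewrite (push (fun y => `|y%:E|)%E)//; last by apply: measurableT_comp.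
  by case/integrableP : i1.
have EY : (\int[P]_t (Y t)%:E = 0)%E.
  transitivity (\int[pushforward P Y]_y y%:E)%E.
    by rewrite integral_pushforward.
  rewrite (eq_measure_integral (normal_law 0 v)); last by move=> A mA _; exact: law.
  rewrite -[LHS]fineK; last exact: integrable_fin_num.
  by congr EFin.
rewrite /variance covariance.unlock expectation.unlock /= EY /=.
transitivity (\int[P]_t (Y t ^+ 2)%:E)%E.
  by apply: eq_integral => t _; rewrite /= mulrfctE/= subr0 expr2.
rewrite (push (fun y => (y ^+ 2)%:E)); last 2 first.
- by apply/measurable_EFinP; exact: measurable_funX.
- by move=> y; rewrite lee_fin sqr_ge0.
rewrite -[LHS]fineK; last exact: integrable_fin_num.
by congr EFin.
Qed.

End normal_law_variance.

(** Both sides are the variance of a variable equal to [z k] with probability [p k]; the right one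
    is the variance of the summands in the central limit theorem. *)
Lemma multinomial_variance (R : realType) (m : nat) (p z : 'rV[R]_m) :
  \sum_k p ord0 k = 1 ->
  (z *m multinomial_cov p *m z^T) ord0 ord0 =
  \sum_k p ord0 k * (z ord0 k - \sum_j p ord0 j * z ord0 j) ^+ 2.
Proof.
move=> p1; set zb := \sum_j p ord0 j * z ord0 j.
have expand (b : R) : \sum_k p ord0 k * (z ord0 k - b) ^+ 2 =
    \sum_k p ord0 k * z ord0 k ^+ 2 - 2 * b * zb + b ^+ 2.
  rewrite -[b ^+ 2 in RHS]mulr1 -[X in _ + _ * X]p1 /zb !mulr_sumr -sumrB -big_split/=.
  by apply: eq_bigr => k _; ring.
rewrite expand mxE.
transitivity (\sum_k (p ord0 k * z ord0 k ^+ 2 - zb * (p ord0 k * z ord0 k))); last first.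
  by rewrite sumrB -mulr_sumr -/zb; ring.
apply: eq_bigr => j _; rewrite !mxE.
have -> : \sum_i z ord0 i * multinomial_cov p i j = p ord0 j * z ord0 j - p ord0 j * zb.
  rewrite /zb mulr_sumr (bigD1 j)//= [X in _ = _ - X](bigD1 j)//= !mxE eqxx.
  rewrite opprD addrA -sumrN; congr (_ + _); first by ring.
  by apply: eq_bigr => i ij; rewrite !mxE (negPf ij); ring.
by ring.
Qed.

(** * Labelling sample points by atoms *)

Section atom_label.
Context {R : realType} {d m : nat}.
Variables (x : 'I_m -> 'rV[R]_d) (i0 : 'I_m).
Hypothesis x_inj : injective x.
Local Notation E := (borelRV R d).

(** Points that are not atoms get the default label [i0]; the sample almost surely avoids them. *)
Definition atom_label (y : E) : 'I_m := odflt i0 [pick k | x k == y].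

Lemma atom_labelK k : atom_label (x k) = k.
Proof.
by rewrite /atom_label; case: pickP => [j /eqP/x_inj //|/(_ k)]; rewrite eqxx.
Qed.

Let fixed : set E := \bigcup_(k in [set: 'I_m]) [set x k].

Let fixedP y : fixed y <-> y = x (atom_label y).
Proof.
split=> [[k _ ->]|->]; first by rewrite atom_labelK.
by exists (atom_label y).
Qed.

Let measurable_fixed : measurable fixed.
Proof. by apply: fin_bigcup_measurable => // k _; exact: measurable_point. Qed.

Lemma measurable_atom_label j : measurable (atom_label @^-1` [set j]).
Proof.
(* The preimage of [j] is the atom [x j], together with all non-atoms when [j = i0]. *)
rewrite (_ : atom_label @^-1` [set j] =
    [set x j : E] `|` (~` fixed `&` [set _ | j = i0])); last first.
  apply/seteqP; split => y /= => [yj|[->|[yf ->]]].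
  - have [/fixedP ->|yf] := pselect (fixed y); first by left; rewrite yj.
    right; split=> //; rewrite -yj /atom_label; case: pickP => // k /eqP ky.
    by case: yf; exists k.
  - exact: atom_labelK.
  - rewrite /atom_label; case: pickP => // k /eqP ky.
    by case: yf; exists k.
apply: measurableU; first exact: measurable_point.
apply: measurableI; first exact: measurableC.
have [->|ji] := eqVneq j i0.
  by rewrite (_ : [set _ | _] = setT)//; apply/seteqP; split.
rewrite (_ : [set _ | _] = set0)//; apply/seteqP; split=> // y /= ji'.
by rewrite ji' eqxx in ji.
Qed.

Variables (q : 'rV[R]_m) (P : probability E R).
Hypothesis P_atomic : forall A, measurable A -> P A = atomic x q A.

Lemma atom_label_law j : P (atom_label @^-1` [set j]) = (q ord0 j)%:E.
Proof.
rewrite P_atomic; last exact: measurable_atom_label.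
rewrite /atomic (bigD1 j)//= diracE mem_set ?mule1/=; last exact: atom_labelK.
rewrite big1 ?adde0// => k kj; rewrite diracE memNset ?mule0//= atom_labelK.
exact/eqP.
Qed.

Lemma atom_label_ae (d' : measure_display) (Omega : measurableType d')
    (Pr : probability Omega R) (X : nat -> {RV Pr >-> E}) :
  iid X P -> {ae Pr, forall o k, X k o = x (atom_label (X k o))}.
Proof.
move=> [_ law]; apply: ae_foralln => k.
have mX A : measurable A -> measurable (X k @^-1` A).
  by move=> mA; rewrite -[X in measurable X]setTI; exact: (measurable_funP (X k)).
exists (X k @^-1` ~` fixed); split.
- by apply: mX; exact: measurableC.
- rewrite -[LHS]/(distribution Pr (X k) (~` fixed)) law; last exact: measurableC.
  rewrite P_atomic; last exact: measurableC.
  apply: big1 => j _; rewrite diracE memNset ?mule0//=; apply.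
  by exists j.
- by move=> o /= H /fixedP.
Qed.

End atom_label.

(** * The limit law of the empirical transport cost *)

Theorem theorem3p2 (R : realType) (d m : nat)
  (x : 'I_m -> 'rV[R]_d) (p : 'rV[R]_m)
  (P Q : probability (borelRV R d) R)
  (h : 'rV[R]_d -> R)
  (d_gt0 : (0 < d)%N)
  (x_inj : injective x)
  (p_gt0 : forall k, 0 < p ord0 k)
  (p_sum : \sum_(k < m) p ord0 k = 1)
  (P_def : forall A : set (borelRV R d), measurable A ->
     P A = (\sum_(k < m) (p ord0 k)%:E * \d_(x k : borelRV R d) A)%E)
  (Q_ac : Q `<< lebesgueRV)
  (Q_supp : connected (supp Q))
  (Q_frontier : lebesgueRV (frontier (supp Q)) = 0%E)
  (h_ge0 : forall y, 0 <= h y)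
  (A1 : strictly_convex h)
  (A2 : cone_condition h)
  (A3 : superlinear h)
  (c_int : forall i, (\int[Q]_y (h (x i - y))%:E < +oo)%E)
  (dO : measure_display) (Omega : measurableType dO)
  (Pr : probability Omega R)
  (X : nat -> {RV Pr >-> borelRV R d})
  (X_iid : iid X P)
  (dG : measure_display) (OmegaG : measurableType dG)
  (PG : probability OmegaG R)
  (G : 'I_m -> {RV PG >-> R})
  (G_gauss : centered_gaussian_vector G (multinomial_cov p))
  (z : 'rV[R]_m) :
  let c := fun a b : 'rV[R]_d => h (a - b) in
  z \in Opt c x p P Q ->
  cvg_in_distribution Pr
    (fun n w => (Num.sqrt n%:R)%:E *
       (transport_cost c (empirical X n w) Q - transport_cost c P Q))%E
    (normal_law 0 (fine 'V_PG[linear_comb G z])).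
Proof.
move=> c /set_mem zO.
have ch := strictly_convex_continuous A1.
have m0 : (0 < m)%N.
  rewrite lt0n; apply/eqP => m0; subst m; move: p_sum; rewrite big_ord0 => /esym/eqP.
  by rewrite oner_eq0.
pose i0 : 'I_m := Ordinal m0.
have PE A : measurable A -> P A = atomic x p A by exact: P_def.
have expansion e : 0 < e -> _ := @transport_cost_expansion R d m x h P Q p z e
  x_inj h_ge0 ch c_int Q_supp p_gt0 p_sum PE zO.
pose label := atom_label x i0.
have mlabel := measurable_atom_label i0 x_inj.
have llaw := atom_label_law i0 x_inj PE.
pose T (P' : set (borelRV R d) -> \bar R) := transport_cost c P' Q.
(* The statistic as a function of the word of labels; composed with the random word it is
   measurable, there being finitely many words of length [n]. *)
pose F n (s : seq 'I_m) : R :=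
  Num.sqrt n%:R * (fine (T (atomic x (frequency s))) - fine (T P)).
pose word n o := sample_word X label n o.
pose zb := \sum_j p ord0 j * z ord0 j.
(* Frequencies and [p] have the same total, so subtracting [zb] leaves the linear term unchanged
   while centring the summands. *)
pose zeta k := z ord0 k - zb.
pose w k := p ord0 k.
have zeta_mean : \sum_k w k * zeta k = 0.
  under eq_bigr do rewrite mulrBr.
  by rewrite sumrB -mulr_suml p_sum mul1r subrr.
have F_near e : 0 < e -> exists2 t0 : R, 0 < t0 & forall n (s : seq 'I_m),
    (0 < n)%N -> size s = n -> deviation w s <= t0 ->
    `|F n s - (\sum_(k <- s) zeta k) / Num.sqrt n%:R| <=
      e * Num.sqrt n%:R * deviation w s.
  move=> /expansion[t0 t00 H]; exists t0 => // n s n0 sn st.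
  have s0 : size s != 0%N by rewrite sn -lt0n.
  have [_ _ r0 /(_ st) r1] := H (atomic x (frequency s)) (frequency s)
    (frequency_ge0 s) (frequency_total s0) (fun _ _ => erefl).
  have sq0 : 0 < Num.sqrt (n%:R : R) by rewrite sqrtr_gt0 ltr0n.
  have zE : (\sum_(k <- s) zeta k) / Num.sqrt n%:R =
      Num.sqrt n%:R * \sum_k (frequency s ord0 k - p ord0 k) * z ord0 k.
    transitivity (Num.sqrt n%:R * ((\sum_(k <- s) zeta k) / (size s)%:R)).
      rewrite sn -[X in _ = _ * (_ / X)](sqr_sqrtr (ler0n R n)); field; exact: lt0r_neq0.
    congr (_ * _); rewrite -frequency_sum.
    transitivity (\sum_k frequency s ord0 k * z ord0 k - zb * \sum_k frequency s ord0 k).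
      by rewrite mulr_sumr -sumrB; apply: eq_bigr => k _; rewrite /zeta; ring.
    by rewrite (frequency_total s0) mulr1 /zb -sumrB; apply: eq_bigr => k _; ring.
  rewrite zE /F -mulrBr normrM (gtr0_norm sq0) ger0_norm// [e * _]mulrC -mulrA.
  by rewrite ler_pM2l.
have mZ n : measurable_fun setT (fun o => F n (word n o)).
  exact: (measurable_sample_word X i0 mlabel n (F n)).
pose Z n : {RV Pr >-> R} := mfun_Sub (mem_set (mZ n)).
exists Z.
  move=> n; have := atom_label_ae i0 x_inj PE X_iid; apply: filterS => o oX.
  rewrite -[Z n o]/(F n (word n o)) /F.
  (* For [n = 0] the empirical set function is zero and admits no coupling, so its transport cost is
     [+oo]; the factor [sqrt 0] annihilates it. *)
  have [->|n0] := posnP n; first by rewrite sqrtr0 mul0e mul0r.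
  (* The tolerance [1] is arbitrary: only the finiteness of both costs is extracted. *)
  have [t0 _ H] := expansion 1 ltr01.
  have s0 : size (word n o) != 0%N by rewrite size_sample_word -lt0n.
  have eE A : measurable A -> empirical X n o A = atomic x (frequency (word n o)) A.
    by move=> _; exact: empirical_sample_word.
  have [f1 f2 _ _] := H (empirical X n o) _ (frequency_ge0 _) (frequency_total s0) eE.
  have TE : T (empirical X n o) = T (atomic x (frequency (word n o))).
    rewrite /T /transport_cost; congr (ereal_inf [set _ | pi in _]).
    apply/seteqP; split => pi [pi1 pi2]; split=> // A mA.
      by rewrite pi1// eE.
    by rewrite pi1// -eE.
  rewrite -/(T _) -/(T _) -TE EFinM EFinB !fineK//.
move=> f cf bf.
have mf : measurable_fun setT f := continuous_measurable_fun cf.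
have [B [_ fB0]] := bf.
have fB t : `|f t| <= `|B| + 1.
  by apply: fB0 => //; rewrite (le_lt_trans (ler_norm _))// ltrDl.
have V0 : 0 <= \sum_k w k * zeta k ^+ 2.
  by apply: sumr_ge0 => k _; rewrite mulr_ge0 ?sqr_ge0// ltW.
have -> : 'V_PG[linear_comb G z] = (\sum_k w k * zeta k ^+ 2)%:E.
  apply: variance_normal_law => //.
    rewrite /linear_comb; apply: measurable_sum => k.
    by apply: measurable_funM => //; exact: measurable_funP.
  by move=> A mA; rewrite G_gauss// multinomial_variance.
set nu := normal_law 0 _.
have -> : (\int[nu]_y (f y)%:E = (\int[nu]_y f y)%:E)%E.
  rewrite /Rintegral fineK//; apply: integrable_fin_num => //.
  exact: (bounded_integrable nu mf fB).
have EZ n : ('E_Pr[f \o Z n] = (word_mean w n (fun s => f (F n s)))%:E)%E.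
  rewrite expectation.unlock.
  exact: (sample_word_mean i0 X_iid mlabel llaw n (fun s => f (F n s))).
under eq_fun do rewrite EZ.
apply: cvg_EFin; first by apply: nearW.
exact: (word_mean_limit p_gt0 p_sum zeta_mean F_near cf bf).
Qed.
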